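(* Assume that the Nicholson system $$y_i'(t)=-\tilde d_i(t)\,y_i(t)+\sum_{j=1}^m \tilde a_{ij}(t)\,y_j(t)+\tilde\beta_i(t)\,y_i(t-r_i)\,e^{-\tilde c_i(t)\,y_i(t-r_i)},\quad t\ge 0,\quad i=1,\ldots,m,$$ with delays $r_i>0$, satisfies assumptions (a1)--(a6) listed in the context and is uniformly persistent at $0$. Then there exists a global attractor for the induced skew-product semiflow $\tau$, $\tau(t,\omega,\varphi)=(\omega\cdot t,y_t(\omega,\varphi))$, in $\Omega\times\operatorname{Int}X_+$ with respect to the class of compact subsets of $\operatorname{Int}X_+$. That is, there is a compact set $\mathbb{A}\subset\Omega\times\operatorname{Int}X_+$ such that $\tau_t(\mathbb{A})=\mathbb{A}$ for all $t\ge 0$ and $\lim_{t\to\infty}\mathrm{dist}(\tau_t(\Omega\times X_1),\mathbb{A})=0$ for every compact $X_1\subset\operatorname{Int}X_+$.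
   Context: Almost periodicity: a continuous function $h:\mathbb{R}\to\mathbb{R}$ is almost periodic if for every $\varepsilon>0$ the set $\{s\in\mathbb{R}: |h(t+s)-h(t)|<\varepsilon \text{ for all } t\in\mathbb{R}\}$ is relatively dense in $\mathbb{R}$. Assumptions on the coefficients: (a1) $\tilde d_i,\tilde a_{ij},\tilde c_i,\tilde\beta_i$ are almost periodic functions on $\mathbb{R}$; (a2) there is a constant $d_0>0$ with $\tilde d_i(t)\ge d_0$ for each $t\in\mathbb{R}$ and $i\in\{1,\dots,m\}$; (a3) all $\tilde a_{ij}(t)$ are nonnegative functions and $\tilde a_{ii}$ is identically null; (a4) $\tilde\beta_i(t)>0$ for each $t\in\mathbb{R}$ and $i$; (a5) there is a constant $c_0>0$ with $\tilde c_i(t)\ge c_0$ for each $t\in\mathbb{R}$ and $i$; (a6) $\tilde d_i(t)-\sum_{j=1}^m\tilde a_{ji}(t)>0$ for each $t\in\mathbb{R}$ and $i$. State space: $X=C([-r_1,0])\times\cdots\times C([-r_m,0])$ (real-valued continuous functions) with the supremum norm, $X_+=\{\phi\in X:\phi_i(s)\ge0 \text{ for } s\in[-r_i,0],\ 1\le i\le m\}$, with interior $\operatorname{Int}X_+=\{\phi\in X:\phi_i(s)>0 \text{ for } s\in[-r_i,0],\ 1\le i\le m\}$. $\varphi\ge0$ means $\varphi\in X_+$; for $v\in\mathbb{R}^m$, $v\gg0$ means all components are positive. For a continuous $y:[-r,\infty)\to\mathbb{R}^m$, $r=\max(r_1,\dots,r_m)$, and $t\ge0$, $y_t\in X$ is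 defined by $(y_t)_i(s)=y_i(t+s)$, $s\in[-r_i,0]$. Uniform persistence at $0$: denoting by $y(t,\varphi)$ the solution of the Nicholson system with initial value $\varphi$ (i.e. $y_0=\varphi$), the system is uniformly persistent at $0$ if there exists $M>0$ such that for every $\varphi\ge0$ in $X$ with $\varphi(0)\gg0$ there exists a time $t_0=t_0(\varphi)$ such that $y_i(t,\varphi)\ge M$ for all $t\ge t_0$ and $i=1,\dots,m$. Hull: let $l:\mathbb{R}\to\mathbb{R}^N$ be the map collecting all the coefficients, $l(t)=(\tilde d_i(t),\tilde a_{ij}(t),\tilde\beta_i(t),\tilde c_i(t))$, and let $\Omega$ be its hull, i.e. the closure of the set of time-translates of $l$ in the compact-open topology. $\Omega$ is a compact metric space and $(\omega\cdot t)(s)=\omega(t+s)$ defines a continuous flow on $\Omega$. Define continuous nonnegative maps $d_i,a_{ij},\beta_i,c_i:\Omega\to\mathbb{R}$ by $(d_i(\omega),a_{ij}(\omega),\beta_i(\omega),c_i(\omega))=\omega(0)$. For $\omega\in\Omega$ and $\varphi\in X$, $y(t,\omega,\varphi)$ denotes the solution of $$y_i'(t)=-d_i(\omega\cdot t)\,y_i(t)+\sum_{j=1}^m a_{ij}(\omega\cdot t)\,y_j(t)+\beta_i(\omega\cdot t)\,y_i(t-r_i)\,e^{-c_i(\omega\cdot t)\,y_i(t-r_i)},\quad i=1,\dots,m,$$ with initial value $\varphi$, and $y_t(\omega,\varphi)\in X$ is the corresponding segment at time $t$. For $\varphi\in X_+$ solutions are defined for all $t\ge0$ and $y_t(\omega,\varphi)\in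 X_+$; moreover if $\varphi\ge0$ with $\varphi(0)\gg0$ then $y(t,\omega,\varphi)\gg0$ for all $t\ge0$, so $\Omega\times\operatorname{Int}X_+$ is positively invariant. $\tau_t(\omega,\varphi)=\tau(t,\omega,\varphi)$. Here $\mathrm{dist}$ is the Hausdorff semidistance, $\mathrm{dist}(B,A)=\sup_{b\in B}\inf_{a\in A}d(b,a)$, for a product metric on $\Omega\times X$. *)

(* Defs.v *)
From mathcomp Require Import all_boot all_order all_algebra.
From mathcomp Require Import all_classical all_reals all_analysis.
Set Implicit Arguments.
Unset Strict Implicit.
Unset Printing Implicit Defensive.
Import Order.TTheory GRing.Theory Num.Theory.
Import numFieldNormedType.Exports.
Local Open Scope classical_set_scope.
Local Open Scope ring_scope.

Section AlmostPeriodic.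
Variable R : realType.

Definition relatively_dense (S : set R) : Prop :=
  exists2 L : R, 0 < L & forall x, exists2 s, s \in `[x, x + L] & S s.

Definition almost_periodic (h : R -> R) : Prop :=
  continuous h /\
  forall e, 0 < e ->
    relatively_dense [set s | forall t, `|h (t + s) - h t| < e].

End AlmostPeriodic.

Section StateSpace.
Variables (R : realType) (m : nat) (r : 'I_m -> R).

(* Ambient space of X. A function in C([-r_i, 0]) is represented by its
   extension to R with value 0 outside [-r_i, 0] (see [stateX]), so that the
   uniform topology over all of R is the one of the supremum norm on X. *)
Definition state : Type := {uniform 'I_m -> {uniform R -> R}}.

Definition stateX : set state :=
  [set phi | forall i, {within `[- r i, 0], continuous (phi i : R -> R)} /\
                       (phi i : R -> R) = phi i \_ `[- r i, 0]].

Definition stateX_ge0 : set state :=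
  [set phi | stateX phi /\ forall i s, s \in `[- r i, 0] -> 0 <= phi i s].

Definition stateX_int : set state :=
  [set phi | stateX phi /\ forall i s, s \in `[- r i, 0] -> 0 < phi i s].

Definition sup_dist (phi psi : state) : R :=
  sup [set `|phi p.1 p.2 - psi p.1 p.2| |
         p in [set p : 'I_m * R | p.2 \in `[- r p.1, 0]]].

Definition segment (y : 'I_m -> R -> R) (t : R) : state :=
  fun i => (fun s => y i (t + s)) \_ `[- r i, 0].

End StateSpace.

Section Nicholson.
Variables (R : realType) (m : nat).

Record nicholson := Nicholson {
  decay : 'I_m -> R -> R;                (* d_i *)
  migration : 'I_m -> 'I_m -> R -> R;    (* a_ij *)
  birth : 'I_m -> R -> R;                (* beta_i *)
  crowding : 'I_m -> R -> R              (* c_i *)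
}.

Implicit Types (N : nicholson) (r : 'I_m -> R) (y : 'I_m -> R -> R).

Definition nicholson_rhs N r y (i : 'I_m) (t : R) : R :=
  - decay N i t * y i t + \sum_(j < m) migration N i j t * y j t
  + birth N i t * y i (t - r i) * expR (- crowding N i t * y i (t - r i)).

(* At t = 0 only the right derivative makes sense. *)
Definition is_solution N r (phi : state R m) y : Prop :=
  forall i,
    [/\ {within `[- r i, +oo[, continuous (y i)},
        {in `[- r i, 0], y i =1 phi i},
        h^-1 * (y i h - y i 0) @[h --> 0^'+] --> nicholson_rhs N r y i 0 &
        forall t : R, 0 < t -> is_derive t 1 (y i) (nicholson_rhs N r y i t)].

(* The solution; only its values on the intervals [-r_i, +oo[ are meaningful. *)
Definition solution N r (phi : state R m) : 'I_m -> R -> R :=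
  xget (fun _ _ => 0) [set y | is_solution N r phi y].

Definition uniformly_persistent N r : Prop :=
  exists2 M : R, 0 < M &
    forall phi, stateX_ge0 r phi -> (forall i, 0 < phi i 0) ->
      exists t0 : R, forall t, t0 <= t -> forall i, M <= solution N r phi i t.

End Nicholson.

Section Hull.
Variables (R : realType) (m : nat).

(* R^N, arranged as (d_i, a_ij, beta_i, c_i). *)
Definition coefs : Type := ('rV[R]_m * 'M[R]_m * 'rV[R]_m * 'rV[R]_m)%type.

Definition paths : Type := {compact-open, R -> coefs}.

Definition coef_path (N : nicholson R m) : paths := fun t =>
  (\row_i decay N i t, \matrix_(i, j) migration N i j t,
   \row_i birth N i t, \row_i crowding N i t).

Definition shift (w : paths) (t : R) : paths := fun s => w (t + s).

(* The closure is relative to the continuous maps: [paths] itself also contains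
   discontinuous ones. *)
Definition hull (l : paths) : set paths :=
  [set w | continuous (w : R -> coefs) /\ closure (range (shift l)) w].

Definition hull_decay (w : paths) i : R := (w 0).1.1.1 ord0 i.
Definition hull_migration (w : paths) i j : R := (w 0).1.1.2 i j.
Definition hull_birth (w : paths) i : R := (w 0).1.2 ord0 i.
Definition hull_crowding (w : paths) i : R := (w 0).2 ord0 i.

Definition hull_system (w : paths) : nicholson R m :=
  Nicholson (fun i t => hull_decay (shift w t) i)
            (fun i j t => hull_migration (shift w t) i j)
            (fun i t => hull_birth (shift w t) i)
            (fun i t => hull_crowding (shift w t) i).

Definition skew_product (r : 'I_m -> R) (t : R) (z : paths * state R m) :
    paths * state R m :=
  (shift z.1 t, segment r (solution (hull_system z.1) r z.2) t).

End Hull.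

Section Distances.
Variable R : realType.

(* d is a metric on S inducing the subspace topology of S. *)
Definition metrizes (T : topologicalType) (S : set T) (d : T -> T -> R) : Prop :=
  [/\ forall x y, S x -> S y -> 0 <= d x y /\ (d x y = 0 <-> x = y),
      forall x y, S x -> S y -> d x y = d y x,
      forall x y z, S x -> S y -> S z -> d x z <= d x y + d y z &
      forall x (U : set T), S x ->
        (within S (nbhs x) U <->
         exists2 e, 0 < e & [set y | S y /\ d x y < e] `<=` U)].

Definition max_dist (T1 T2 : Type) (d1 : T1 -> T1 -> R) (d2 : T2 -> T2 -> R)
    (x y : T1 * T2) : R :=
  Num.max (d1 x.1 y.1) (d2 x.2 y.2).

(* The supremum is taken in [0, +oo], so it is 0 for B empty. *)
Definition hausdorff_semidist (T : Type) (d : T -> T -> R) (B A : set T) :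
    \bar R :=
  Order.max 0%E
    (ereal_sup [set ereal_inf [set (d b a)%:E | a in A] | b in B]).

End Distances.

(* Main.v *)
Require Import Defs.
From mathcomp Require Import all_boot all_order all_algebra.
From mathcomp Require Import all_classical all_reals all_analysis.
From mathcomp Require Import ring lra.
Set Implicit Arguments.
Unset Strict Implicit.
Unset Printing Implicit Defensive.
Import Order.TTheory GRing.Theory Num.Theory.
Import numFieldNormedType.Exports.
Local Open Scope classical_set_scope.
Local Open Scope ring_scope.

(**
The coefficients of the system are jointly almost periodic, so every element of
the hull is a locally uniform limit of arbitrarily late forward translates; by
continuous dependence, estimates that are uniform over late translates pass to
the hull.

Upper bound: for S the sum of the y_i, S' <= - g S + B with
g = min_i (d_i - sum_j a_ji), an almost periodic function which may have infimum
0 but whose integral over long windows is bounded below; hence solutions are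
ultimately bounded by a common constant.

Lower bound: let u be the solution of the given system starting at 1.
Persistence gives M <= u for late times.  Since x e^(-cx) is strictly sublinear,
sigma(t) u(s + t) is a subsolution of the translate by s when sigma is a
logistic function of k times the integral of min_i beta_i, with k small; here
again the integral, unlike the infimum, of min_i beta_i is controlled.  So
solutions of all late translates end up above a common positive constant.

Bounded solutions are uniformly Lipschitz, so the hull times a set of Lipschitz
states between two positive constants is compact (Ascoli) and absorbs every
hull times X1; the attractor is the intersection of its images.
*)

(** * Real analysis *)

(** Limits of translates may lose the strict inequalities (a4) and (a6), and persistence is assumed
    for the given system alone, with a time depending on the initial state. So the hull receives
    only non-strict bounds, and the strict inequalities are used before the limit is taken; the
    dependence of the persistence time is harmless because a single solution, translated, serves for
    all comparisons. In the comparison, the gain from strict sublinearity and the cost of letting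
    [sigma] grow are both proportional to the birth rate at that instant, which may therefore be
    arbitrarily small; [k] must be small for this balance and because the delayed term sees an
    older, smaller [sigma]. A bump of the rate near time 0, repeated by almost periods, makes its
    integral grow at a uniform speed, so the arrival time depends only on bounds of the initial
    state. As [solution] is a mere choice, existence and uniqueness are proved as well. The metric
    on the hull is arbitrary: attraction is shown for neighborhoods and turned into distances at the
    end. *)

Lemma derive_gt0_left (R : realType) (f : R -> R) (t d : R) :
  is_derive t 1 f d -> 0 < d -> \forall s \near t^'-, f s < f t.
Proof.
move=> [df <-] d0.
have /cvgrPdist_lt /(_ _ d0) : h^-1 *: (f (h *: 1 + t) - f t) @[h --> 0^'] --> 'D_1 f t.
  exact: df.
move=> /nbhs_ballP [e /= e0 he].
exists e => //= s /= ste s_t.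
have st0 : s - t < 0 by rewrite subr_lt0.
have := he (s - t); rewrite /ball /= sub0r normrN distrC ste lt_eqF//.
move=> /(_ isT isT); rewrite /GRing.scale/= mulr1 subrK => h.
have {}h : 0 < (s - t)^-1 * (f s - f t).
  by move: h; rewrite ltr_norml => /andP[_]; rewrite ltrBlDr ltrDl.
by rewrite -subr_lt0; rewrite nmulr_rgt0 ?invr_lt0// in h.
Qed.

Lemma derive_le0_le (R : realType) (f df : R -> R) (a b : R) :
  a <= b -> {within `[a, b], continuous f} ->
  (forall x, a < x < b -> is_derive x 1 f (df x)) ->
  (forall x, a < x < b -> df x <= 0) -> f b <= f a.
Proof.
rewrite le_eqVlt => /predU1P[->//|ab] fc fd f0.
have fd' x : x \in `]a, b[ -> is_derive x 1 f (df x) by rewrite in_itv/=; exact: fd.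
have [c + E] := MVT ab fd' fc; rewrite in_itv/= => cab; rewrite -subr_le0 E.
by rewrite mulr_le0_ge0 ?f0// subr_ge0 ltW.
Qed.

(* At the first time some [v i] vanishes its derivative would be nonpositive. *)
Lemma barrier (R : realType) (I : finType) (v dv : I -> R -> R) (T : R) :
  (forall i, {within `[0, +oo[, continuous (v i)}) ->
  (forall i, 0 < v i 0) ->
  (forall i (t : R), 0 < t <= T -> is_derive t 1 (v i) (dv i t)) ->
  (forall i (t : R), 0 < t <= T -> (forall j (s : R), 0 <= s <= t -> 0 <= v j s) ->
    v i t = 0 -> 0 < dv i t) ->
  forall i (t : R), 0 <= t <= T -> 0 < v i t.
Proof.
move=> vc v0 vd vb.
pose E := [set t : R | 0 <= t <= T /\ exists i, v i t <= 0].
suff E0 : E = set0.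
  move=> i t tT; rewrite ltNge; apply/negP => vt.
  by have : E t; [split => //; exists i|rewrite E0].
rewrite -subset0 => t1 Et1.
have lbE : lbound E 0 by move=> t [/andP[]].
have hE : has_inf E by split; [exists t1|exists 0].
pose t := inf E.
have t0 : 0 <= t by apply: lb_le_inf => //; exists t1.
have tT : t <= T.
  by apply: le_trans (_ : t1 <= T); [apply: ge_inf => //; exists 0|case: Et1 => /andP[]].
have pos i s : 0 <= s < t -> 0 < v i s.
  move=> /andP[s0 st]; rewrite ltNge; apply/negP => vs.
  suff : t <= s by rewrite leNgt st.
  apply: ge_inf; first by exists 0.
  by split; [rewrite s0 (le_trans (ltW st))|exists i].
have vr i : v i s @[s --> t^'+] --> v i t.
  have := vc i; rewrite continuous_within_itvcyP => -[c1 c2].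
  move: t0; rewrite le_eqVlt => /predU1P[<-//|t0].
  by apply: cvg_at_right_filter; apply: c1; rewrite in_itv/= t0.
have vl i : 0 <= v i t.
  move: t0; rewrite le_eqVlt => /predU1P[<-|t0]; first exact/ltW/v0.
  have := vc i; rewrite continuous_within_itvcyP => -[c1 c2].
  have c3 : v i s @[s --> t^'-] --> v i t.
    by apply: cvg_at_left_filter; apply: c1; rewrite in_itv/= t0.
  rewrite leNgt; apply/negP => vt.
  have : \forall s \near t^'-, False.
    near=> s; have : v i s < 0 by near: s; exact: (cvgr_lt _ c3).
    rewrite ltNge => /negP; apply; apply/ltW/pos; apply/andP; split => //.
    by near: s; exact: nbhs_left_ge.
  by case/filter_ex.
(* If all [v i t] were positive they would stay so just after [t], against [t] being the infimum of
   [E]. *)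
have [i vi] : exists i, v i t <= 0.
  apply: contrapT => H.
  have H' i : 0 < v i t by rewrite ltNge; apply/negP => ?; apply: H; exists i.
  have : \forall s \near t^'+, forall i, 0 < v i s.
    apply: filter_forall => i; exact: (cvgr_gt _ (vr i)).
  move=> [e /= e0 he].
  have [s Es] := inf_adherent e0 hE.
  rewrite -/t => ste.
  have ts : t <= s by apply: ge_inf => //; exists 0.
  case: (Es) => sT [i vis].
  have : 0 < v i s; last by rewrite ltNge vis.
  move: ts; rewrite le_eqVlt => /predU1P[<-//|ts].
  apply: he => //=; rewrite ltr0_norm ?subr_lt0// opprB ltrBlDl; lra.
have {}vi : v i t = 0 by apply/le_anti; rewrite vi vl.
have {}t0 : 0 < t.
  rewrite lt_neqAle t0 andbT; apply/eqP => t00; have := v0 i.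
  by move: vi; rewrite -t00 => ->; rewrite ltxx.
have tT' : 0 < t <= T by rewrite t0.
have : 0 < dv i t.
  apply: vb => // j s /andP[s0]; rewrite le_eqVlt => /predU1P[->//|st].
  by apply/ltW/pos; rewrite s0.
move=> /(derive_gt0_left (vd i t tT')) H.
have : \forall s \near t^'-, False.
  near=> s; have : v i s < 0 by rewrite -vi; near: s; exact: H.
  rewrite ltNge => /negP; apply; apply/ltW/pos; apply/andP; split => //.
  by near: s; exact: nbhs_left_ge.
by case/filter_ex.
Unshelve. all: by end_near. Qed.

Lemma primitive_exists (R : realType) (f : R -> R) (a : R) :
  continuous f -> exists F : R -> R, forall t, a < t -> is_derive t 1 F (f t).
Proof.
move=> fc.
exists (fun x => (\int[@lebesgue_measure R]_(t in `[a, x]) f t)%R) => t at_.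
have tt1 : t < t + 1 by rewrite ltrDl.
have fi : (@lebesgue_measure R).-integrable `[a, t + 1] (EFin \o f).
  apply: continuous_compact_integrable; first exact: segment_compact.
  exact: continuous_subspaceT.
have [d1 d2] := continuous_FTC1_closed tt1 fi at_ (fc t).
by apply: DeriveDef; [exact: d1|rewrite -derive1E; exact: d2].
Qed.

(** * Almost periodic functions *)

(** Only [s] is confined to the segment: an almost period can move one of two close points into a
    given segment, while the other may fall just outside. *)
Lemma segment_uniform_continuous (R : realType) (h : R -> R) (a b e : R) :
  continuous h -> 0 < e ->
  exists2 d : R, 0 < d & forall s t, a <= s <= b -> `|s - t| < d -> `|h s - h t| < e.
Proof.
move=> hc e0.
have := @segment_compact R a b => /compact_near_coveringP.
move=> /(_ _ (0 : R)^'+ (fun d s => forall t, `|s - t| < d -> `|h s - h t| < e) _) H.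
have [d /= d0 hd] : \forall d \near (0 : R)^'+,
    `[a, b] `<=` (fun s => forall t, `|s - t| < d -> `|h s - h t| < e).
  apply: H => x xab.
  have e2 : 0 < e / 2 by rewrite divr_gt0.
  have /cvgrPdist_lt/(_ _ e2)/nbhs_ballP[d /= d0 hd] := hc x.
  have d2 : 0 < d / 2 by rewrite divr_gt0.
  exists (ball x (d / 2), [set d' | 0 < d' < d / 2]).
    split; first exact: nbhsx_ballx.
    exists (d / 2) => //= y /=; rewrite sub0r normrN => yd y0.
    by rewrite y0; move: yd; rewrite gtr0_norm.
  case=> /= s d' [xs /andP[d'0 d'd]] t std.
  have xt : ball x d t.
    by rewrite /ball/= (le_lt_trans (ler_distD s _ _))// (splitr d) ltrD// (lt_trans std).
  have xs' : ball x d s by apply: le_ball xs; rewrite ler_pdivrMr//; lra.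
  rewrite (le_lt_trans (ler_distD (h x) _ _))// (splitr e) ltrD//; last exact: hd.
  by rewrite distrC; exact: hd.
exists (d / 2); first by rewrite divr_gt0.
move=> s t sab st; apply: (hd (d / 2)) => //=; last by rewrite ?in_itv ?divr_gt0.
by rewrite sub0r normrN gtr0_norm ?divr_gt0// ltr_pdivrMr//; lra.
Qed.

Section AlmostPeriodic.
Variable R : realType.
Implicit Types h : R -> R.

Lemma almost_periodic_uniform_continuous h (e : R) :
  almost_periodic h -> 0 < e ->
  exists2 d : R, 0 < d & forall s t, `|s - t| < d -> `|h s - h t| < e.
Proof.
move=> [hc hp] e0; have e3 : 0 < e / 3 by rewrite divr_gt0.
have [L L0 HL] := hp _ e3.
have [d d0 hd] := @segment_uniform_continuous R h 0 L _ hc e3.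
exists d => // s t st; have [p + /= hsp] := HL (- s).
rewrite in_itv/= => /andP[p1 p2].
have h1 := hsp s; have h2 := hsp t.
have h3 : `|h (s + p) - h (t + p)| < e / 3.
  by apply: hd; [apply/andP; split; lra|rewrite opprD addrACA subrr addr0].
have -> : h s - h t = (h (s + p) - h (t + p)) - (h (s + p) - h s) + (h (t + p) - h t) by ring.
rewrite (le_lt_trans (ler_normD _ _))//.
have := ler_normB (h (s + p) - h (t + p)) (h (s + p) - h s); lra.
Qed.

Lemma almost_periodic_bounded h :
  almost_periodic h -> exists C : R, forall t, `|h t| <= C.
Proof.
move=> [hc hp]; have [L L0 HL] := hp 1 ltr01.
have : compact (h @` `[0, L]).
  by apply: continuous_compact; [exact: continuous_subspaceT|exact: segment_compact].
move=> /compact_bounded[C [_ hC']].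
have CC : C < C + 1 by rewrite ltrDl.
have hC := hC' _ CC.
exists (C + 2) => t; have [p + /= hsp] := HL (- t).
rewrite in_itv/= => /andP[p1 p2].
have := hsp t; have : `|h (t + p)| <= C + 1.
  by apply: hC; exists (t + p) => //=; rewrite in_itv/=; apply/andP; split; lra.
have : `|h t| <= `|h (t + p)| + `|h (t + p) - h t|.
  by rewrite -{1}(subKr (h (t + p)) (h t)) ler_normB.
lra.
Qed.

(* Total boundedness of the set of translates, encoded by a finite colouring. *)
Lemma almost_periodic_coloring h (e : R) :
  almost_periodic h -> 0 < e ->
  exists n (c : R -> nat), (forall s, (c s < n)%N) /\
    forall s s', c s = c s' -> forall t, `|h (t + s) - h (t + s')| < e.
Proof.
move=> ap e0; have e3 : 0 < e / 3 by rewrite divr_gt0.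
have [d d0 hd] := almost_periodic_uniform_continuous ap e3.
have [L L0 HL] := ap.2 _ e3.
have /choice[p Hp] : forall s, exists p, (0 <= s + p <= L) /\
    forall t, `|h (t + p) - h t| < e / 3.
  move=> s; have [p + hp] := HL (- s); rewrite in_itv/= => /andP[p1 p2].
  by exists p; split => //; apply/andP; split; lra.
(* The almost period [p s] brings [s] into [0, L]; the colour is the cell of length [d] that
   contains the result. *)
exists (Num.truncn (L / d)).+1, (fun s => Num.truncn ((s + p s) / d)); split.
  move=> s; rewrite ltnS; apply: le_truncn; rewrite ler_pM2r ?invr_gt0//.
  by have [/andP[]] := Hp s.
move=> s s' E t.
have [/andP[s1 s2] hs] := Hp s; have [/andP[s1' s2'] hs'] := Hp s'.
have : `|(s + p s) / d - (s' + p s') / d| < 1.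
  have q0 : 0 <= (s + p s) / d by rewrite divr_ge0// ltW.
  have q0' : 0 <= (s' + p s') / d by rewrite divr_ge0// ltW.
  have /andP[b1 b2] := truncn_itv q0; have /andP[b3 b4] := truncn_itv q0'.
  by rewrite -E -natr1 in b3 b4; rewrite -natr1 in b2; rewrite ltr_norml; apply/andP; split; lra.
rewrite -mulrBl normrM (gtr0_norm (_ : 0 < d^-1)) ?invr_gt0// ltr_pdivrMr// mul1r => dd.
have h1 := hs (t + s); have h2 := hs' (t + s').
have h3 : `|h (t + s + p s) - h (t + s' + p s')| < e / 3.
  apply: hd; suff -> : t + s + p s - (t + s' + p s') = s + p s - (s' + p s') by [].
  ring.
have -> : h (t + s) - h (t + s') = (h (t + s + p s) - h (t + s' + p s'))
  - (h (t + s + p s) - h (t + s)) + (h (t + s' + p s') - h (t + s')) by ring.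
rewrite (le_lt_trans (ler_normD _ _))//.
have := ler_normB (h (t + s + p s) - h (t + s' + p s')) (h (t + s + p s) - h (t + s)); lra.
Qed.

(* Pigeonhole: translates of equal colour differ by a joint almost period, and
   finitely many representatives suffice. *)
Lemma joint_almost_period (I : finType) (h : I -> R -> R) (e : R) :
  (forall i, almost_periodic (h i)) -> 0 < e ->
  exists2 L : R, 0 < L & forall x, exists s, x <= s <= x + L /\
    forall i t, `|h i (t + s) - h i t| < e.
Proof.
move=> ap e0.
have /choice[n /choice[c Hc]] := fun i => almost_periodic_coloring (ap i) e0.
pose n' := (\max_i n i)%N.
pose c' s := [ffun i => inord (c i s) : 'I_n'.+1].
pose rep k := xget 0 [set s | c' s = k].
pose C : R := \sum_k `|rep k|.
have Crep k : `|rep k| <= C by rewrite /C (bigD1 k)//= lerDl sumr_ge0.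
have C0 : 0 <= C by rewrite sumr_ge0.
(* Representatives lie in [-C, C], so subtracting one from [x + C] lands in [x, x + 2C]; the added 1
   keeps the length positive. *)
exists (2 * C + 1); first by lra.
move=> x; exists (x + C - rep (c' (x + C))); split.
  by have := Crep (c' (x + C)); rewrite ler_norml => /andP[? ?]; apply/andP; split; lra.
move=> i t; set s := rep _.
have /= E : c' s = c' (x + C) by rewrite /s /rep; case: xgetP => [y _ //|/(_ (x + C))[]].
have [cn ch] := Hc i.
have : c i s = c i (x + C).
  have cn' s' : (c i s' < n'.+1)%N.
    by rewrite ltnS (leq_trans (ltnW (cn s')))// /n' (@leq_bigmax _ (fun i => n i)).
  by move: E => /ffunP/(_ i); rewrite !ffunE => /(congr1 val); rewrite /= !inordK.
move=> /esym/ch/(_ (t - s)); rewrite subrK; congr (_ < _).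
by congr (`|h i _ - _|); ring.
Qed.

End AlmostPeriodic.

(** * Delay equations: existence by Picard iteration *)

(** With [w n] the sum of all increments still allowed, [u - w] is nondecreasing and [u + w]
    nonincreasing; the supremum of the former is the limit. *)
Lemma geometric_cauchy_limit (R : realType) (u : nat -> R) (B : R) :
  (forall n, `|u n.+1 - u n| <= B / 2 ^+ n) ->
  exists l, forall n, `|u n - l| <= 2 * B / 2 ^+ n.
Proof.
move=> hu.
pose w n : R := 2 * B / 2 ^+ n.
have wS n : w n = w n.+1 + B / 2 ^+ n.
  rewrite /w exprS invfM; have -> : 2 * B * (2^-1 * (2 ^+ n)^-1) = B / 2 ^+ n :> R by field.
  by ring.
have hu' n : - (B / 2 ^+ n) <= u n.+1 - u n <= B / 2 ^+ n by rewrite -ler_norml.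
have aS : {homo (fun n => u n - w n) : m n / (m <= n)%N >-> m <= n}.
  apply: homo_leq => [//|x y z xy yz|n]; [exact: le_trans xy yz|].
  by have /andP[? ?] := hu' n; have := wS n; lra.
have bS : {homo (fun n => - (u n + w n)) : m n / (m <= n)%N >-> m <= n}.
  apply: homo_leq => [//|x y z xy yz|n]; [exact: le_trans xy yz|].
  by have /andP[? ?] := hu' n; have := wS n; lra.
have w0 n : 0 <= w n.
  have := le_trans (normr_ge0 _) (hu n) => ?; rewrite /w -mulrA mulr_ge0//.
have ab n k : u n - w n <= u k + w k.
  case: (leqP n k) => [nk|/ltnW kn].
    by have /= := aS _ _ nk; have := w0 k; lra.
  by have /= := bS _ _ kn; have := w0 n; lra.
exists (sup (range (fun n => u n - w n))) => n.
rewrite -/(w n) ler_norml; apply/andP; split.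
  suff : sup (range (fun n => u n - w n)) <= u n + w n by lra.
  by apply: ge_sup; [exists (u 0 - w 0), 0%N|move=> _ [k _ <-]].
suff : u n - w n <= sup (range (fun n => u n - w n)) by lra.
by apply: ub_le_sup; [exists (u 0 + w 0) => _ [k _ <-]|exists n].
Qed.

Lemma eq_of_geometric_dist (R : realType) (x y B : R) :
  (forall n, `|x - y| <= B / 2 ^+ n) -> x = y.
Proof.
move=> H; apply/eqP; rewrite -subr_eq0 -normr_le0; apply/ler_addgt0Pl => e e0.
rewrite addr0.
have [B0|B0] := leP B 0.
  by have := H 0%N; rewrite expr0 divr1 => /le_trans; apply; exact: le_trans (ltW e0).
have [n Hn] : exists n, B / 2 ^+ n < e.
  exists (Num.truncn (B / e)).+1; rewrite ltr_pdivrMr ?exprn_gt0//.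
  rewrite -ltr_pdivrMl// mulrC.
  apply: (lt_trans (y := (Num.truncn (B / e)).+1%:R)).
    by have /truncn_itv/andP[] : 0 <= B / e by rewrite divr_ge0// ltW.
  by rewrite -natrX ltr_nat ltn_expl.
exact: le_trans (H n) (ltW Hn).
Qed.

Lemma is_derive_expR_scale (R : realType) (a B t : R) :
  is_derive t 1 (fun s => B * expR (a * s)) (B * a * expR (a * t)).
Proof.
have h : is_derive t 1 (fun s : R => a * s) a.
  by apply: is_derive_eq (is_deriveZ a (is_derive_id t (1 : R))) _; rewrite /GRing.scale/= mulr1.
have h2 := is_derive1_comp (is_derive_expR (a * t)) h.
by apply: is_derive_eq (is_deriveZ B h2) _; rewrite /GRing.scale/=; ring.
Qed.

Lemma is_derive_translate (R : realType) (s x : R) : is_derive x 1 (fun u : R => s + u) (1 : R).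
Proof.
by apply: is_derive_eq (is_deriveD (is_derive_cst s x 1) (is_derive_id x (1 : R))) _; rewrite add0r.
Qed.

Lemma derivable_within_continuous_itv (R : realType) (f df : R -> R) (a b : R) :
  (forall x, a <= x <= b -> is_derive x 1 f (df x)) -> {within `[a, b], continuous f}.
Proof.
move=> H; apply: derivable_within_continuous => x; rewrite in_itv/= => /H.
by case.
Qed.

(** The exponential has derivative [B * k * expR (k * s)], which dominates [f] in absolute value.
    Integration thus gains a factor [k^-1] in the weighted norm, the source of the contraction. *)
Lemma exp_growth_bound (R : realType) (p f : R -> R) (B k t : R) :
  0 <= t -> 0 <= B -> p 0 = 0 ->
  (forall s, 0 <= s <= t -> is_derive s 1 p (f s)) ->
  (forall s, 0 <= s <= t -> `|f s| <= B * k * expR (k * s)) ->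
  `|p t| <= B * expR (k * t).
Proof.
move=> t0 B0 p0 dp fb.
have E := @is_derive_expR_scale R k B.
have E0 : B * expR (k * 0) = B by rewrite mulr0 expR0 mulr1.
have P s : 0 < s < t -> 0 <= s <= t by move=> /andP[? ?]; rewrite !ltW.
rewrite ler_norml; apply/andP; split.
  have D s : 0 <= s <= t ->
      is_derive s 1 (fun s => - (p s + B * expR (k * s))) (- (f s + B * k * expR (k * s))).
    by move=> st; have ? := dp _ st; have ? := E s; exact: is_deriveN.
  have := derive_le0_le t0 (derivable_within_continuous_itv D) (fun s st => D s (P s st)).
  rewrite p0 E0 => H; suff : - (p t + B * expR (k * t)) <= - (0 + B) by lra.
  by apply: H => s /P/fb; rewrite ler_norml => /andP[]; lra.
have D s : 0 <= s <= t ->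
    is_derive s 1 (fun s => p s - B * expR (k * s)) (f s - B * k * expR (k * s)).
  by move=> st; have ? := dp _ st; have ? := E s; exact: is_deriveB.
have := derive_le0_le t0 (derivable_within_continuous_itv D) (fun s st => D s (P s st)).
rewrite p0 E0 => H; suff : p t - B * expR (k * t) <= 0 - B by lra.
by apply: H => s /P/fb; rewrite ler_norml => /andP[]; lra.
Qed.

Lemma nonexpansive_continuous (R : realType) (f : R -> R) :
  (forall x y, `|f x - f y| <= `|x - y|) -> continuous f.
Proof.
move=> H x; apply/cvgrPdist_lt => e e0; apply: filterS (nbhsx_ballx x e e0) => y.
exact: le_lt_trans (H x y).
Qed.

Lemma max_nonexpansive (R : realType) (c x y : R) :
  `|Num.max x c - Num.max y c| <= `|x - y|.
Proof.
rewrite !maxEle.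
by case: (leP x c) => ?; case: (leP y c) => ?; rewrite ?subrr ?normr0//;
  rewrite ler_norml; apply/andP; split;
  have := ler_norm (x - y); have := ler_norm (y - x); rewrite (distrC y x); lra.
Qed.

Lemma maxr_cst_continuous (R : realType) (c : R) : continuous (fun t : R => Num.max t c).
Proof. by apply: nonexpansive_continuous => x y; exact: max_nonexpansive. Qed.

Lemma minr_cst_continuous (R : realType) (c : R) : continuous (fun t : R => Num.min t c).
Proof.
apply: nonexpansive_continuous => x y; rewrite !minEle.
by case: (leP x c) => ?; case: (leP y c) => ?; rewrite ?subrr ?normr0//;
  rewrite ler_norml; apply/andP; split;
  have := ler_norm (x - y); have := ler_norm (y - x); rewrite (distrC y x); lra.
Qed.

Section Picard.
Variables (R : realType) (I : finType) (F : (I -> R -> R) -> I -> R -> R).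
Variables (L B : R) (phi : I -> R -> R).
Hypothesis L_gt0 : 0 < L.
Hypothesis phi_cont : forall i, continuous (phi i).
Hypothesis F_cont : forall Y, (forall i, continuous (Y i)) -> forall i, continuous (F Y i).
Hypothesis F_lip : forall Y Z i (t E : R), 0 <= t ->
  (forall j (s : R), s <= t -> `|Y j s - Z j s| <= E) -> `|F Y i t - F Z i t| <= L * E.
Hypothesis F_bnd : forall i (t : R), 0 <= t -> `|F (fun j s => phi j (Num.min s 0)) i t| <= B.

Let k := 2 * L.
Let k_gt0 : 0 < k. Proof. by rewrite mulr_gt0. Qed.

(* The weight e^(kt) makes the integral operator a contraction of ratio 1/2
   on the whole half-line. *)
Lemma picard : exists y : I -> R -> R,
  [/\ forall i, continuous (y i), forall i (t : R), t <= 0 -> y i t = phi i t,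
      forall i, h^-1 * (y i h - y i 0) @[h --> 0^'+] --> F y i 0 &
      forall i (t : R), 0 < t -> is_derive t 1 (y i) (F y i t)].
Proof.
have [prim Hprim] : exists prim : (R -> R) -> R -> R, forall f, continuous f ->
    prim f 0 = 0 /\ forall t : R, 0 <= t -> is_derive t 1 (prim f) (f t).
  have /choice[prim Hp] : forall f : R -> R, exists p : R -> R, continuous f ->
      p 0 = 0 /\ forall t : R, 0 <= t -> is_derive t 1 p (f t).
    move=> f; have [fc|fc] := pselect (continuous f); last by exists (fun=> 0).
    (* Starting the primitive at -1 makes it differentiable from both sides at 0. *)
    have [P HP] := @primitive_exists R f (-1) fc.
    exists (fun t => P t - P 0) => _; split; first by rewrite subrr.
    move=> t t0; have ? : is_derive t 1 P (f t) by apply: HP; rewrite (lt_le_trans _ t0)// ltrN10.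
    by apply: is_derive_eq (is_deriveB _ (is_derive_cst (P 0) t 1)) _; rewrite subr0.
  by exists prim.
(* The history is frozen after time 0 and the integral term of [step] before it, so that all
   iterates are continuous on the whole line. *)
pose Y0 i (t : R) := phi i (Num.min t 0).
pose step (Y : I -> R -> R) i (t : R) := Y0 i t + prim (F Y i) (Num.max t 0).
have maxc (g : R -> R) : (forall t : R, 0 <= t -> {for t, continuous g}) ->
    continuous (fun t : R => g (Num.max t 0)).
  move=> gc t; apply: (@continuous_comp _ _ _ (fun t : R => Num.max t 0) g); last first.
    by apply: gc; rewrite le_max lexx orbT.
  exact: maxr_cst_continuous.
have Y0c i : continuous (Y0 i).
  move=> t; apply: (@continuous_comp _ _ _ (fun t : R => Num.min t 0) (phi i)).
    exact: minr_cst_continuous.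
  exact: phi_cont.
have stepc Y : (forall i, continuous (Y i)) -> forall i, continuous (step Y i).
  move=> Yc i t; apply: continuousD; first exact: Y0c.
  apply: maxc => s s0; have [_ /(_ _ s0)[d _]] := Hprim _ (@F_cont _ Yc i).
  exact/differentiable_continuous/derivable1_diffP.
have step_lip (Y Z : I -> R -> R) (E : R) i (t : R) :
    (forall i, continuous (Y i)) -> (forall i, continuous (Z i)) ->
    0 <= E -> (forall j (s : R), `|Y j s - Z j s| <= E * expR (k * Num.max s 0)) ->
    `|step Y i t - step Z i t| <= E / 2 * expR (k * Num.max t 0).
  move=> Yc Zc E0 YZ.
  have [p0 pd] := Hprim _ (@F_cont _ Yc i); have [q0 qd] := Hprim _ (@F_cont _ Zc i).
  rewrite /step opprD addrACA subrr add0r.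
  apply: (@exp_growth_bound R (prim (F Y i) \- prim (F Z i)) (F Y i \- F Z i)).
  - by rewrite le_max lexx orbT.
  - by rewrite divr_ge0.
  - by rewrite /= p0 q0 subrr.
  - by move=> s /andP[s0 _]; have ? := pd _ s0; have ? := qd _ s0; exact: is_deriveB.
  move=> s /andP[s0 _] /=.
  have -> : E / 2 * k * expR (k * s) = L * (E * expR (k * s)) by rewrite /k; field.
  apply: F_lip => // j u us; apply: le_trans (YZ j u) _.
  by rewrite ler_wpM2l// ler_expR ler_wpM2l ?(ltW k_gt0)// ge_max us.
pose Y n := iter n step Y0.
have Yc n i : continuous (Y n i) by elim: n i => [//|n IH]; exact: stepc.
(* The first increment is the integral of a function bounded by [A * k]. *)
pose A := `|B| / k.
have A0 : 0 <= A by rewrite divr_ge0// ltW.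
have Yd n i (t : R) : `|Y n.+1 i t - Y n i t| <= A / 2 ^+ n * expR (k * Num.max t 0).
  elim: n i t => [|n IH] i t; last first.
    rewrite exprSr invfM mulrA; apply: step_lip => [j|j||//]; [exact: (Yc n.+1 j)|exact: (Yc n j)|].
    by rewrite divr_ge0// exprn_ge0.
  rewrite expr0 divr1 /Y /= /step addrAC subrr add0r.
  have [p0 pd] := Hprim _ (@F_cont _ Y0c i).
  apply: (@exp_growth_bound R _ (F Y0 i)) => //.
  - by rewrite le_max lexx orbT.
  - by move=> s /andP[s0 _]; exact: pd.
  move=> s /andP[s0 _]; rewrite /A divfK ?gt_eqF//.
  apply: le_trans (F_bnd i s0) _; apply: le_trans (ler_norm _) _.
  by rewrite ler_peMr// -expR0 ler_expR mulr_ge0// ltW.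
have /choice[y Hy'] : forall i, exists y : R -> R, forall (t : R) n,
    `|Y n i t - y t| <= 2 * A / 2 ^+ n * expR (k * Num.max t 0).
  move=> i; suff /choice[l Hl] : forall t : R, exists l, forall n,
      `|Y n i t - l| <= 2 * A / 2 ^+ n * expR (k * Num.max t 0) by exists l.
  move=> t.
  have Yd' n : `|Y n.+1 i t - Y n i t| <= A * expR (k * Num.max t 0) / 2 ^+ n.
    by rewrite mulrAC; exact: Yd.
  have [l Hl] := geometric_cauchy_limit Yd'.
  by exists l => n; rewrite mulrAC -[2 * A * _]mulrA.
have Hy n i (t : R) := Hy' i t n => {Hy'}.
have yc i : continuous (y i).
  move=> t; apply/cvgrPdist_lt => e e0.
  pose D := 2 * A * expR (k * (`|t| + 1)).
  have D0 : 0 <= D by apply: mulr_ge0; [exact: mulr_ge0|exact: expR_ge0].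
  have [n Hn] : exists n, D / 2 ^+ n < e / 3.
    apply: contrapT => /forallNP H; have e3 : 0 < e / 3 by rewrite divr_gt0.
    suff : e / 3 = 0 by move=> e30; rewrite e30 ltxx in e3.
    apply: (@eq_of_geometric_dist R _ _ D) => n; rewrite subr0 gtr0_norm//.
    by rewrite leNgt; apply/negP; exact: H.
  have near_bound (s : R) : `|t - s| < 1 -> `|Y n i s - y i s| < e / 3.
    move=> ts; apply: le_lt_trans (Hy n i s) _; apply: le_lt_trans Hn.
    rewrite /D mulrAC; apply: ler_wpM2r; first by rewrite invr_ge0 exprn_ge0.
    apply: ler_wpM2l; first exact: mulr_ge0.
    rewrite ler_expR; apply: ler_wpM2l; first exact: ltW.
    rewrite ge_max addr_ge0// andbT.
    have := ler_norm s; have := ler_distD t s 0; rewrite !subr0 distrC; lra.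
  have e3 : 0 < e / 3 by rewrite divr_gt0.
  have /cvgrPdist_lt/(_ _ e3) := Yc n i t; apply: filterS2 (nbhsx_ballx t 1 ltr01) => s ts h.
  have h1 := near_bound _ ts.
  have h2 : `|Y n i t - y i t| < e / 3 by apply: near_bound; rewrite subrr normr0.
  have -> : y i t - y i s = (Y n i t - Y n i s) - (Y n i t - y i t) + (Y n i s - y i s) by ring.
  rewrite (le_lt_trans (ler_normD _ _))//.
  have := ler_normB (Y n i t - Y n i s) (Y n i t - y i t); lra.
have yE i (t : R) : y i t = step y i t.
  apply: (@eq_of_geometric_dist R _ _ (2 * A * expR (k * Num.max t 0))) => n.
  have h1 := Hy n.+1 i t.
  have h2 : `|step (Y n) i t - step y i t| <= (2 * A / 2 ^+ n) / 2 * expR (k * Num.max t 0).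
    apply: step_lip => [j|j||j s]; [exact: (Yc n j)|exact: yc| |exact: Hy].
    by apply: divr_ge0; [exact: mulr_ge0|exact: exprn_ge0].
  have -> : y i t - step y i t = (step (Y n) i t - step y i t) - (Y n.+1 i t - y i t).
    by rewrite /Y /=; ring.
  apply: le_trans (ler_normB _ _) _; apply: le_trans (lerD h2 h1) _.
  rewrite exprS invfM le_eqVlt; apply/orP; left; apply/eqP; field.
  by rewrite expf_neq0.
have [pp Hpp] : exists p : I -> R -> R, forall i, p i 0 = 0 /\
    (forall t : R, 0 <= t -> is_derive t 1 (p i) (F y i t) /\ y i t = phi i 0 + p i t).
  exists (fun i => prim (F y i)) => i; have [p0 pd] := Hprim _ (@F_cont _ yc i).
  split => // t t0; split; first exact: pd.
  by rewrite yE /step /Y0 (min_idPr t0) (max_idPl t0).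
exists y; split => //.
- move=> i t t0; rewrite yE /step /Y0 (min_idPl t0) (max_idPr t0).
  by rewrite (Hprim _ (@F_cont _ yc i)).1 addr0.
- move=> i; have [p0 pd] := Hpp i; have [[d0 d0E] y0] := pd 0 (lexx 0).
  rewrite -d0E.
  (* [y] is a constant plus the primitive for nonnegative times only, so its right derivative is
     read off from the two-sided derivative of the primitive. *)
  have H : h^-1 *: (pp i (h *: 1 + 0) - pp i 0) @[h --> 0^'] --> 'D_1 (pp i) 0 by exact: d0.
  have H2 : h^-1 *: (pp i (h *: 1 + 0) - pp i 0) @[h --> 0^'+] --> 'D_1 (pp i) 0.
    by move=> U /H[e e0 he]; exists e => // h eh h0; apply: he => //; rewrite gt_eqF.
  apply: cvg_trans H2; apply: near_eq_cvg; near=> h.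
  have h0 : 0 <= h by near: h; exact: nbhs_right_ge.
  have [_ yh] := pd _ h0.
  by rewrite /GRing.scale/= mulr1 addr0 y0 yh; congr (_ * _); ring.
- move=> i t t0; have [p0 pd] := Hpp i; have [d _] := pd _ (ltW t0).
  have d' : is_derive t 1 (fun s => phi i 0 + pp i s) (F y i t).
    by apply: is_derive_eq (is_deriveD (is_derive_cst (phi i 0) t 1) d) _; rewrite add0r.
  apply: near_eq_is_derive d'; near=> s.
  have s0 : 0 <= s by apply: ltW; near: s; exact: lt_nbhsr.
  by have [_ ->] := pd _ s0.
Unshelve. all: by end_near. Qed.

End Picard.

(** * Nicholson systems and their solutions *)

Section Ricker.
Variable R : realType.
Implicit Types c x y : R.

Definition ricker c y : R := y * expR (- c * y).

Lemma ricker_ge0 c y : 0 <= y -> 0 <= ricker c y.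
Proof. by move=> y0; rewrite /ricker mulr_ge0// expR_ge0. Qed.

Lemma expRN_le1 x : 0 <= x -> expR (- x) <= 1.
Proof. by move=> x0; rewrite -expR0 ler_expR oppr_le0. Qed.

Lemma ricker_le c y : 0 <= c -> 0 <= y -> ricker c y <= y.
Proof. by move=> c0 y0; rewrite /ricker ler_piMr// mulNr expRN_le1// mulr_ge0. Qed.

Lemma expRN_ge x : 1 - x <= expR (- x).
Proof. exact: expR_ge1Dx. Qed.

Lemma ricker_bound c y : 0 < c -> 0 <= y -> ricker c y <= c^-1.
Proof.
move=> c0 y0; rewrite /ricker mulNr expRN ler_pdivrMr ?expR_gt0//.
rewrite ler_pdivlMl//; apply: le_trans (expR_ge1Dx _); lra.
Qed.

(** The derivative (1 - c y) e^(-c y) lies in [-1, 1]. In integrated form, with [a] = e^(-c x) and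
    [b] = e^(-c (y - x)), the increment is [(y - x) * (a * b) - x * a * (1 - b)], a difference of
    two numbers between 0 and [y - x]. *)
Lemma ricker_lip c x y : 0 <= c -> 0 <= x -> 0 <= y ->
  `|ricker c x - ricker c y| <= `|x - y|.
Proof.
move=> c0; wlog xy : x y / x <= y.
  move=> H x0 y0; case: (leP x y) => [xy|/ltW yx]; first exact: H.
  by rewrite distrC (distrC x); exact: H.
move=> x0 y0.
have cxy : 0 <= c * (y - x) by rewrite mulr_ge0// subr_ge0.
rewrite (distrC x) (ger0_norm (_ : 0 <= y - x)) ?subr_ge0// distrC /ricker !mulNr.
have Ey : expR (- (c * y)) = expR (- (c * x)) * expR (- (c * (y - x))).
  by rewrite -expRD; congr expR; ring.
have e1 := expRN_le1 (mulr_ge0 c0 x0); have e0 := expR_ge0 (- (c * x)).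
have f1 := expRN_le1 cxy; have f0 := expR_ge0 (- (c * (y - x))).
have f2 := expRN_ge (c * (y - x)).
have g := ricker_le c0 x0.
have x1 : c * x * expR (- (c * x)) <= 1.
  rewrite expRN ler_pdivrMr ?expR_gt0// mul1r.
  by apply: le_trans (expR_ge1Dx _); lra.
rewrite Ey; set a := expR (- (c * x)) in e1 e0 x1 *; set b := expR _ in f1 f0 f2 *.
rewrite ler_norml; apply/andP; split.
  (* [x a (1 - b) <= x a c (y - x) <= y - x] *)
  have h1 : x * a * (1 - b) <= x * a * (c * (y - x)) by apply: ler_wpM2l; [exact: mulr_ge0|lra].
  have h2 : c * x * a * (y - x) <= y - x by rewrite ler_piMl// subr_ge0.
  have h3 : 0 <= (y - x) * (a * b) by rewrite mulr_ge0 ?subr_ge0// mulr_ge0.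
  have -> : y * (a * b) - x * a = (y - x) * (a * b) - x * a * (1 - b) by ring.
  have h4 : x * a * (c * (y - x)) = c * x * a * (y - x) by ring.
  lra.
have -> : y * (a * b) - x * a = (y - x) * (a * b) - x * a * (1 - b) by ring.
have h3 : (y - x) * (a * b) <= y - x.
  by rewrite ler_piMr ?subr_ge0// mulr_ile1.
have h4 : 0 <= x * a * (1 - b) by rewrite !mulr_ge0// subr_ge0.
lra.
Qed.

Lemma expRN_lip x y : 0 <= x -> 0 <= y -> `|expR (- x) - expR (- y)| <= `|x - y|.
Proof.
wlog xy : x y / x <= y.
  move=> H x0 y0; case: (leP x y) => [xy|/ltW yx]; first exact: H.
  by rewrite distrC (distrC x); exact: H.
move=> x0 y0; rewrite ger0_norm ?subr_ge0 ?ler_expR ?lerN2//.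
rewrite distrC ger0_norm ?subr_ge0//.
have -> : expR (- y) = expR (- x) * expR (- (y - x)) by rewrite -expRD; congr expR; ring.
have := expRN_le1 x0; have := expR_ge0 (- x); have := expRN_ge (y - x).
set a := expR (- x); set b := expR _ => hb a0 a1.
have : a * (1 - b) <= a * (y - x) by apply: ler_wpM2l => //; lra.
have : a * (y - x) <= y - x by rewrite ler_piMl// subr_ge0.
have -> : a - a * b = a * (1 - b) by ring.
lra.
Qed.

Lemma ricker_lip_rate c c' y : 0 <= c -> 0 <= c' -> 0 <= y ->
  `|ricker c y - ricker c' y| <= `|c - c'| * y ^+ 2.
Proof.
move=> c0 c0' y0; rewrite /ricker -mulrBr normrM (ger0_norm y0) !mulNr.
have := expRN_lip (mulr_ge0 c0 y0) (mulr_ge0 c0' y0).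
rewrite -mulrBl normrM (ger0_norm y0) => h.
by rewrite expr2 mulrA [X in _ <= X]mulrC ler_wpM2l.
Qed.

Lemma ricker_continuous (f g : R -> R) : continuous f -> continuous g ->
  continuous (fun t => ricker (f t) (g t)).
Proof.
rewrite /ricker => fc gc t; apply: cvgM; first exact: gc.
apply: (@continuous_comp _ _ _ (fun t => - f t * g t) (@expR R)); last exact: continuous_expR.
by apply: cvgM; [apply: cvgN; exact: fc|exact: gc].
Qed.

(* [ricker c] first increases and then decreases; the constant on [x] keeps
   [ricker c x] below both branches. *)
Lemma ricker_mono c C K x y : 0 <= c <= C -> 0 < C -> 0 <= x <= y -> y <= K ->
  x <= expR (- C * K) / C -> ricker c x <= ricker c y.
Proof.
move=> /andP[c0 cC] C0 /andP[x0 xy] yK xs.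
have y0 := le_trans x0 xy.
(* Above the threshold, y >= 1/C and e^(-c y) >= e^(-C K), and the product of these bounds is the
   one imposed on [x]. Below it c y <= 1, the increasing branch. *)
have [Cy|Cy] := leP 1 (C * y).
  apply: le_trans (ricker_le c0 x0) _; apply: le_trans xs _.
  rewrite /ricker [X in _ <= X]mulrC; apply: ler_pM.
  - exact: expR_ge0.
  - by rewrite invr_ge0 ltW.
  - by rewrite ler_expR !mulNr lerN2; apply: ler_pM.
  - by rewrite -(ler_pM2l C0) divff ?gt_eqF.
have cy : c * y <= 1 by apply: le_trans (ltW Cy); rewrite ler_wpM2r.
rewrite /ricker !mulNr.
have -> : expR (- (c * y)) = expR (- (c * x)) * expR (- (c * (y - x))).
  by rewrite -expRD; congr expR; ring.
rewrite [X in _ <= X]mulrCA mulrC ler_wpM2l ?expR_ge0//.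
apply: (le_trans (y := y * (1 - c * (y - x)))); last by rewrite ler_wpM2l// expRN_ge.
have : c * y * (y - x) <= y - x by rewrite ler_piMl// subr_ge0.
lra.
Qed.

End Ricker.

Lemma sum_continuous (R : realType) (I : Type) (s : seq I) (f : I -> R -> R) :
  (forall i, continuous (f i)) -> continuous (fun t => \sum_(i <- s) f i t).
Proof.
move=> fc; elim: s => [|i s IH].
  have -> : (fun t => \sum_(i <- [::]) f i t) = cst 0 by apply/funext => u; rewrite big_nil.
  by move=> t; exact: cvg_cst.
have -> : (fun t => \sum_(i <- i :: s) f i t) = f i \+ (fun t => \sum_(i <- s) f i t).
  by apply/funext => u; rewrite big_cons.
by move=> t; apply: cvgD; [exact: fc|exact: IH].
Qed.

Lemma is_derive_bigsum (R : realType) (I : Type) (s : seq I) (f df : I -> R -> R) (t : R) :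
  (forall i, is_derive t 1 (f i) (df i t)) ->
  is_derive t 1 (fun u => \sum_(i <- s) f i u) (\sum_(i <- s) df i t).
Proof.
move=> fd; elim: s => [|i s IH].
  have -> : (fun u => \sum_(i <- [::]) f i u) = cst 0 by apply/funext => u; rewrite big_nil.
  by rewrite big_nil; exact: is_derive_cst.
have -> : (fun u => \sum_(i <- i :: s) f i u) = f i + (fun u => \sum_(i <- s) f i u).
  by apply/funext => u; rewrite big_cons.
by rewrite big_cons; exact: is_deriveD.
Qed.

Lemma finite_positive_lower (R : realType) (I : finType) (f : I -> R) :
  (forall i, 0 < f i) -> exists2 mu : R, 0 < mu & forall i, mu <= f i.
Proof.
move=> f0; exists (\big[Order.min/1]_i f i); last by move=> i; exact: bigmin_le.
by apply/bigmin_gtP.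
Qed.

(** Clamping the argument extends [f] by its end values; initial states, continuous only relative to
    [-r_i, 0], thereby satisfy the continuity asked for by [picard]. *)
Lemma clamp_continuous (R : realType) (f : R -> R) (a b : R) : a <= b ->
  {within `[a, b], continuous f} -> continuous (fun t => f (Num.max (Num.min t b) a)).
Proof.
move=> ab /subspace_continuousP fc t.
have gA s : `[a, b]%classic (Num.max (Num.min s b) a).
  by rewrite /= in_itv/= le_max lexx orbT/= ge_max ab ge_min lexx orbT.
have gc : continuous (fun s : R => Num.max (Num.min s b) a).
  move=> s; apply: (@continuous_comp _ _ _ (fun s : R => Num.min s b) (fun s : R => Num.max s a)).
    exact: minr_cst_continuous.
  exact: maxr_cst_continuous.
move=> U /(fc _ (gA t)) H.
have H' : nbhs (Num.max (Num.min t b) a) [set s | `[a, b]%classic s -> U (f s)] by exact: H.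
have H2 : nbhs t [set s | `[a, b]%classic (Num.max (Num.min s b) a) ->
    U (f (Num.max (Num.min s b) a))] by exact: (gc t _ H').
by apply: filterS H2 => s; apply; exact: gA.
Qed.

(** * Existence and positivity of solutions *)

Section NicholsonSystems.
Variables (R : realType) (m : nat) (r : 'I_m -> R).
Hypothesis r_gt0 : forall i, 0 < r i.
Implicit Types (N : nicholson R m) (phi : state R m) (y : 'I_m -> R -> R).

(** Every inequality on the coefficients is non-strict and has constants uniform in time, so the
    whole record is inherited by limits of translates. *)
Record admissible N (C c0 : R) : Prop := Admissible {
  adm_C : 0 < C;
  adm_c0 : 0 < c0;
  decay_cont : forall i, continuous (decay N i);
  migration_cont : forall i j, continuous (migration N i j);
  birth_cont : forall i, continuous (birth N i);
  crowding_cont : forall i, continuous (crowding N i);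
  decay_bnd : forall i t, 0 <= decay N i t <= C;
  migration_bnd : forall i j t, 0 <= migration N i j t <= C;
  birth_bnd : forall i t, 0 <= birth N i t <= C;
  crowding_bnd : forall i t, c0 <= crowding N i t <= C;
  column_ge0 : forall i t, \sum_(j < m) migration N j i t <= decay N i t
}.

Lemma crowding_ge0 N C c0 : admissible N C c0 -> forall i t, 0 <= crowding N i t.
Proof.
move=> aN i t; have /andP[h _] := crowding_bnd aN i t.
exact: le_trans (ltW (adm_c0 aN)) h.
Qed.

Lemma rhsE N y i t : nicholson_rhs N r y i t =
  - decay N i t * y i t + \sum_(j < m) migration N i j t * y j t
  + birth N i t * ricker (crowding N i t) (y i (t - r i)).
Proof. by rewrite /nicholson_rhs /ricker mulrA. Qed.

Lemma stateX_int_bounds phi : stateX_int r phi -> exists mu K : R,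
  0 < mu /\ forall i s, - r i <= s <= 0 -> mu <= phi i s <= K.
Proof.
move=> [phiX phi0].
have r0 i : - r i <= 0 by rewrite oppr_le0 ltW.
have /choice[a Ha] : forall i, exists a : R, 0 < a /\ forall s, - r i <= s <= 0 -> a <= phi i s.
  move=> i; have [c cr Hc] := EVT_min (r0 i) (phiX i).1.
  exists (phi i c); split; first exact: phi0.
  by move=> s rs; apply: Hc; rewrite in_itv.
have [mu mu0 Hmu] := finite_positive_lower (fun i => (Ha i).1).
have /choice[b Hb] : forall i, exists b : R, forall s, - r i <= s <= 0 -> phi i s <= b.
  move=> i; have [c cr Hc] := EVT_max (r0 i) (phiX i).1.
  by exists (phi i c) => s rs; apply: Hc; rewrite in_itv.
exists mu, (\sum_i `|b i|); split => // i s rs; apply/andP; split.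
  exact: le_trans (Hmu i) ((Ha i).2 _ rs).
apply: le_trans (Hb i _ rs) _; rewrite (bigD1 i)//=.
by apply: le_trans (ler_norm _) _; rewrite lerDl sumr_ge0.
Qed.

Lemma solution_cont N phi y : is_solution N r phi y ->
  forall i, {within `[0, +oo[, continuous (y i)}.
Proof.
move=> ys i; have [yc _ _ _] := ys i; apply: continuous_subspaceW yc.
by move=> t /=; rewrite !in_itv/= !andbT; apply: le_trans; rewrite oppr_le0 ltW.
Qed.

Lemma solution_history N phi y : is_solution N r phi y ->
  forall i s, - r i <= s <= 0 -> y i s = phi i s.
Proof. by move=> ys i s rs; have [_ yh _ _] := ys i; apply: yh; rewrite in_itv. Qed.

Lemma solution_derive N phi y : is_solution N r phi y ->
  forall i (t : R), 0 < t -> is_derive t 1 (y i) (nicholson_rhs N r y i t).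
Proof. by move=> ys i; have [] := ys i. Qed.

(** The differential inequality is required only while the past is nonnegative, so the bound applies
    both to solutions and to the truncated equation whose positivity is still open. The factor 1/2
    and the rate [C + 1] provide strictness at time 0 and at a first contact. *)
Lemma exponential_lower_bound y (dy : 'I_m -> R -> R) (C mu : R) : 0 <= C -> 0 < mu ->
  (forall i, {within `[0, +oo[, continuous (y i)}) ->
  (forall i (t : R), 0 < t -> is_derive t 1 (y i) (dy i t)) ->
  (forall i s, - r i <= s <= 0 -> mu <= y i s) ->
  (forall i (t : R), 0 < t -> (forall j s, - r j <= s <= t -> 0 <= y j s) ->
     - C * y i t <= dy i t) ->
  forall i (t : R), 0 <= t -> mu / 2 * expR (- (C + 1) * t) < y i t.
Proof.
move=> C0 mu0 yc yd yh yg i t t0.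
pose E s : R := mu / 2 * expR (- (C + 1) * s).
have E0 s : 0 < E s by rewrite mulr_gt0 ?divr_gt0 ?expR_gt0.
have Ed s := @is_derive_expR_scale R (- (C + 1)) (mu / 2) s.
have rj j : - r j <= 0 by rewrite oppr_le0 ltW.
rewrite -subr_gt0.
apply: (@barrier R _ (fun i s => y i s - E s)
  (fun i s => dy i s - mu / 2 * (- (C + 1)) * expR (- (C + 1) * s)) t).
- move=> j x; apply: cvgB; first exact: yc.
  apply: continuous_subspaceT => s; have [d _] := Ed s.
  exact/differentiable_continuous/derivable1_diffP.
- move=> j; rewrite /E mulr0 expR0 mulr1 subr_gt0.
  apply: (@lt_le_trans _ _ mu); first by rewrite ltr_pdivrMr//; lra.
  by apply: yh; rewrite lexx andbT.
- by move=> j s /andP[s0 _]; have ? := yd j s s0; have ? := Ed s; exact: is_deriveB.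
- move=> j s /andP[s0 _] pos /eqP; rewrite subr_eq0 => /eqP Ej.
  have := yg j s s0; rewrite Ej => /(_ _).
  have H k u : - r k <= u <= s -> 0 <= y k u.
    move=> /andP[ru us]; have [u0|u0] := leP 0 u; last first.
      by apply: le_trans (ltW mu0) _; apply: yh; rewrite ru ltW.
    have := pos k u; rewrite u0 us => /(_ isT); rewrite subr_ge0; apply: le_trans.
    exact: ltW.
  move=> /(_ H); have := E0 s; rewrite /E; set e := _ * expR _ => e0 h.
  have -> : mu / 2 * - (C + 1) * expR (- (C + 1) * s) = - (C + 1) * e by rewrite /e; ring.
  lra.
- by rewrite t0 lexx.
Qed.

Lemma nonneg_rhs N C c0 y i t : admissible N C c0 -> 0 < t ->
  (forall j s, - r j <= s <= t -> 0 <= y j s) ->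
  - C * y i t <= nicholson_rhs N r y i t.
Proof.
move=> aN t0 y0; rewrite rhsE.
have yt j : 0 <= y j t.
  by apply: y0; rewrite lexx andbT ltW// (lt_trans _ t0)// oppr_lt0.
have h1 : - C * y i t <= - decay N i t * y i t.
  by rewrite ler_wpM2r// lerN2; have /andP[] := decay_bnd aN i t.
have h2 : 0 <= \sum_(j < m) migration N i j t * y j t.
  by apply: sumr_ge0 => j _; rewrite mulr_ge0//; have /andP[] := migration_bnd aN i j t.
have h3 : 0 <= birth N i t * ricker (crowding N i t) (y i (t - r i)).
  rewrite mulr_ge0//; first by have /andP[] := birth_bnd aN i t.
  by apply/ricker_ge0/y0; have := r_gt0 i; move=> ?; apply/andP; split; lra.
lra.
Qed.

Lemma solution_lower_bound N C c0 phi y (mu : R) : admissible N C c0 ->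
  is_solution N r phi y -> 0 < mu ->
  (forall i s, - r i <= s <= 0 -> mu <= phi i s) ->
  forall i (t : R), 0 <= t -> mu / 2 * expR (- (C + 1) * t) < y i t.
Proof.
move=> aN ys mu0 phi_mu.
apply: (@exponential_lower_bound y (nicholson_rhs N r y)) => //.
- exact: ltW (adm_C aN).
- exact: solution_cont ys.
- exact: solution_derive ys.
- by move=> i s rs; rewrite (solution_history ys)//; exact: phi_mu.
- by move=> i t t0 H; exact: nonneg_rhs aN t0 H.
Qed.

Lemma solution_gt0 N C c0 phi y : admissible N C c0 -> stateX_int r phi ->
  is_solution N r phi y -> forall i s, - r i <= s -> 0 < y i s.
Proof.
move=> aN phi0 ys i s rs.
have [mu [K [mu0 H]]] := stateX_int_bounds phi0.
have Hmu j u : - r j <= u <= 0 -> mu <= phi j u by move=> /H/andP[].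
have [s0|s0] := leP 0 s; last first.
  by rewrite (solution_history ys) ?rs ?ltW//; apply: lt_le_trans mu0 _; apply: Hmu; rewrite rs ltW.
apply: le_lt_trans (solution_lower_bound aN ys mu0 Hmu i s0).
by rewrite mulr_ge0 ?divr_ge0 ?expR_ge0// ltW.
Qed.

(** The Ricker function is globally Lipschitz on nonnegative arguments only, so the delayed argument
    is truncated at 0 before Picard iteration; the solution obtained is nonnegative, hence solves
    the original equation. *)
Lemma solution_exists N C c0 phi : admissible N C c0 -> stateX_int r phi ->
  exists y, is_solution N r phi y.
Proof.
move=> aN phiI; have [mu [K [mu0 HmuK]]] := stateX_int_bounds phiI.
have r0 i : - r i <= 0 by rewrite oppr_le0 ltW.
pose ph i (s : R) := phi i (Num.max (Num.min s 0) (- r i)).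
pose F (Y : 'I_m -> R -> R) i t :=
  - decay N i t * Y i t + \sum_(j < m) migration N i j t * Y j t
  + birth N i t * ricker (crowding N i t) (Num.max (Y i (t - r i)) 0).
pose L := C + m%:R * C + C.
have C0 := adm_C aN.
have phc i : continuous (ph i) by apply: clamp_continuous (r0 i) _; exact: (phiI.1 i).1.
have Fc Y : (forall i, continuous (Y i)) -> forall i, continuous (F Y i).
  move=> Yc i t; apply: cvgD; first apply: cvgD.
  - by apply: cvgM; [apply: cvgN; exact: (decay_cont aN)|exact: Yc].
  - apply: sum_continuous => j u; apply: cvgM; [exact: (migration_cont aN)|exact: Yc].
  apply: cvgM; first exact: (birth_cont aN).
  apply: ricker_continuous; first exact: (crowding_cont aN).
  move=> u; apply: (@continuous_comp _ _ _ (fun u => Y i (u - r i)) (fun x : R => Num.max x 0));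
    last exact: maxr_cst_continuous.
  apply: (@continuous_comp _ _ _ (fun u => u - r i) (Y i)); last exact: Yc.
  by apply: cvgB; [exact: cvg_id|exact: cvg_cst].
have Flip (Y Z : 'I_m -> R -> R) i (t E : R) : 0 <= t ->
    (forall j (s : R), s <= t -> `|Y j s - Z j s| <= E) -> `|F Y i t - F Z i t| <= L * E.
  move=> t0 YZ; have E0 : 0 <= E by apply: le_trans (YZ i t (lexx t)).
  have -> : F Y i t - F Z i t = - decay N i t * (Y i t - Z i t)
      + \sum_(j < m) migration N i j t * (Y j t - Z j t)
      + birth N i t * (ricker (crowding N i t) (Num.max (Y i (t - r i)) 0)
                       - ricker (crowding N i t) (Num.max (Z i (t - r i)) 0)).
    have -> : \sum_(j < m) migration N i j t * (Y j t - Z j t) =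
        \sum_(j < m) migration N i j t * Y j t - \sum_(j < m) migration N i j t * Z j t.
      by rewrite -sumrB; apply: eq_bigr => j _; rewrite mulrBr.
    by rewrite /F; ring.
  have h1 : `|- decay N i t * (Y i t - Z i t)| <= C * E.
    have /andP[d0 d1] := decay_bnd aN i t.
    by rewrite normrM normrN (ger0_norm d0); apply: ler_pM => //; exact: YZ.
  have h2 : `|\sum_(j < m) migration N i j t * (Y j t - Z j t)| <= m%:R * C * E.
    apply: le_trans (ler_norm_sum _ _ _) _.
    apply: (@le_trans _ _ (\sum_(j < m) C * E)); last first.
      by rewrite sumr_const card_ord -mulrA mulr_natl.
    apply: ler_sum => j _; have /andP[d0 d1] := migration_bnd aN i j t.
    by rewrite normrM (ger0_norm d0); apply: ler_pM => //; exact: YZ.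
  have h3 : `|birth N i t * (ricker (crowding N i t) (Num.max (Y i (t - r i)) 0)
                       - ricker (crowding N i t) (Num.max (Z i (t - r i)) 0))| <= C * E.
    have /andP[d0 d1] := birth_bnd aN i t.
    rewrite normrM (ger0_norm d0); apply: ler_pM => //.
    apply: le_trans (ricker_lip (crowding_ge0 aN i t) _ _) _; rewrite ?le_max ?lexx ?orbT//.
    apply: le_trans (_ : `|Y i (t - r i) - Z i (t - r i)| <= _); last first.
      by apply: YZ; rewrite gerBl ltW.
    exact: max_nonexpansive.
  rewrite /L !mulrDl.
  apply: le_trans (ler_normD _ _) _; apply: lerD h3.
  by apply: le_trans (ler_normD _ _) _; apply: lerD h2.
have phb i s : s <= 0 -> `|ph i s| <= K.
  move=> s0; have : - r i <= Num.max (Num.min s 0) (- r i) <= 0.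
    by rewrite le_max lexx orbT ge_max r0 ge_min lexx orbT.
  move=> /HmuK/andP[h1 h2]; rewrite ger0_norm//.
  exact: le_trans (ltW mu0) h1.
have Fb i (t : R) : 0 <= t -> `|F (fun j s => ph j (Num.min s 0)) i t| <= L * K.
  move=> t0; have := Flip (fun j s => ph j (Num.min s 0)) (fun _ _ => 0) i t K t0.
  have -> : F (fun _ _ => 0) i t = 0.
    rewrite /F mulr0 big1; last by move=> j _; rewrite mulr0.
    by rewrite /ricker maxxx mul0r mulr0 !addr0.
  rewrite subr0; apply => j s st; rewrite subr0; apply: phb.
  by rewrite ge_min lexx orbT.
have L0 : 0 < L.
  have : 0 <= m%:R * C by rewrite mulr_ge0// ltW.
  by rewrite /L; lra.
have [y [yc yh yd0 yd]] := picard L0 phc Fc Flip Fb.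
have yhist i s : - r i <= s <= 0 -> y i s = phi i s.
  move=> /andP[rs s0]; rewrite yh// /ph; congr (phi i _).
  by rewrite (min_idPl s0) (max_idPl rs).
have y0 i s : - r i <= s -> 0 <= y i s.
  move=> rs; have [s0|s0] := leP 0 s; last first.
    rewrite yhist; last by rewrite rs ltW.
    apply/ltW/(lt_le_trans mu0).
    by have /andP[] : mu <= phi i s <= K by apply: HmuK; rewrite rs ltW.
  apply/ltW; apply: le_lt_trans (@exponential_lower_bound y (F y) C mu (ltW C0) mu0 _ _ _ _ i s s0).
  - by rewrite mulr_ge0 ?divr_ge0 ?expR_ge0// ltW.
  - by move=> j; exact: continuous_subspaceT.
  - by move=> j u ju; rewrite yhist//; have /andP[] := HmuK j u ju.
  move=> j t t0 H; have -> : F y j t = nicholson_rhs N r y j t.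
    rewrite rhsE /F; congr (_ + _ * ricker _ _); apply/max_idPl/H.
    by have := r_gt0 j; move=> ?; apply/andP; split; lra.
  exact: nonneg_rhs aN t0 H.
have FE i t : 0 <= t -> F y i t = nicholson_rhs N r y i t.
  move=> t0; rewrite rhsE /F; congr (_ + _ * ricker _ _); apply/max_idPl/y0; lra.
exists y => i; split.
- exact: continuous_subspaceT.
- by move=> s; rewrite in_itv/=; exact: yhist.
- by rewrite -FE.
- by move=> t t0; rewrite -FE ?(ltW t0)//; exact: yd.
Qed.

End NicholsonSystems.

(** * Continuous dependence, uniqueness and time shifts *)

Section SolutionMap.
Variables (R : realType) (m : nat) (r : 'I_m -> R).
Hypothesis r_gt0 : forall i, 0 < r i.
Implicit Types (N : nicholson R m) (phi : state R m) (y : 'I_m -> R -> R).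

Definition coefs_close N1 N2 (e t : R) : Prop :=
  [/\ forall i, `|decay N1 i t - decay N2 i t| <= e,
      forall i j, `|migration N1 i j t - migration N2 i j t| <= e,
      forall i, `|birth N1 i t - birth N2 i t| <= e &
      forall i, `|crowding N1 i t - crowding N2 i t| <= e].

(** The contributions of decay, migration and birth when coefficients and states both vary, for
    states below [K]. The final 1 is a surplus that makes the comparison in [solution_dist]
    strict. *)
Definition growth_rate (C K : R) : R :=
  (K + C) + m%:R * (K + C) + (K + C * K ^+ 2 + C) + 1.

Lemma growth_rate_ge1 (C K : R) : 0 <= C -> 0 <= K -> 1 <= growth_rate C K.
Proof.
move=> C0 K0; have h1 : 0 <= m%:R * (K + C) by rewrite mulr_ge0// addr_ge0.
have h2 : 0 <= C * K ^+ 2 by rewrite mulr_ge0// exprn_ge0.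
by rewrite /growth_rate; lra.
Qed.

Lemma rhs_dist N1 N2 C c0 y1 y2 (e E K t : R) i :
  admissible N1 C c0 -> admissible N2 C c0 -> 0 <= e <= E ->
  coefs_close N1 N2 e t ->
  (forall j, 0 <= y1 j t <= K) -> 0 <= y1 i (t - r i) <= K -> 0 <= y2 i (t - r i) ->
  (forall j, `|y1 j t - y2 j t| <= E) -> `|y1 i (t - r i) - y2 i (t - r i)| <= E ->
  `|nicholson_rhs N1 r y1 i t - nicholson_rhs N2 r y2 i t| <= (growth_rate C K - 1) * E.
Proof.
move=> a1 a2 /andP[e0 eE] [hd ha hb hc] yK /andP[z0 zK] w0 yE zE; rewrite !rhsE.
have C0 := ltW (adm_C a1).
have K0 : 0 <= K by exact: le_trans zK.
have E0 := le_trans e0 eE.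
set z := y1 i _ in z0 zK zE *; set w := y2 i _ in w0 zE *.
have bnd (a x b u A X : R) : `|a| <= A -> `|x| <= X -> `|b| <= C -> `|u| <= E ->
    A <= E -> `|a * x + b * u| <= (X + C) * E.
  move=> aA xX bC uE AE; apply: le_trans (ler_normD _ _) _; rewrite mulrDl !normrM.
  apply: lerD; last exact: ler_pM.
  by rewrite mulrC; apply: ler_pM => //; exact: le_trans AE.
have h1 : `|(- (decay N1 i t - decay N2 i t)) * y1 i t + (- decay N2 i t) * (y1 i t - y2 i t)|
    <= (K + C) * E.
  apply: bnd eE => //; first by rewrite normrN.
    by have /andP[? ?] := yK i; rewrite ger0_norm.
  by have /andP[? ?] := decay_bnd a2 i t; rewrite normrN ger0_norm.
have h2 : `|\sum_(j < m) ((migration N1 i j t - migration N2 i j t) * y1 j t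
     + migration N2 i j t * (y1 j t - y2 j t))| <= m%:R * (K + C) * E.
  apply: le_trans (ler_norm_sum _ _ _) _.
  apply: (@le_trans _ _ (\sum_(j < m) (K + C) * E)); last first.
    by rewrite sumr_const card_ord -mulrA mulr_natl.
  apply: ler_sum => j _; apply: bnd eE => //.
    by have /andP[? ?] := yK j; rewrite ger0_norm.
  by have /andP[? ?] := migration_bnd a2 i j t; rewrite ger0_norm.
have c1 := crowding_ge0 a1 i t; have c2 := crowding_ge0 a2 i t.
have b2 : `|birth N2 i t| <= C.
  by have /andP[? ?] := birth_bnd a2 i t; rewrite ger0_norm.
have h3 : `|(birth N1 i t - birth N2 i t) * ricker (crowding N1 i t) z
    + birth N2 i t * (ricker (crowding N2 i t) z - ricker (crowding N2 i t) w)| <= (K + C) * E.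
  apply: bnd eE => //.
    by rewrite ger0_norm ?ricker_ge0//; exact: le_trans (ricker_le c1 z0) zK.
  exact: le_trans (ricker_lip c2 z0 w0) zE.
have h4 : `|birth N2 i t * (ricker (crowding N1 i t) z - ricker (crowding N2 i t) z)|
    <= C * K ^+ 2 * E.
  rewrite normrM -mulrA; apply: ler_pM => //.
  apply: le_trans (ricker_lip_rate c1 c2 z0) _; rewrite mulrC.
  apply: ler_pM => //; first by rewrite exprn_ge0.
    by rewrite ler_pXn2r.
  exact: le_trans (hc i) eE.
set A1 := _ + _ in h1; set A2 := \sum_(j < m) _ in h2; set A3 := _ + _ in h3.
set A4 := _ * _ in h4.
rewrite (_ : _ - _ = A1 + A2 + A3 + A4).
  have := ler_normD (A1 + A2 + A3) A4; have := ler_normD (A1 + A2) A3.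
  have := ler_normD A1 A2; rewrite /growth_rate; lra.
have -> : A2 = \sum_(j < m) migration N1 i j t * y1 j t - \sum_(j < m) migration N2 i j t * y2 j t.
  by rewrite -sumrB; apply: eq_bigr => j _; ring.
by rewrite /A1 /A3 /A4; ring.
Qed.

(** A Gronwall estimate by comparison: the factor 2 gives strictness at time 0, the surplus in
    [growth_rate] at a contact. The bound [K] is asked of [y1] alone, so a tolerance can be fixed
    before the perturbed solution is known. *)
Lemma solution_dist N1 N2 C c0 phi1 phi2 y1 y2 (e K T : R) :
  admissible N1 C c0 -> admissible N2 C c0 ->
  stateX_int r phi1 -> stateX_int r phi2 ->
  is_solution N1 r phi1 y1 -> is_solution N2 r phi2 y2 -> 0 < e ->
  (forall i s, - r i <= s <= 0 -> `|phi1 i s - phi2 i s| <= e) ->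
  (forall t : R, 0 < t <= T -> coefs_close N1 N2 e t) ->
  (forall i s, - r i <= s <= T -> y1 i s <= K) ->
  forall i (t : R), 0 <= t <= T ->
    `|y1 i t - y2 i t| <= 2 * e * expR (growth_rate C K * t).
Proof.
move=> a1 a2 p1 p2 s1 s2 e0 phie ce yK i t tT.
have y10 := solution_gt0 r_gt0 a1 p1 s1; have y20 := solution_gt0 r_gt0 a2 p2 s2.
have C0 := ltW (adm_C a1).
have K0 : 0 <= K.
  have /andP[t0 t1] := tT.
  have ri : - r i <= 0 by rewrite oppr_le0 ltW.
  apply: le_trans (ltW (y10 i 0 ri)) _; apply: yK; rewrite ri/=; exact: le_trans t1.
have k1 := growth_rate_ge1 C0 K0.
set k := growth_rate C K in k1 *.
pose E s : R := 2 * e * expR (k * s).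
have Ed s := @is_derive_expR_scale R k (2 * e) s.
have E0 s : 0 < E s by rewrite !mulr_gt0// expR_gt0.
have EE s u : s <= u -> E s <= E u.
  move=> su; rewrite ler_wpM2l ?mulr_ge0 ?(ltW e0)// ler_expR ler_wpM2l//.
  exact: le_trans k1.
have E00 : E 0 = 2 * e by rewrite /E mulr0 expR0 mulr1.
have hist j s : - r j <= s <= 0 -> `|y1 j s - y2 j s| <= e.
  by move=> js; rewrite (solution_history s1)// (solution_history s2)//; exact: phie.
suff H (p : 'I_m * bool) : 0 < E t - (-1) ^+ p.2 * (y1 p.1 t - y2 p.1 t).
  have := H (i, true); have := H (i, false); rewrite /= expr0 expr1 mul1r mulN1r opprK.
  rewrite -/k -/(E t) => h1 h2; rewrite ler_norml; apply/andP; split; lra.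
(* The barrier is applied to both signs of the difference at once. *)
apply: (@barrier R ('I_m * bool)%type (fun p s => E s - (-1) ^+ p.2 * (y1 p.1 s - y2 p.1 s))
  (fun p s => 2 * e * k * expR (k * s) - (-1) ^+ p.2 *
     (nicholson_rhs N1 r y1 p.1 s - nicholson_rhs N2 r y2 p.1 s)) T _ _ _ _ p t tT).
- move=> [j b] x; apply: cvgB.
    apply: continuous_subspaceT => s; have [d _] := Ed s.
    exact/differentiable_continuous/derivable1_diffP.
  apply: cvgM; first exact: cvg_cst.
  by apply: cvgB; [exact: (solution_cont r_gt0 s1)|exact: (solution_cont r_gt0 s2)].
- move=> [j b] /=; rewrite E00 subr_gt0.
  apply: le_lt_trans (ler_norm _) _; rewrite normrM normrX normrN1 expr1n mul1r.
  apply: le_lt_trans (hist j 0 _) _; first by rewrite lexx oppr_le0 ltW.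
  lra.
- move=> [j b] s /andP[s0 sT] /=.
  have ? := solution_derive s1 j s0; have ? := solution_derive s2 j s0.
  have D := is_deriveB (solution_derive s1 j s0) (solution_derive s2 j s0).
  exact: is_deriveB (Ed s) (is_deriveZ ((-1) ^+ b) D).
move=> [j b] s /andP[s0 sT] /= pos _.
have posn l u : 0 <= u <= s -> `|y1 l u - y2 l u| <= E s.
  move=> us; have := pos (l, true) u us; have := pos (l, false) u us.
  rewrite /= expr0 expr1 mul1r mulN1r opprK => h1 h2.
  have /andP[_ /EE Eus] := us.
  by rewrite ler_norml; apply/andP; split; lra.
have eEs : e <= E s.
  by apply: le_trans (EE 0 s (ltW s0)); rewrite E00; lra.
have posr l : `|y1 l (s - r l) - y2 l (s - r l)| <= E s.
  have rl := r_gt0 l; have [u0|u0] := leP 0 (s - r l).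
    by apply: posn; apply/andP; split; lra.
  by apply: le_trans (hist l _ _) eEs; apply/andP; split; lra.
have rl l := r_gt0 l.
have H : `|nicholson_rhs N1 r y1 j s - nicholson_rhs N2 r y2 j s| <= (k - 1) * E s.
  apply: (@rhs_dist _ _ C c0 _ _ e) => //.
  - by rewrite (ltW e0).
  - by apply: ce; rewrite s0.
  - move=> l; have := rl l => ?; apply/andP; split; first by apply/ltW/y10; lra.
    by apply: yK; apply/andP; split; lra.
  - have := rl j => ?; apply/andP; split; first by apply/ltW/y10; lra.
    by apply: yK; apply/andP; split; lra.
  - by have := rl j => ?; apply/ltW/y20; lra.
  - by move=> l; apply: posn; rewrite lexx ltW.
rewrite subr_gt0; apply: le_lt_trans (ler_norm _) _; rewrite normrM normrX normrN1 expr1n mul1r.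
apply: le_lt_trans H _.
have -> : 2 * e * k * expR (k * s) = k * E s by rewrite /E; ring.
by rewrite ltr_pM2r//; lra.
Qed.

Lemma solution_bounded N C c0 phi y (T : R) :
  admissible N C c0 -> stateX_int r phi -> is_solution N r phi y -> 0 <= T ->
  exists K : R, forall i s, - r i <= s <= T -> y i s <= K.
Proof.
move=> aN pI ys T0; have [mu [K [mu0 HK]]] := stateX_int_bounds r_gt0 pI.
have /choice[b Hb] : forall i, exists b : R, forall s, 0 <= s <= T -> y i s <= b.
  move=> i; have yc : {within `[0, T], continuous (y i)}.
    apply: continuous_subspaceW (@solution_cont _ _ _ r_gt0 _ _ _ ys i).
    by move=> s /=; rewrite !in_itv/= => /andP[->].
  have [c _ Hc] := EVT_max T0 yc.
  by exists (y i c) => s sT; apply: Hc; rewrite in_itv.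
exists (`|K| + \sum_i `|b i|) => i s /andP[rs sT].
have b0 : `|b i| <= \sum_i `|b i| by rewrite (bigD1 i)//= lerDl sumr_ge0.
have [s0|s0] := leP 0 s.
  have h : y i s <= b i by apply: Hb; rewrite s0.
  by have := ler_norm (b i); have := normr_ge0 K; lra.
have rs0 : - r i <= s <= 0 by rewrite rs ltW.
rewrite (solution_history ys)//; have /andP[_ h] := HK i s rs0.
by have := ler_norm K; have := normr_ge0 (b i); lra.
Qed.

Lemma solution_unique N C c0 phi y1 y2 :
  admissible N C c0 -> stateX_int r phi ->
  is_solution N r phi y1 -> is_solution N r phi y2 ->
  forall i s, - r i <= s -> y1 i s = y2 i s.
Proof.
move=> aN pI s1 s2 i s rs; have [s0|s0] := leP 0 s; last first.
  by rewrite (solution_history s1) ?(solution_history s2) ?rs ?ltW.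
have [K HK] := solution_bounded aN pI s1 s0.
apply/eqP; rewrite -subr_eq0 -normr_le0; apply/ler_addgt0Pl => e e0; rewrite addr0.
have X0 := expR_gt0 (growth_rate C K * s).
pose e' := e / (2 * expR (growth_rate C K * s)).
have e'0 : 0 < e' by rewrite divr_gt0// mulr_gt0.
have -> : e = 2 * e' * expR (growth_rate C K * s).
  by rewrite /e'; field; rewrite gt_eqF.
apply: (solution_dist aN aN pI pI s1 s2 e'0 _ _ HK); last by rewrite s0 lexx.
- by move=> j u _; rewrite subrr normr0 ltW.
- by move=> u _; split => *; rewrite subrr normr0 ltW.
Qed.

Lemma solutionP N C c0 phi : admissible N C c0 -> stateX_int r phi ->
  is_solution N r phi (solution N r phi).
Proof.
move=> aN pI; have [y ys] := solution_exists r_gt0 aN pI.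
exact: (xgetPex (fun _ _ => 0) (ex_intro _ y ys)).
Qed.

Definition shift_system N (s : R) : nicholson R m :=
  Nicholson (fun i t => decay N i (s + t)) (fun i j t => migration N i j (s + t))
    (fun i t => birth N i (s + t)) (fun i t => crowding N i (s + t)).

Lemma shift_admissible N C c0 (s : R) :
  admissible N C c0 -> admissible (shift_system N s) C c0.
Proof.
have sc (f : R -> R) : continuous f -> continuous (fun t => f (s + t)).
  move=> fc t; apply: (@continuous_comp _ _ _ (fun t => s + t) f); last exact: fc.
  by apply: cvgD; [exact: cvg_cst|exact: cvg_id].
move=> [] *; split => //= *; try exact: sc; auto.
Qed.

Lemma within_shift_continuous (f : R -> R) (a s : R) : 0 <= s ->
  {within `[a, +oo[, continuous f} -> {within `[a, +oo[, continuous (fun u => f (s + u))}.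
Proof.
move=> s0 fc; apply/subspace_continuousP => x xr.
have sr (u : R) : `[a, +oo[%classic u -> `[a, +oo[%classic (s + u).
  by rewrite /= !in_itv/= !andbT; lra.
move: fc => /subspace_continuousP/(_ (s + x) (sr _ xr)) fc.
move=> U /fc H.
have H' : nbhs (s + x) [set u | `[a, +oo[%classic u -> U (f u)] by exact: H.
have tc : continuous (fun u : R => s + u).
  by move=> u; apply: cvgD; [exact: cvg_cst|exact: cvg_id].
have H2 : nbhs x [set u | `[a, +oo[%classic (s + u) -> U (f (s + u))] by exact: (tc x _ H').
by apply: filterS H2 => u /= Hu /sr/Hu.
Qed.

Lemma solution_shift N phi y (s : R) : is_solution N r phi y -> 0 <= s ->
  is_solution (shift_system N s) r (segment r y s) (fun i t => y i (s + t)).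
Proof.
move=> ys s0 i; have [yc yh yd0 yd] := ys i.
have rE t : nicholson_rhs (shift_system N s) r (fun i t => y i (s + t)) i t =
    nicholson_rhs N r y i (s + t).
  by rewrite /nicholson_rhs /= addrA.
have dE (t : R) : 0 < s + t ->
      is_derive t 1 (fun t => y i (s + t)) (nicholson_rhs N r y i (s + t)).
  move=> st0; have h := is_derive_translate s t.
  by apply: is_derive_eq (is_derive1_comp (yd _ st0) h) _; rewrite mulr1.
split.
- exact: within_shift_continuous yc.
- by move=> u ur; rewrite /segment patchE mem_set.
(* For [s = 0] this is the right derivative of the original solution; for [s > 0] it follows from
   the two-sided one. *)
- rewrite rE addr0; move: s0; rewrite le_eqVlt => /predU1P[<-|s0].
    by under eq_cvg do rewrite !add0r.
  have s00 : 0 < s + 0 by rewrite addr0.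
  have [d dE0] := dE 0 s00.
  have H : h^-1 *: (y i (s + (h *: 1 + 0)) - y i (s + 0)) @[h --> 0^'] -->
      'D_1 (fun t => y i (s + t)) 0.
    exact: d.
  rewrite dE0 addr0 in H.
  move=> U /H[e e0 he]; exists e => // h eh h0.
  have := he h eh; rewrite gt_eqF// => /(_ isT); rewrite /GRing.scale/= mulr1 !addr0; exact.
- by move=> t t0; rewrite rE; apply: dE; lra.
Qed.

Lemma segment_int y (s : R) : 0 <= s ->
  (forall i, {within `[- r i, +oo[, continuous (y i)}) ->
  (forall i u, - r i <= u -> 0 < y i u) -> stateX_int r (segment r y s).
Proof.
move=> s0 yc ypos; split=> [i|i u ur]; last first.
  rewrite /segment patchE mem_set//; apply: ypos.
  by move: ur; rewrite in_itv/= => /andP[]; lra.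
split; last first.
  by apply/funext => u; rewrite /segment /= !patchE; case: ifPn => // ->.
apply: (@subspace_eq_continuous _ _ _ (fun u => y i (s + u))).
  by move=> u ur; rewrite -[RHS]/(((fun v => y i (s + v)) \_ `[- r i, 0]) u) patchE ur.
apply: continuous_subspaceW (within_shift_continuous s0 (yc i)).
by move=> u /=; rewrite !in_itv/= => /andP[->].
Qed.

End SolutionMap.

(** * Dissipativity and persistence *)

Lemma derive_ge0_le (R : realType) (f df : R -> R) (a b : R) : a <= b ->
  (forall x, a <= x <= b -> is_derive x 1 f (df x)) ->
  (forall x, a <= x <= b -> 0 <= df x) -> f a <= f b.
Proof.
move=> ab fd f0.
have P x : a < x < b -> a <= x <= b by move=> /andP[? ?]; rewrite !ltW.
have fd' x : a <= x <= b -> is_derive x 1 (fun u => - f u) (- df x).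
  by move=> /fd h; exact: is_deriveN.
rewrite -lerN2; apply: (derive_le0_le ab (derivable_within_continuous_itv fd')
  (fun x h => fd' x (P x h))).
by move=> x /P/f0; rewrite oppr_le0.
Qed.

Lemma window_growth (R : realType) (G : R -> R) (W eta : R) :
  0 < W -> (forall t, 0 <= t -> G t + eta <= G (t + W)) ->
  (forall s t, 0 <= s <= t -> G s <= G t) ->
  forall n s t, 0 <= s -> n%:R * W <= t -> G s + n%:R * eta <= G (s + t).
Proof.
move=> W0 GW Gmono; elim=> [|n IH] s t s0 nt.
  by rewrite mul0r in nt; rewrite mul0r addr0; apply: Gmono; rewrite s0; lra.
have nW : 0 <= n%:R * W by rewrite mulr_ge0// ltW.
rewrite -natr1 mulrDl mul1r in nt.
have h1 : G s + n%:R * eta <= G (s + (t - W)) by apply: IH => //; lra.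
have h2 := GW (s + (t - W)).
have e1 : s + (t - W) + W = s + t by ring.
rewrite e1 in h2; have := h2 _; rewrite -natr1 mulrDl mul1r => h3.
have : G (s + (t - W)) + eta <= G (s + t) by apply: h3; lra.
lra.
Qed.

(** * Ultimate upper bounds through the total population *)

Section Dissipativity.
Variables (R : realType) (m : nat) (r : 'I_m -> R).
Hypothesis r_gt0 : forall i, 0 < r i.
Implicit Types (N : nicholson R m) (phi : state R m) (y : 'I_m -> R -> R).

(** Exchanging the double sum charges to [y i] its column of migration rates, which is where the
    column gaps appear. The birth terms are bounded by C/c0 whatever the delayed values, since the
    Ricker function is at most 1/c. *)
Lemma total_rhs N C c0 phi y (g t : R) : admissible N C c0 -> stateX_int r phi ->
  is_solution N r phi y -> 0 < t ->
  (forall i, g <= decay N i t - \sum_(j < m) migration N j i t) ->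
  \sum_(i < m) nicholson_rhs N r y i t <= - g * (\sum_(i < m) y i t) + m%:R * (C / c0).
Proof.
move=> aN pI ys t0 gE.
have y0 := solution_gt0 r_gt0 aN pI ys.
have yt i : 0 <= y i t by apply/ltW/y0; have := r_gt0 i; lra.
have c00 := adm_c0 aN.
under eq_bigr => i _ do rewrite rhsE.
rewrite !big_split /= exchange_big /=.
have h1 : \sum_(i < m) - decay N i t * y i t
    + \sum_(j < m) \sum_(i < m) migration N i j t * y j t <= - g * \sum_(i < m) y i t.
  rewrite -big_split /= mulr_sumr; apply: ler_sum => i _.
  by rewrite -mulr_suml -mulrDl ler_wpM2r//; have := gE i; lra.
have h2 : \sum_(i < m) birth N i t * ricker (crowding N i t) (y i (t - r i)) <= m%:R * (C / c0).
  apply: (@le_trans _ _ (\sum_(i < m) C / c0)); last by rewrite sumr_const card_ord mulr_natl.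
  apply: ler_sum => i _; have /andP[b0 b1] := birth_bnd aN i t.
  have /andP[k0 k1] := crowding_bnd aN i t.
  have yr : 0 <= y i (t - r i) by apply/ltW/y0; lra.
  have kk := lt_le_trans c00 k0.
  apply: ler_pM => //; first exact: ricker_ge0.
  apply: le_trans (ricker_bound kk yr) _.
  by rewrite lef_pV2.
lra.
Qed.

(** Variation of constants: e^G S grows at a rate at most B e^G <= B e^(G b). The crude forcing term
    B (b - a) suffices because windows of bounded length are used. *)
Lemma total_decay N C c0 phi y (g G : R -> R) (a b : R) :
  admissible N C c0 -> stateX_int r phi -> is_solution N r phi y -> 0 <= a <= b ->
  (forall t : R, 0 <= t -> is_derive t 1 G (g t)) -> (forall t : R, 0 <= t -> 0 <= g t) ->
  (forall t i, 0 < t -> g t <= decay N i t - \sum_(j < m) migration N j i t) ->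
  \sum_(i < m) y i b <= expR (G a - G b) * (\sum_(i < m) y i a) + m%:R * (C / c0) * (b - a).
Proof.
move=> aN pI ys /andP[a0 ab] Gd g0 gE.
pose S (t : R) := \sum_(i < m) y i t; pose B := m%:R * (C / c0).
have B0 : 0 <= B by rewrite mulr_ge0// divr_ge0// ltW// ?(adm_C aN)// (adm_c0 aN).
pose dS t := \sum_(i < m) nicholson_rhs N r y i t.
have Sd (t : R) : 0 < t -> is_derive t 1 S (dS t).
  by move=> t0; apply: is_derive_bigsum => i; exact: (solution_derive ys).
have EGd (t : R) : 0 <= t -> is_derive t 1 (fun t => expR (G t)) (expR (G t) * g t).
  by move=> t0; exact: is_derive1_comp (is_derive_expR (G t)) (Gd t t0).
pose Z t := expR (G t) * S t - B * expR (G b) * t.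
pose dZ t := expR (G t) * (g t * S t + dS t) - B * expR (G b).
have Zd (t : R) : 0 < t -> is_derive t 1 Z (dZ t).
  move=> t0; have h1 := is_deriveM (EGd t (ltW t0)) (Sd t t0).
  have h2 := is_deriveZ (B * expR (G b)) (is_derive_id t (1 : R)).
  by apply: is_derive_eq (is_deriveB h1 h2) _; rewrite /dZ /GRing.scale/=; ring.
have Zc : {within `[a, b], continuous Z}.
  have sub : `[a, b]%classic `<=` `[0, +oo[%classic.
    by move=> t /=; rewrite !in_itv/= andbT => /andP[at_ _]; exact: le_trans at_.
  have Sc : {within `[a, b], continuous S}.
    apply: (continuous_subspaceW sub).
    have := fun i => @solution_cont _ _ _ r_gt0 _ _ _ ys i.
    rewrite /S; elim: (index_enum _) => [|i s IH] H.
      have -> : (fun t => \sum_(i <- [::]) y i t) = cst 0 by apply/funext => u; rewrite big_nil.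
      by move=> t; exact: cvg_cst.
    have -> : (fun t => \sum_(i <- i :: s) y i t) = y i \+ (fun t => \sum_(i <- s) y i t).
      by apply/funext => u; rewrite big_cons.
    by move=> t; apply: cvgD; [exact: H|exact: IH].
  have EGc : {within `[a, b], continuous (fun t => expR (G t))}.
    apply: (derivable_within_continuous_itv (df := fun t => expR (G t) * g t)) => t /andP[at_ _].
    by apply: EGd; exact: le_trans at_.
  move=> t; apply: cvgB; first by apply: cvgM; [exact: EGc|exact: Sc].
  by apply: cvgM; [exact: cvg_cst|apply: continuous_subspaceT => u; exact: cvg_id].
have Gmono (t : R) : a <= t <= b -> G t <= G b.
  move=> /andP[at_ tb]; apply: (derive_ge0_le (df := g) tb) => x /andP[tx _].
    by apply: Gd; lra.
  by apply: g0; lra.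
have ZZ : Z b <= Z a.
  apply: (derive_le0_le ab Zc (df := dZ)) => t /andP[at_ tb]; first by apply: Zd; lra.
  have t0 : 0 < t by lra.
  have h := total_rhs aN pI ys t0 (fun i => gE t i t0).
  have hG : expR (G t) <= expR (G b) by rewrite ler_expR; apply: Gmono; rewrite !ltW.
  have hE := expR_gt0 (G t).
  have : expR (G t) * (g t * S t + dS t) <= expR (G t) * B.
    by apply: ler_wpM2l; [exact: ltW|move: h; rewrite -/(dS t) -/(S t) -/B; lra].
  have : expR (G t) * B <= expR (G b) * B by rewrite ler_wpM2r.
  by rewrite /dZ; lra.
have E0 := expR_gt0 (G b).
rewrite -/(S a) -/(S b) -/B -(ler_pM2l E0) mulrDr mulrA -expRD.
have -> : G b + (G a - G b) = G a by ring.
by move: ZZ; rewrite /Z; lra.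
Qed.

(** One window of length [W] sends the sum S to at most q S + B W with q = e^(-eta) < 1. [P] is the
    fixed point of this affine map, and the excess over [P] shrinks by [q] per window. *)
Lemma uniform_dissipativity N C c0 (g G : R -> R) (W eta : R) :
  admissible N C c0 ->
  (forall t : R, 0 <= t -> is_derive t 1 G (g t)) -> (forall t : R, 0 <= t -> 0 <= g t) ->
  (forall t i, g t <= decay N i t - \sum_(j < m) migration N j i t) ->
  0 < W -> 0 < eta -> (forall t, 0 <= t -> G t + eta <= G (t + W)) ->
  exists2 K : R, 0 < K & forall K0 : R, exists2 T : R, 0 <= T &
    forall (s : R) phi y, 0 <= s -> stateX_int r phi ->
      is_solution (shift_system N s) r phi y -> (forall i, phi i 0 <= K0) ->
      forall i (t : R), T <= t -> y i t <= K.
Proof.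
move=> aN Gd g0 gE W0 eta0 GW.
pose B := m%:R * (C / c0).
have B0 : 0 <= B by rewrite mulr_ge0// divr_ge0// ltW// ?(adm_C aN)// (adm_c0 aN).
pose q := expR (- eta).
have q0 : 0 < q := expR_gt0 _.
have q1 : q < 1 by rewrite /q -expR0 ltr_expR; lra.
pose P := B * W / (1 - q).
have P0 : 0 <= P.
  by apply: divr_ge0; [apply: mulr_ge0 => //; exact: ltW|rewrite subr_ge0; exact: ltW].
have PE : q * P + B * W = P by rewrite /P; field; lra.
have Gmono (s t : R) : 0 <= s <= t -> G s <= G t.
  move=> /andP[s0 st]; apply: (derive_ge0_le (df := g) st) => x /andP[sx _].
    by apply: Gd; lra.
  by apply: g0; lra.
exists (P + 1); first by lra.
(* [K1] bounds the sum over the first window. After [n] windows the excess is at most 1, because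
   e^(n eta) >= 1 + n eta >= K1. *)
move=> K0; pose K1 := m%:R * `|K0| + B * W.
have K10 : 0 <= K1 by rewrite addr_ge0// mulr_ge0// ltW.
pose n := (Num.truncn (K1 / eta)).+1.
have nK : q ^+ n * K1 <= 1.
  rewrite /q -expRM_natl mulrN expRN mulrC ler_pdivrMr ?expR_gt0// mul1r.
  apply: le_trans (expR_ge1Dx _).
  have /andP[_] : (Num.truncn (K1 / eta))%:R <= K1 / eta < n%:R.
    by apply: truncn_itv; rewrite divr_ge0// ltW.
  by rewrite ltr_pdivrMr//; lra.
exists (n%:R * W); first by rewrite mulr_ge0// ltW.
move=> s phi y s0 pI ys phiK i t nt.
have aNs := shift_admissible s aN.
pose S (t : R) := \sum_(i < m) y i t.
have key (a b : R) : 0 <= a <= b -> S b <= expR (G (s + a) - G (s + b)) * S a + B * (b - a).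
  move=> abI.
  apply: (@total_decay (shift_system N s) C c0 phi y (fun t => g (s + t))
    (fun t => G (s + t)) a b) => //.
  - move=> x x0; have h := is_derive_translate s x.
    by apply: is_derive_eq (is_derive1_comp (Gd (s + x) _) h) _; [lra|rewrite mulr1].
  - by move=> x x0; apply: g0; lra.
  - by move=> x j _; exact: gE.
have y0 := solution_gt0 r_gt0 aNs pI ys.
have yp j (x : R) : 0 <= x -> 0 <= y j x by move=> x0; apply/ltW/y0; have := r_gt0 j; lra.
have S0 (x : R) : 0 <= x -> 0 <= S x by move=> x0; apply: sumr_ge0 => j _; exact: yp.
have S1 (a b : R) : 0 <= a <= b -> S b <= S a + B * (b - a).
  move=> /[dup] /andP[a0 ab] /key/le_trans; apply; rewrite lerD2r ler_piMl ?S0//.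
  rewrite -expR0 ler_expR subr_le0; apply: Gmono; apply/andP; split; lra.
have S2 (a : R) : W <= a -> S a <= q * S (a - W) + B * W.
  move=> Wa; have := key (a - W) a _; rewrite subKr => /(_ _).
  have abI : 0 <= a - W <= a by apply/andP; split; lra.
  move=> /(_ abI)/le_trans; apply; rewrite lerD2r ler_wpM2r ?S0//; first lra.
  rewrite /q ler_expR; have := GW (s + (a - W)).
  have -> : s + (a - W) + W = s + a by ring.
  by move=> H; have := H _; lra.
have S00 : S 0 <= m%:R * `|K0|.
  apply: (@le_trans _ _ (\sum_(j < m) `|K0|)); last by rewrite sumr_const card_ord mulr_natl.
  apply: ler_sum => j _; rewrite (solution_history ys); last by rewrite lexx oppr_le0 ltW.
  exact: le_trans (phiK j) (ler_norm _).
have base k : forall x, 0 <= x <= k.+1%:R * W -> S x <= P + K1.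
  elim: k => [|k IH] x /andP[x0 xk].
    rewrite mul1r in xk.
    have : S x <= S 0 + B * (x - 0) by apply: S1; rewrite lexx.
    have : B * (x - 0) <= B * W by rewrite ler_wpM2l// subr0.
    by rewrite /K1; lra.
  have [xW|Wx] := leP x W.
    apply: IH; rewrite x0 (le_trans xW)//.
    by apply: ler_peMl; [exact: ltW|rewrite ler1n].
  apply: le_trans (S2 x (ltW Wx)) _.
  have : S (x - W) <= P + K1.
    by apply: IH; rewrite -natr1 mulrDl mul1r in xk; apply/andP; split; lra.
  rewrite -(ler_pM2l q0) => h.
  have : q * K1 <= K1 by rewrite ler_piMl// ltW.
  by move: h; rewrite mulrDr; lra.
have base' x : 0 <= x -> S x <= P + K1.
  move=> x0; apply: (base (Num.truncn (x / W))); rewrite x0/=.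
  have /andP[_ h] : (Num.truncn (x / W))%:R <= x / W < (Num.truncn (x / W)).+1%:R.
    by apply: truncn_itv; rewrite divr_ge0// ltW.
  by rewrite ltr_pdivrMr// in h; exact: ltW.
have iter k : forall x, k%:R * W <= x -> S x <= P + q ^+ k * K1.
  elim: k => [|k IH] x kx.
    by rewrite expr0 mul1r; apply: base'; rewrite mul0r in kx.
  rewrite -natr1 mulrDl mul1r in kx.
  have kW : 0 <= k%:R * W by rewrite mulr_ge0// ltW.
  have Wx : W <= x by lra.
  apply: le_trans (S2 x Wx) _.
  have : S (x - W) <= P + q ^+ k * K1 by apply: IH; lra.
  by rewrite -(ler_pM2l q0) mulrDr exprS -mulrA; lra.
have tt : 0 <= t by apply: le_trans nt; rewrite mulr_ge0// ltW.
apply: (@le_trans _ _ (S t)).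
  by rewrite /S (bigD1 i)//= lerDl sumr_ge0// => j _; exact: yp.
by have := iter n t nt; lra.
Qed.

End Dissipativity.

(** * Lower bounds by comparison with a multiple of a solution *)

Section Persistence.
Variables (R : realType) (m : nat) (r : 'I_m -> R).
Hypothesis r_gt0 : forall i, 0 < r i.
Implicit Types (N : nicholson R m) (phi : state R m) (y : 'I_m -> R -> R).

(** The solution of sigma' = k Th' sigma (1 - sigma / s1) that takes the value s1 / (1 + rho) where
    [Th] vanishes. *)
Definition logistic (s1 k rho : R) (Th : R -> R) (t : R) : R :=
  s1 / (1 + rho * expR (- k * Th t)).

Section Logistic.
Variables (s1 k rho : R) (Th : R -> R).
Hypotheses (s1_gt0 : 0 < s1) (k_ge0 : 0 <= k) (rho_ge0 : 0 <= rho).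
Local Notation sigma := (logistic s1 k rho Th).

Let w_ge0 t : 0 <= rho * expR (- k * Th t).
Proof. by rewrite mulr_ge0// expR_ge0. Qed.

Let w1_gt0 t : 0 < 1 + rho * expR (- k * Th t).
Proof. by have := w_ge0 t; lra.
Qed.

Lemma logistic_gt0 t : 0 < sigma t.
Proof. by rewrite divr_gt0. Qed.

Lemma logistic_le t : sigma t <= s1.
Proof.
rewrite /logistic ler_pdivrMr//; apply: ler_peMr; first exact: ltW.
by have := w_ge0 t; lra.
Qed.

Lemma logistic_mono t u : Th t <= Th u -> sigma t <= sigma u.
Proof.
move=> tu; rewrite /logistic ler_wpM2l ?(ltW s1_gt0)// lef_pV2 ?posrE// lerD2l.
by rewrite ler_wpM2l// ler_expR !mulNr lerN2 ler_wpM2l.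
Qed.

(** Going back from [t] to [u] multiplies sigma by at least e^(-k (Th t - Th u)). This bounds the
    loss caused by the delay, where an earlier value of sigma enters. *)
Lemma logistic_lag t u : Th u <= Th t -> (1 - k * (Th t - Th u)) * sigma t <= sigma u.
Proof.
move=> ut; have E0 : 0 <= sigma t by exact/ltW/logistic_gt0.
apply: (@le_trans _ _ (expR (- (k * (Th t - Th u))) * sigma t)).
  by rewrite ler_wpM2r// expRN_ge.
set e := expR _.
have e1 : e <= 1 by rewrite expRN_le1// mulr_ge0// subr_ge0.
have ww : rho * expR (- k * Th t) = e * (rho * expR (- k * Th u)).
  by rewrite /e mulrCA -expRD; congr (_ * expR _); ring.
rewrite /logistic ww; have := w_ge0 u; have := w1_gt0 u; have := w1_gt0 t; rewrite ww.
set w := rho * _ => h1 h2 w0.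
have e0 : 0 <= e by rewrite expR_ge0.
rewrite mulrCA ler_wpM2l ?(ltW s1_gt0)//.
rewrite ler_pdivrMr// mulrC ler_pdivlMr// mulrDr mulr1; lra.
Qed.

(** The logistic factor w / (1 + w) is at most 1. The alternative [b < 0] leaves the sign of [b] to
    be settled after [d] has been chosen. *)
Lemma logistic_derive (b t : R) : is_derive t 1 Th b ->
  exists2 d : R, is_derive t 1 sigma d & d <= k * b * sigma t \/ b < 0.
Proof.
move=> Thd; have h1 := is_deriveZ (- k) Thd.
have h2 := @is_derive1_comp R (@expR R) (- k \*: Th) t _ _ (is_derive_expR (- k * Th t)) h1.
have h3 := is_deriveZ rho h2.
have h4 := is_deriveD (is_derive_cst (1 : R) t 1) h3.
have w10 : (cst 1 + rho \*: (@expR R \o (- k \*: Th))) t != 0 by exact: lt0r_neq0 (w1_gt0 t).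
have h5 := is_deriveZ s1 (is_deriveV w10 h4).
exists (s1 * (- (1 + rho * expR (- k * Th t)) ^- 2 * (rho * (expR (- k * Th t) * (- k * b))))).
  by apply: is_derive_eq h5 _; rewrite /GRing.scale/= add0r.
have [b0|b0] := leP 0 b; last by right.
left; have := w_ge0 t; have := w1_gt0 t; rewrite /logistic.
set w := rho * _ => w1 w0.
have -> : s1 * (- (1 + w) ^- 2 * (rho * (expR (- k * Th t) * (- k * b)))) =
   k * b * (s1 / (1 + w)) * (w / (1 + w)).
  have -> : rho * (expR (- k * Th t) * (- k * b)) = w * (- k * b) by rewrite /w; ring.
  by field; exact: lt0r_neq0.
rewrite ler_piMr//; first by rewrite !mulr_ge0// ?invr_ge0 ltW.
by rewrite ler_pdivrMr// mul1r; lra.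
Qed.

End Logistic.

(** Here [s] and [sl] are the present and the delayed value of sigma, and [d] is the relative loss
    between them. Put e = e^(-c x / 2). As [sl] is at most 1/2, [ricker c (sl * x)] is at least
    [sl * x * e], whereas [s * ricker c x] is [s * x * (e * e)]. [nu] bounds e (1 - e) from below,
    and half of it pays for [d]. The bound on [s1 * Ku] is the threshold of [ricker_mono]. *)
Lemma subsolution_gap (C c0 M Ku c x s sl y K s1 d nu : R) :
  0 < c0 -> 0 < C -> 0 < M -> c0 <= c <= C -> M <= x <= Ku ->
  0 < s1 <= 2^-1 -> s1 * Ku <= expR (- C * K) / C ->
  0 <= s -> 0 <= sl <= s1 -> (1 - d) * s <= sl -> 0 <= d ->
  nu = expR (- (C * Ku / 2)) * (1 - expR (- (c0 * M / 2))) -> d <= nu / 2 ->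
  sl * x <= y -> y <= K ->
  s * M * (nu / 2) <= ricker c y - s * ricker c x.
Proof.
move=> c00 C0 M0 /andP[cc cC] /andP[Mx xK] /andP[s10 s12] s1K s0
  /andP[sl0 sl1] sls d0 nuE dnu slx yK.
have x0 : 0 < x by exact: lt_le_trans Mx.
have c_ge0 : 0 <= c by lra.
have h1 : ricker c (sl * x) <= ricker c y.
  apply: (@ricker_mono R c C K) => //; first by rewrite c_ge0.
    by rewrite mulr_ge0// ltW.
  by apply: le_trans s1K; apply: ler_pM => //; exact: ltW.
have e2 : sl * x * expR (- (c * x / 2)) <= ricker c (sl * x).
  rewrite /ricker ler_wpM2l ?mulr_ge0 ?(ltW x0)// ler_expR !mulNr lerN2.
  have -> : c * x / 2 = c * (x / 2) by ring.
  rewrite ler_wpM2l// mulrC ler_wpM2l ?(ltW x0)//; exact: le_trans s12.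
set e := expR (- (c * x / 2)) in e2.
have ee : expR (- c * x) = e * e by rewrite /e -expRD; congr expR; lra.
have cx : c0 * M / 2 <= c * x / 2 by rewrite ler_pM2r//; apply: ler_pM => //; exact: ltW.
have cx2 : c * x / 2 <= C * Ku / 2 by rewrite ler_pM2r//; apply: ler_pM => //; exact: ltW.
have e_le1 : e <= 1 by rewrite expRN_le1// divr_ge0// mulr_ge0// ltW.
have e0 : 0 < e by exact: expR_gt0.
have nue : nu <= e * (1 - e).
  rewrite nuE; apply: ler_pM; first exact: expR_ge0.
  - by rewrite subr_ge0 expRN_le1// divr_ge0// mulr_ge0// ltW.
  - by rewrite ler_expR lerN2.
  - by rewrite lerD2l lerN2 ler_expR lerN2.
have nu0 : 0 <= nu.
  by rewrite nuE mulr_ge0 ?expR_ge0// subr_ge0 expRN_le1// divr_ge0// mulr_ge0// ltW.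
have h2 : (1 - d) * s * x * e <= sl * x * e by rewrite !ler_wpM2r// ltW.
have h3 : s * x * (nu / 2) <= (1 - d) * s * x * e - s * (x * (e * e)).
  have -> : (1 - d) * s * x * e - s * (x * (e * e)) = s * x * (e * (1 - e) - d * e) by ring.
  rewrite ler_wpM2l ?mulr_ge0 ?(ltW x0)//.
  have : d * e <= d by rewrite ler_piMr.
  by move=> h; rewrite [X in _ <= X - _]/=; lra.
have h4 : s * M * (nu / 2) <= s * x * (nu / 2) by rewrite ler_wpM2r ?divr_ge0// ler_wpM2l.
by rewrite [X in _ - s * X]/ricker ee; lra.
Qed.

(* A multiple [sigma t * U t] of a solution [U] that stays between [M] and [Ku]
   is a subsolution while [sigma] grows slowly: the Ricker function is strictly
   sublinear, which leaves a gap proportional to the birth rate. *)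
Lemma persistence_comparison N C c0 phiU phi U y (M Ku K rmax s1 k rho : R) (Th b : R -> R) :
  admissible N C c0 -> stateX_int r phi -> is_solution N r phi y ->
  is_solution N r phiU U ->
  (forall i t, 0 < birth N i t) ->
  0 < M -> (forall i t, - r i <= t -> M <= U i t <= Ku) ->
  (forall i t, - r i <= t -> y i t <= K) ->
  (forall i, r i <= rmax) ->
  (forall t : R, - rmax <= t -> is_derive t 1 Th (b t)) ->
  (forall i t, - rmax <= t -> 0 <= b t <= birth N i t) -> Th 0 = 0 ->
  0 < s1 <= 2^-1 -> s1 * Ku <= expR (- C * K) / C -> 0 < k -> 0 <= rho ->
  let nu := expR (- (C * Ku / 2)) * (1 - expR (- (c0 * M / 2))) in
  k * C * rmax <= nu / 2 -> k * Ku < M * (nu / 2) ->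
  (forall i s, - r i <= s <= 0 -> s1 / (1 + rho) * Ku < phi i s) ->
  forall i (t : R), 0 <= t -> logistic s1 k rho Th t * U i t <= y i t.
Proof.
move=> aN pI ys us beta0 M0 UM yK rm Thd bb Th0 /andP[s10 s12] s1K k0 rho0 nu kr kK phis i t t0.
have C0 := adm_C aN; have c00 := adm_c0 aN.
have s1I : 0 < s1 <= 2^-1 by rewrite s10.
pose sg := logistic s1 k rho Th.
have sg0 u : 0 < sg u by exact: logistic_gt0.
have sg1 u : sg u <= s1 by exact/logistic_le/rho0.
have sg00 : sg 0 = s1 / (1 + rho) by rewrite /sg /logistic Th0 mulr0 expR0 mulr1.
have rm0 : - rmax < 0 by have := rm i; have := r_gt0 i; lra.
have Thmono (u v : R) : - rmax <= u -> u <= v -> Th u <= Th v.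
  move=> ru uv; apply: (derive_ge0_le (df := b) uv) => x /andP[ux _].
    by apply: Thd; lra.
  by have /andP[] : 0 <= b x <= birth N i x by apply: bb; lra.
have Thlip (u v : R) : - rmax <= u -> u <= v -> Th v - Th u <= C * (v - u).
  move=> ru uv.
  have D x : u <= x <= v -> is_derive x 1 (fun x => C * x - Th x) (C - b x).
    move=> /andP[ux _]; have h1 : is_derive x 1 Th (b x) by apply: Thd; lra.
    have h2 := is_deriveZ C (is_derive_id x (1 : R)).
    by apply: is_derive_eq (is_deriveB h2 h1) _; rewrite /GRing.scale/= mulr1.
  have : C * u - Th u <= C * v - Th v.
    apply: (derive_ge0_le uv D) => x /andP[ux _].
    have /andP[_ h] : 0 <= b x <= birth N i x by apply: bb; lra.
    by have /andP[_] := birth_bnd aN i x; lra.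
  by lra.
have /choice[dsg Hdsg] : forall u, exists d : R, - rmax <= u ->
    is_derive u 1 sg d /\ d <= k * b u * sg u.
  move=> u; have [ru|ru] := leP (- rmax) u; last by exists 0.
  have [d d1 d2] := logistic_derive s10 (ltW k0) rho0 (Thd u ru).
  exists d => _; split => //; case: d2 => // b0.
  by have /andP[] := bb i u ru; lra.
have sgd (u : R) : 0 <= u -> is_derive u 1 sg (dsg u) by move=> u0; apply: (Hdsg u _).1; lra.
have hist j s : - r j <= s <= 0 -> sg s * U j s < y j s.
  move=> js; rewrite (solution_history ys)//; apply: le_lt_trans (phis j s js).
  have /andP[rs s0] := js; have /andP[h1 h2] := UM j s rs.
  rewrite -sg00; apply: ler_pM => //; [exact: ltW|lra|].
  by apply: logistic_mono => //; [exact: ltW|apply: Thmono => //; have := rm j; lra].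
suff H : 0 < y i t - sg t * U i t by rewrite -subr_ge0 ltW.
apply: (@barrier R 'I_m (fun i t => y i t - sg t * U i t)
  (fun i t => nicholson_rhs N r y i t - (sg t * nicholson_rhs N r U i t + U i t * dsg t)) t
   _ _ _ _ i t); last by rewrite t0 lexx.
- move=> j x; apply: cvgB; first exact: (solution_cont r_gt0 ys).
  apply: cvgM; last exact: (solution_cont r_gt0 us).
  have sgc : {within `[0, +oo[, continuous sg}.
    apply: derivable_within_continuous => u; rewrite in_itv/= andbT => /sgd.
    by case.
  exact: sgc.
- by move=> j; rewrite subr_gt0; apply: hist; rewrite lexx oppr_le0 ltW.
- move=> j s /andP[s0 _].
  have h1 := solution_derive ys j s0; have h2 := solution_derive us j s0.
  have h3 := is_deriveM (sgd s (ltW s0)) h2.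
  by apply: is_derive_eq (is_deriveB h1 h3) _; rewrite /GRing.scale/=; ring.
move=> j s /andP[s0 _] pos /eqP; rewrite subr_eq0 => /eqP Ej.
have rj := r_gt0 j; have rmj := rm j.
have ylag : sg (s - r j) * U j (s - r j) <= y j (s - r j).
  have [sr0|sr0] := leP 0 (s - r j); last by apply/ltW/hist; apply/andP; split; lra.
  by rewrite -subr_ge0; apply: pos; apply/andP; split; lra.
have UL : M <= U j (s - r j) <= Ku by apply: UM; lra.
(* The relative loss of sigma over one delay is at most [k * C * rmax], since [Th] grows no faster
   than the birth rates. *)
have d0 : 0 <= k * (Th s - Th (s - r j)).
  by apply: mulr_ge0; [exact: ltW|rewrite subr_ge0; apply: Thmono; lra].
have d1 : k * (Th s - Th (s - r j)) <= nu / 2.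
  apply: le_trans kr; rewrite -mulrA; apply: ler_wpM2l; first exact: ltW.
  have h : Th s - Th (s - r j) <= C * (s - (s - r j)) by apply: Thlip; lra.
  apply: le_trans h _; rewrite subKr; apply: ler_wpM2l => //; exact: ltW.
have lag : (1 - k * (Th s - Th (s - r j))) * sg s <= sg (s - r j).
  by apply: logistic_lag => //; [exact: ltW|apply: Thmono; lra].
have sgl : 0 <= sg (s - r j) <= s1 by rewrite sg1 ltW.
have yKj : y j (s - r j) <= K by apply: yK; lra.
have gap := @subsolution_gap C c0 M Ku (crowding N j s) (U j (s - r j)) (sg s) (sg (s - r j))
  (y j (s - r j)) K s1 _ nu c00 C0 M0 (crowding_bnd aN j s) UL s1I s1K (ltW (sg0 s)) sgl lag d0
  (erefl _) d1 ylag yKj.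
have dsgs : dsg s <= k * b s * sg s by apply: (Hdsg s _).2; lra.
have /andP[b0 bbeta] : 0 <= b s <= birth N j s by apply: bb; lra.
have /andP[UM1 UM2] : M <= U j s <= Ku by apply: UM; lra.
have beta := beta0 j s.
(* Gain and cost share the factor [birth N j s * sg s]: the gap yields [M * (nu / 2)], the growth of
   sigma costs at most [k * Ku]. *)
have h1 : birth N j s * (sg s * M * (nu / 2)) <= birth N j s *
   (ricker (crowding N j s) (y j (s - r j)) - sg s * ricker (crowding N j s) (U j (s - r j))).
  by apply: ler_wpM2l => //; exact: ltW.
have h2 : U j s * dsg s <= birth N j s * sg s * (k * Ku).
  apply: (@le_trans _ _ (U j s * (k * b s * sg s))).
    by apply: ler_wpM2l => //; lra.
  have -> : U j s * (k * b s * sg s) = (b s * sg s * k) * U j s by ring.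
  have -> : birth N j s * sg s * (k * Ku) = (birth N j s * sg s * k) * Ku by ring.
  apply: ler_pM => //; [|lra|].
    by apply: mulr_ge0; [apply: mulr_ge0 => //; exact: ltW|exact: ltW].
  by apply: ler_wpM2r; [exact: ltW|apply: ler_wpM2r => //; exact: ltW].
have h3 : birth N j s * sg s * (k * Ku) < birth N j s * (sg s * M * (nu / 2)).
  have -> : birth N j s * (sg s * M * (nu / 2)) = birth N j s * sg s * (M * (nu / 2)) by ring.
  by rewrite ltr_pM2l// mulr_gt0.
have h4 : 0 <= \sum_(l < m) migration N j l s * y l s
    - sg s * \sum_(l < m) migration N j l s * U l s.
  rewrite mulr_sumr -sumrB; apply: sumr_ge0 => l _.
  have -> : migration N j l s * y l s - sg s * (migration N j l s * U l s) =
    migration N j l s * (y l s - sg s * U l s) by ring.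
  apply: mulr_ge0; first by have /andP[] := migration_bnd aN j l s.
  by apply: pos; rewrite lexx ltW.
rewrite !rhsE Ej; move: h1; rewrite mulrBr; move: h4.
set A := \sum_(l < m) _; set A' := \sum_(l < m) _ => h4 h1.
(* The decay terms cancel because [y] equals [sg * U] at the contact. *)
have -> : - decay N j s * (sg s * U j s) + A + birth N j s * ricker (crowding N j s) (y j (s - r j))
  - (sg s * (- decay N j s * U j s + A' + birth N j s * ricker (crowding N j s) (U j (s - r j)))
     + U j s * dsg s)
  = (A - sg s * A') + (birth N j s * ricker (crowding N j s) (y j (s - r j)) -
   birth N j s * (sg s * ricker (crowding N j s) (U j (s - r j)))) - U j s * dsg s by ring.
lra.
Qed.

End Persistence.

(** * Minimum of a finite family of functions *)

Section MinFun.
Variables (R : realType) (I : finType).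
Implicit Types f : I -> R -> R.

(** The fold caps the minimum at 1; it stays positive and below each member, which is what the
    estimates need. *)
Definition min_family f t : R := \big[Order.min/1]_i f i t.

Lemma min_family_le f i t : min_family f t <= f i t.
Proof. exact: bigmin_le. Qed.

Lemma min_family_gt0 f t : (forall i, 0 < f i t) -> 0 < min_family f t.
Proof. by move=> f0; apply/bigmin_gtP. Qed.

Lemma min_family_dist f (t u e : R) : 0 <= e ->
  (forall i, `|f i t - f i u| <= e) -> `|min_family f t - min_family f u| <= e.
Proof.
move=> e0 H; rewrite /min_family.
elim/big_ind2: _ => [|x x' y y'|i _]; [by rewrite subrr normr0| |exact: H].
rewrite !ler_norml => /andP[? ?] /andP[? ?]; rewrite !minEle.
by case: (leP x y) => ?; case: (leP x' y') => ?; apply/andP; split; lra.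
Qed.

Lemma min_family_continuous f : (forall i, continuous (f i)) -> continuous (min_family f).
Proof.
move=> fc t; apply/cvgrPdist_le => e e0.
have : \forall u \near t, forall i, `|f i t - f i u| <= e.
  apply: (@filter_forall R I (fun i u => `|f i t - f i u| <= e) (nbhs t)) => i.
  by have /cvgrPdist_le/(_ _ e0) := fc i t.
by move=> H; apply: filterS H => u; apply: min_family_dist; exact: ltW.
Qed.

End MinFun.

(** [f] exceeds 3/4 of [f 0] on [0, d]. Every window of length [L] contains an almost period [s]
    that repeats this bump on [s, s + d] up to [f 0 / 4]; elsewhere nonnegativity is enough. *)
Lemma positive_window (R : realType) (f : R -> R) :
  continuous f -> 0 < f 0 ->
  (forall e, 0 < e -> exists2 L : R, 0 < L & forall x, exists s, x <= s <= x + L /\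
    forall t, `|f (s + t) - f t| <= e) ->
  exists W eta : R, [/\ 0 < W, 0 < eta & forall G : R -> R,
    (forall t : R, 0 <= t -> is_derive t 1 G (f t)) -> (forall t : R, 0 <= t -> 0 <= f t) ->
    forall t, 0 <= t -> G t + eta <= G (t + W)].
Proof.
move=> fc f0 fap; have e0 : 0 < f 0 / 4 by rewrite divr_gt0.
have [L L0 HL] := fap _ e0.
have /cvgrPdist_lt/(_ _ e0)/nbhs_ballP[d' /= d'0 Hd'] := fc 0.
pose d := d' / 2; have d0 : 0 < d by rewrite divr_gt0.
have fd t : 0 <= t <= d -> 3 / 4 * f 0 <= f t.
  move=> /andP[t0 td]; have : ball 0 d' t.
    by rewrite /ball/= sub0r normrN ger0_norm// (le_lt_trans td)// ltr_pdivrMr//; lra.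
  by move=> /Hd'; rewrite ltr_norml => /andP[_ h]; lra.
exists (L + d), (d * (f 0 / 2)); split; [lra|by rewrite mulr_gt0// divr_gt0|].
move=> G Gd fge0 t t0.
have [s [/andP[ts sL] Hs]] := HL t.
have mono x y : 0 <= x <= y -> G x <= G y.
  move=> /andP[x0 xy]; apply: (derive_ge0_le (df := f) xy) => z /andP[xz _].
    by apply: Gd; lra.
  by apply: fge0; lra.
have h1 : G t <= G s by apply: mono; rewrite t0.
have h2 : G (s + d) <= G (t + (L + d)) by apply: mono; apply/andP; split; lra.
have D x : s <= x <= s + d -> is_derive x 1 (fun u => G u - u * (f 0 / 2)) (f x - f 0 / 2).
  move=> /andP[sx xd]; have h3 : is_derive x 1 G (f x) by apply: Gd; lra.
  have h4 := is_deriveZ (f 0 / 2) (is_derive_id x (1 : R)).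
  have -> : (fun u => G u - u * (f 0 / 2)) = (fun u => G u - f 0 / 2 * u).
    by apply/funext => u; rewrite mulrC.
  by apply: is_derive_eq (is_deriveB h3 h4) _; rewrite /GRing.scale/= mulr1.
have sd : s <= s + d by lra.
have : G s - s * (f 0 / 2) <= G (s + d) - (s + d) * (f 0 / 2).
  apply: (derive_ge0_le sd D) => x /andP[sx xd].
  have h5 := Hs (x - s); have e5 : s + (x - s) = x by ring.
  rewrite e5 in h5; have h6 : 3 / 4 * f 0 <= f (x - s) by apply: fd; apply/andP; split; lra.
  by move: h5; rewrite ler_norml => /andP[h5 _]; lra.
lra.
Qed.

(* The coordinates of the coefficient vector [l(t)] in R^N. *)
Definition coef_index (m : nat) : finType := ('I_m + ('I_m * 'I_m) + ('I_m + 'I_m))%type.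

Definition coef (R : realType) (m : nat) (N : nicholson R m) (k : coef_index m) : R -> R :=
  match k with
  | inl (inl i) => decay N i
  | inl (inr p) => migration N p.1 p.2
  | inr (inl i) => birth N i
  | inr (inr i) => crowding N i
  end.

Lemma coefs_closeP (R : realType) (m : nat) (N1 N2 : nicholson R m) (e t : R) :
  coefs_close N1 N2 e t <-> forall k, `|coef N1 k t - coef N2 k t| <= e.
Proof.
split; first by move=> [h1 h2 h3 h4] [[i|[i j]]|[i|i]] /=.
move=> H; split => [i|i j|i|i].
- exact: (H (inl (inl i))).
- exact: (H (inl (inr (i, j)))).
- exact: (H (inr (inl i))).
- exact: (H (inr (inr i))).
Qed.

(** * Bounds uniform over late translates *)

Section UniformBounds.
Variables (R : realType) (m : nat) (r : 'I_m -> R).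
Hypothesis r_gt0 : forall i, 0 < r i.
Implicit Types (N : nicholson R m) (phi : state R m) (y : 'I_m -> R -> R).

Definition almost_periodic_system N :=
  [/\ forall i, almost_periodic (decay N i),
      forall i j, almost_periodic (migration N i j),
      forall i, almost_periodic (birth N i) &
      forall i, almost_periodic (crowding N i)].

Let coef_ap N : almost_periodic_system N -> forall k, almost_periodic (coef N k).
Proof. by move=> [a1 a2 a3 a4] [[i|[i j]]|[i|i]] /=. Qed.

Lemma joint_almost_period_system N (e : R) : almost_periodic_system N -> 0 < e ->
  exists2 L : R, 0 < L & forall x, exists s, x <= s <= x + L /\
    forall t, coefs_close (shift_system N s) N e t.
Proof.
move=> aN e0; have [L L0 HL] := joint_almost_period (coef_ap aN) e0.
exists L => // x; have [s [xs Hs]] := HL x; exists s; split => // t.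
by apply/coefs_closeP => k; have := Hs k t; rewrite (addrC t s) => /ltW; case: k => [[]|[]].
Qed.

Lemma system_equicontinuous N (e : R) : almost_periodic_system N -> 0 < e ->
  exists2 d : R, 0 < d & forall s t, `|s - t| < d -> coefs_close (shift_system N (s - t)) N e t.
Proof.
move=> aN e0.
have /choice[d Hd] : forall k, exists d : R, 0 < d /\ forall s t, `|s - t| < d ->
    `|coef N k s - coef N k t| < e.
  by move=> k; have [d d0 Hd] := almost_periodic_uniform_continuous (coef_ap aN k) e0; exists d.
have [mu mu0 Hmu] := finite_positive_lower (fun k => (Hd k).1).
exists mu => // s t st; apply/coefs_closeP => k.
have : `|coef N k s - coef N k t| <= e.
  by apply/ltW; apply: (Hd k).2; exact: lt_le_trans st (Hmu k).
by case: k => [[i|p]|[i|i]] /=; rewrite subrK.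
Qed.

Lemma almost_periodic_admissible N (c0 : R) : almost_periodic_system N ->
  (exists2 d0 : R, 0 < d0 & forall t i, d0 <= decay N i t) ->
  (forall i j t, 0 <= migration N i j t) -> (forall t i, 0 < birth N i t) ->
  0 < c0 -> (forall t i, c0 <= crowding N i t) ->
  (forall t i, 0 < decay N i t - \sum_(j < m) migration N j i t) ->
  exists C : R, admissible N C c0.
Proof.
move=> aN [d0 d00 a2] a3 a4 c00 a5 a6.
have /choice[b Hb] : forall k, exists b : R, forall t, `|coef N k t| <= b.
  by move=> k; exact: almost_periodic_bounded (coef_ap aN k).
pose C := 1 + \sum_k `|b k|.
have S0 : 0 <= \sum_k `|b k| by rewrite sumr_ge0.
have H k t : coef N k t <= C.
  apply: le_trans (ler_norm _) _; apply: le_trans (Hb k t) _; apply: le_trans (ler_norm _) _.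
  rewrite /C (bigD1 k)//=.
  have : 0 <= \sum_(i | i != k) `|b i| by rewrite sumr_ge0.
  lra.
have [b1 b2 b3 b4] := aN.
exists C; split.
- by rewrite /C; lra.
- exact: c00.
- by move=> i; exact: (b1 i).1.
- by move=> i j; exact: (b2 i j).1.
- by move=> i; exact: (b3 i).1.
- by move=> i; exact: (b4 i).1.
- by move=> i t; rewrite (H (inl (inl i))) (le_trans (ltW d00))//.
- by move=> i j t; rewrite (H (inl (inr (i, j)))) a3.
- by move=> i t; rewrite (H (inr (inl i))) ltW.
- by move=> i t; rewrite (H (inr (inr i))) a5.
- by move=> i t; have := a6 t i; rewrite subr_gt0; exact: ltW.
Qed.

Lemma shift_system0 N : shift_system N 0 = N.
Proof.
by case: N => d a b c; congr Nicholson; apply/funext => i; apply/funext => t;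
  do ?[apply/funext => ?]; rewrite /= add0r.
Qed.

Lemma shift_systemD N s t : shift_system (shift_system N s) t = shift_system N (s + t).
Proof.
by congr Nicholson; apply/funext => i; apply/funext => u;
  do ?[apply/funext => ?]; rewrite /= addrA.
Qed.

(* Persistence enters only through the solution [u] starting at the constant 1,
   which bounds from below all solutions of the forward translates of [N]. *)
Lemma uniform_bounds N (C c0 : R) : almost_periodic_system N -> admissible N C c0 ->
  (forall i t, 0 < birth N i t) ->
  (forall t i, 0 < decay N i t - \sum_(j < m) migration N j i t) ->
  uniformly_persistent N r ->
  exists M K s1 : R, [/\ 0 < M, 0 < K & forall mu K0 : R, 0 < mu -> exists2 T : R, 0 <= T &
    forall s phi, s1 <= s -> stateX_int r phi ->
      (forall i u, - r i <= u <= 0 -> mu <= phi i u <= K0) ->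
      forall i t, T <= t -> M <= solution (shift_system N s) r phi i t <= K].
Proof.
move=> apN aN beta0 a6 [M M0 HM].
have C0 := adm_C aN; have c00 := adm_c0 aN.
pose rmax := \sum_i r i.
have rm i : r i <= rmax.
  by rewrite /rmax (bigD1 i)//= lerDl sumr_ge0// => j _; exact: ltW.
have rm0 : 0 <= rmax by rewrite sumr_ge0// => j _; exact: ltW.
pose fg i t := decay N i t - \sum_(j < m) migration N j i t.
have fgc i : continuous (fg i).
  move=> t; apply: cvgB; first exact: (decay_cont aN).
  by apply: sum_continuous => j; exact: (migration_cont aN).
pose g := min_family fg.
have gc : continuous g := min_family_continuous fgc.
have g0 t : 0 < g t by apply: min_family_gt0 => i; exact: a6.
have gap e : 0 < e -> exists2 L : R, 0 < L & forall x, exists s, x <= s <= x + L /\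
    forall t, `|g (s + t) - g t| <= e.
  (* A column gap involves [1 + m] coefficients. *)
  move=> e0; have e'0 : 0 < e / (1 + m%:R) by rewrite divr_gt0// ltr_pwDl.
  have [L L0 HL] := joint_almost_period_system apN e'0; exists L => // x.
  have [s [xs Hs]] := HL x; exists s; split => // t; apply: min_family_dist; first exact: ltW.
  move=> i; have [h1 h2 _ _] := Hs t; have := h1 i => /= h1i.
  have -> : fg i (s + t) - fg i t = (decay N i (s + t) - decay N i t) -
      \sum_(j < m) (migration N j i (s + t) - migration N j i t).
    by rewrite sumrB /fg; ring.
  apply: le_trans (ler_normB _ _) _.
  have h3 : `|\sum_(j < m) (migration N j i (s + t) - migration N j i t)|
      <= m%:R * (e / (1 + m%:R)).
    apply: le_trans (ler_norm_sum _ _ _) _.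
    apply: (@le_trans _ _ (\sum_(j < m) e / (1 + m%:R))); last first.
      by rewrite sumr_const card_ord mulr_natl.
    by apply: ler_sum => j _; exact: h2.
  have -> : e = e / (1 + m%:R) + m%:R * (e / (1 + m%:R)).
    by field; rewrite gt_eqF// ltr_pwDl.
  exact: lerD.
have [Wg [etag [Wg0 etag0 HG]]] := positive_window gc (g0 0) gap.
have [G Gd] := @primitive_exists R g (-1) gc.
have Gd' (t : R) : 0 <= t -> is_derive t 1 G (g t) by move=> t0; apply: Gd; lra.
have [K K0 HK] := uniform_dissipativity r_gt0 aN Gd' (fun t _ => ltW (g0 t))
  (fun t i => min_family_le fg i t) Wg0 etag0 (HG G Gd' (fun t _ => ltW (g0 t))).
pose b := min_family (birth N).
have bc : continuous b := min_family_continuous (birth_cont aN).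
have b0 t : 0 < b t by apply: min_family_gt0 => i; exact: beta0.
have bap e : 0 < e -> exists2 L : R, 0 < L & forall x, exists s, x <= s <= x + L /\
    forall t, `|b (s + t) - b t| <= e.
  move=> e0; have [L L0 HL] := joint_almost_period_system apN e0; exists L => // x.
  have [s [xs Hs]] := HL x; exists s; split => // t; apply: min_family_dist; first exact: ltW.
  by move=> i; have [_ _ h _] := Hs t; exact: h.
have [W [eta [W0 eta0 HTh]]] := positive_window bc (b0 0) bap.
have [Th Thd] := @primitive_exists R b (-1) bc.
have Thd' (t : R) : 0 <= t -> is_derive t 1 Th (b t) by move=> t0; apply: Thd; lra.
have ThW := HTh Th Thd' (fun t _ => ltW (b0 t)).
have Thmono (u v : R) : 0 <= u <= v -> Th u <= Th v.
  move=> /andP[u0 uv]; apply: (derive_ge0_le (df := b) uv) => x /andP[ux _].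
    by apply: Thd'; lra.
  exact/ltW/b0.
pose one : state R m := segment r (fun _ _ => 1) 0.
have oneI : stateX_int r one.
  apply: segment_int => //.
  by move=> i; apply: continuous_subspaceT => t; exact: cvg_cst.
have oneE i s : - r i <= s <= 0 -> one i s = 1.
  by move=> rs; rewrite /one /segment patchE mem_set//= in_itv.
have ri0 i : - r i <= 0 <= 0 by rewrite lexx oppr_le0 ltW.
have [t0 Ht0] : exists t0 : R, forall t, t0 <= t -> forall i, M <= solution N r one i t.
  apply: HM; last by move=> i; rewrite oneE.
  by split; [exact: oneI.1|move=> i s rs; apply/ltW; exact: oneI.2].
set u := solution N r one in Ht0.
have us : is_solution N r one u := solutionP r_gt0 aN oneI.
have [T0 T00 HT0] := HK 1.
have uK i t : T0 <= t -> u i t <= K.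
  apply: (HT0 0 one u (lexx 0) oneI); first by rewrite shift_system0.
  by move=> j; rewrite oneE.
(* From [t1] on, [u] lies between [M] and [K] even one delay earlier. *)
pose t1 := `|t0| + T0 + rmax.
have t10 : 0 <= t1 by rewrite /t1; have := normr_ge0 t0; lra.
have uMK s i t : t1 <= s -> - r i <= t -> M <= u i (s + t) <= K.
  move=> s1 rt; have := rm i; have := ler_norm t0; have := normr_ge0 t0 => h1 h2 h3.
  by apply/andP; split; [apply: Ht0|apply: uK]; rewrite /t1 in s1;
    clear -h1 h2 h3 s1 rt T00 rm0; lra.
(* The ceiling of sigma: at most 1/2 for the sublinearity gap, and small enough for [s1 * K] to
   respect the threshold of [ricker_mono]. *)
pose s1 := Num.min 2^-1 (expR (- C * K) / C / K).
have s10 : 0 < s1 by rewrite lt_min invr_gt0 ltr0n/= !divr_gt0 ?expR_gt0.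
have s1I : 0 < s1 <= 2^-1 by rewrite s10 ge_min lexx.
have s1K : s1 * K <= expR (- C * K) / C.
  by rewrite -ler_pdivlMr// ge_min lexx orbT.
pose nu := expR (- (C * K / 2)) * (1 - expR (- (c0 * M / 2))).
have nu0 : 0 < nu.
  by rewrite mulr_gt0 ?expR_gt0// subr_gt0 -expR0 ltr_expR oppr_lt0 divr_gt0// mulr_gt0.
(* The first bound limits the loss over a delay, the second makes growth cheaper than the gain;
   [rmax + 1] keeps the denominator positive and the factor 2 yields a strict inequality. *)
pose k := Num.min (nu / 2 / (C * (rmax + 1))) (M * (nu / 2) / (2 * K)).
have k0 : 0 < k.
  rewrite lt_min; apply/andP; split; apply: divr_gt0.
  - by rewrite divr_gt0.
  - by apply: mulr_gt0 => //; lra.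
  - by apply: mulr_gt0 => //; rewrite divr_gt0.
  - by apply: mulr_gt0.
have kr : k * C * rmax <= nu / 2.
  apply: (@le_trans _ _ (k * (C * (rmax + 1)))).
    by rewrite -mulrA ler_wpM2l ?(ltW k0)// ler_wpM2l ?(ltW C0)//; lra.
  rewrite -ler_pdivlMr; last by rewrite mulr_gt0//; lra.
  by rewrite ge_min lexx.
have kK : k * K < M * (nu / 2).
  have h : k * (2 * K) <= M * (nu / 2).
    by rewrite -ler_pdivlMr ?mulr_gt0// ge_min lexx orbT.
  have h2 : 0 < k * K by rewrite mulr_gt0.
  lra.
exists (s1 / 2 * M), K, t1; split => //; first by rewrite mulr_gt0// divr_gt0.
move=> mu K1 mu0; have [Td Td0 HTd] := HK K1.
(* The comparison starts at [tau], when the solution has been below [K] for a full delay; until then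
   it stays above [mu']. *)
pose tau := Td + rmax; have tau0 : 0 <= tau by rewrite addr_ge0.
pose mu' := mu / 2 * expR (- (C + 1) * tau).
have mu'0 : 0 < mu' by rewrite mulr_gt0 ?expR_gt0// divr_gt0.
(* This makes the initial value s1 / (1 + rho) of sigma, times [K], smaller than [mu']. *)
pose rho := s1 * K / mu'.
have rho0 : 0 <= rho by rewrite divr_ge0 ?mulr_ge0// ltW.
(* After [n] windows rho e^(-k Th') is at most 1, so sigma has reached half of its ceiling [s1]. *)
pose n := (Num.truncn (rho / (k * eta))).+1.
have nrho : rho <= n%:R * (k * eta).
  rewrite -ler_pdivrMr ?mulr_gt0//; apply: ltW.
  have /andP[] // : (Num.truncn (rho / (k * eta)))%:R <= rho / (k * eta) < n%:R.
  by apply: truncn_itv; rewrite divr_ge0// ltW// mulr_gt0.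
have nW : 0 <= n%:R * W by rewrite mulr_ge0// ltW.
exists (tau + n%:R * W); first by clear -tau0 nW; lra.
move=> s phi st1 pI phib i t tT.
have aNs := shift_admissible s aN.
set y := solution (shift_system N s) r phi.
have ys : is_solution (shift_system N s) r phi y := solutionP r_gt0 aNs pI.
have s0 : 0 <= s by clear -st1 t10; lra.
have yK j v : Td <= v -> y j v <= K.
  apply: (HTd s phi y s0 pI ys) => l.
  by have /andP[] : mu <= phi l 0 <= K1 by exact: phib.
have ymu j v : 0 <= v -> mu / 2 * expR (- (C + 1) * v) < y j v.
  apply: (solution_lower_bound r_gt0 aNs ys mu0).
  by move=> l v' hv; have /andP[] := phib l v' hv.
rewrite yK ?andbT; last by rewrite /tau in tT; clear -tT rm0 nW; lra.
have aNt := shift_admissible (s + tau) aN.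
have y's := solution_shift ys tau0; rewrite shift_systemD in y's.
have st0 : 0 <= s + tau by clear -s0 tau0; lra.
have u's := solution_shift us st0.
have pI' : stateX_int r (segment r y tau).
  apply: (segment_int tau0); first by move=> j; have [] := ys j.
  by move=> j v rv; exact: (solution_gt0 r_gt0 aNs pI ys).
have segE j v : - r j <= v <= 0 -> segment r y tau j v = y j (tau + v).
  by move=> rv; rewrite /segment patchE mem_set//= in_itv.
have tt : t = tau + (t - tau) by ring.
have ttau : n%:R * W <= t - tau by clear -tT; lra.
pose Th' v := Th (s + tau + v) - Th (s + tau).
have main := @persistence_comparison R m r r_gt0 (shift_system N (s + tau)) C c0 _
  (segment r y tau) _ _ M K K rmax s1 k rho Th' (fun v => b (s + tau + v))
  aNt pI' y's u's _ M0 _ _ rm _ _ _ s1I s1K k0 rho0 kr kK _ i (t - tau) _.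
have {main} : logistic s1 k rho Th' (t - tau) * u i (s + tau + (t - tau)) <= y i t.
  rewrite [in X in _ <= X]tt; apply: main.
  - by move=> j v; exact: beta0.
  - by move=> j v rv; apply: uMK => //; clear -st1 tau0; lra.
  - by move=> j v rv; apply: yK; have := rm j; rewrite /tau; clear -rv; lra.
  - move=> v rv; have h1 := is_derive_translate (s + tau) v.
    have h2 : is_derive (s + tau + v) 1 Th (b (s + tau + v)) by apply: Thd'; rewrite /tau; clear -rv s0 Td0; lra.
    have h3 := is_deriveB (is_derive1_comp h2 h1) (is_derive_cst (Th (s + tau)) v 1).
    by apply: is_derive_eq h3 _; rewrite mulr1 subr0.
  - move=> j v _; rewrite (ltW (b0 _))/=; exact: min_family_le.
  - by rewrite /Th' addr0 subrr.
  - move=> j v rv; rewrite segE//.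
    have /andP[rv1 v0] := rv.
    have tv : 0 <= tau + v by have := rm j; rewrite /tau; clear -rv1 Td0; lra.
    apply: lt_trans (ymu j _ tv).
    apply: (@lt_le_trans _ _ mu'); last first.
      rewrite ler_wpM2l ?divr_ge0 ?(ltW mu0)// ler_expR !mulNr lerN2 ler_wpM2l//; clear -C0 v0; lra.
    rewrite mulrAC ltr_pdivrMr; last by clear -rho0; lra.
    have : mu' * rho = s1 * K by rewrite /rho; field; rewrite gt_eqF.
    by rewrite mulrDr mulr1; clear -mu'0; lra.
  - by clear -ttau nW; lra.
apply: le_trans.
have ui : M <= u i (s + tau + (t - tau)).
  have h1 : - r i <= t - tau by have := r_gt0 i; clear -ttau nW; lra.
  have h2 : t1 <= s + tau by clear -st1 tau0; lra.
  by have /andP[] := uMK _ i _ h2 h1.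
apply: ler_pM => //; [by rewrite divr_ge0// ltW|exact: ltW|].
have w0 : 0 < 1 + rho * expR (- k * Th' (t - tau)).
  by rewrite ltr_pwDl// mulr_ge0// expR_ge0.
rewrite /logistic; apply: ler_wpM2l; first exact: ltW.
rewrite lef_pV2 ?posrE//.
suff : rho * expR (- k * Th' (t - tau)) <= 1 by move=> h; clear -h; lra.
have ThG : n%:R * eta <= Th' (t - tau).
  have h := window_growth W0 ThW Thmono st0 ttau; rewrite /Th'; clear -h; lra.
rewrite mulNr expRN ler_pdivrMr ?expR_gt0// mul1r.
apply: le_trans nrho _; apply: le_trans (expR_ge1Dx _).
have : k * (n%:R * eta) <= k * Th' (t - tau) by rewrite ler_wpM2l// ltW.
have -> : n%:R * (k * eta) = k * (n%:R * eta) by ring.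
by move=> h; clear -h; lra.
Qed.

End UniformBounds.

(** * The hull and the state space *)

Section CompactOpenBalls.
Variables (R : realType) (V : normedModType R).
Implicit Types (w : {compact-open, R -> V}) (c e : R).

Definition segment_ball w c e : set {compact-open, R -> V} :=
  [set w' | forall t, - c <= t <= c -> ball (w t) e (w' t)].

Lemma segment_ball_nbhs w c e : continuous (w : R -> V) -> 0 < e ->
  nbhs w (segment_ball w c e).
Proof.
move=> wc e0.
have H : {compact-open, nbhs w --> w} by exact: cvg_id.
move: H => /(compact_open_fam_compactP wc)/fam_cvgP/(_ _ (@segment_compact R (- c) c)).
apply; apply/uniform_nbhs.
exists [set xy | ball xy.1 e xy.2]; split; first exact: entourage_ball (PosNum e0).
by move=> w' /= H t tc; apply: H; rewrite in_itv.
Qed.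

(** The sets [segment_ball w c e] generate a filter converging to [w] uniformly on compact sets, as
    these are bounded. At a continuous limit this is compact-open convergence, so every neighborhood
    contains one of the sets. *)
Lemma nbhs_segment_ball w (U : set {compact-open, R -> V}) :
  continuous (w : R -> V) -> nbhs w U ->
  exists c e, 0 < e /\ segment_ball w c e `<=` U.
Proof.
move=> wc wU.
pose F := filter_from [set p : R * R | 0 < p.2] (fun p => segment_ball w p.1 p.2).
have FF : Filter F.
  apply: filter_from_filter; first by exists (0, 1) => /=.
  move=> [c e] [c' e'] /= e0 e'0; exists (Num.max c c', Num.min e e') => /=.
    by rewrite lt_min e0.
  move=> w' H; split => t /= /andP[t1 t2].
    apply: (@le_ball _ _ _ (Num.min e e')); first by rewrite ge_min lexx.
    apply: H => /=; rewrite le_max t2 andbT; apply: le_trans t1.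
    by rewrite lerN2 le_max lexx.
  apply: (@le_ball _ _ _ (Num.min e e')); first by rewrite ge_min lexx orbT.
  apply: H => /=; rewrite le_max t2 orbT andbT; apply: le_trans t1.
  by rewrite lerN2 le_max lexx orbT.
have : {compact-open, F --> w}.
  apply/(compact_open_fam_compactP wc)/fam_cvgP => A cA U' /uniform_nbhs[E [entE EV]].
  have [M [_ HM]] := compact_bounded cA.
  have MM : M < M + 1 by rewrite ltrDl.
  move: entE; rewrite -entourage_ballE => -[e /= e0 He].
  exists (M + 1, e) => //= w' Hw'; apply: EV => t At; apply: (He (_, _)) => /=.
  by apply: Hw'; rewrite -ler_norml; exact: (HM _ MM).
by move=> /(_ U wU)[[c e] /= e0 H]; exists c, e.
Qed.

(** Singletons are compact, so two maps are separated by open conditions on their values at one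
    point. *)
Lemma compact_open_hausdorff : hausdorff_space {compact-open, R -> V}.
Proof.
move=> p q pq; apply/funext => t; apply: contrapT => /eqP pqt.
have := @norm_hausdorff _ V; rewrite open_hausdorff => /(_ _ _ pqt).
move=> [[A B] /= [pA qB] [oA oB AB]].
have nb (f : {compact-open, R -> V}) O : open O -> O (f t) ->
    nbhs f [set g | g @` [set t] `<=` O].
  move=> oO Of; apply: open_nbhs_nbhs; split.
    by apply: compact_open_open => //; exact: compact_set1.
  by move=> _ [_ -> <-].
have [f [fA fB]] := pq _ _ (nb p A oA (set_mem pA)) (nb q B oB (set_mem qB)).
have : (A `&` B) (f t) by split; [apply: fA|apply: fB]; exists t.
by move/eqP: AB => ->.
Qed.

End CompactOpenBalls.

Section PathSpace.
Variables (R : realType) (m : nat).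
Implicit Types (w : paths R m) (c e : R).

Lemma coefs_ballP (x y : coefs R m) e : 0 < e -> ball x e y <->
  [/\ forall i, `|x.1.1.1 ord0 i - y.1.1.1 ord0 i| < e,
      forall i j, `|x.1.1.2 i j - y.1.1.2 i j| < e,
      forall i, `|x.1.2 ord0 i - y.1.2 ord0 i| < e &
      forall i, `|x.2 ord0 i - y.2 ord0 i| < e].
Proof.
move=> e0; split.
  by move=> [[[[_ h1] [_ h2]] [_ h3]] [_ h4]]; split => [i|i j|i|i];
    [exact: h1|exact: h2|exact: h3|exact: h4].
move=> [h1 h2 h3 h4]; split; first split; first split; split => //= i j; rewrite ?ord1.
- exact: h1.
- exact: h3.
- exact: h4.
Qed.

Definition path_ball w c e : set (paths R m) :=
  [set w' | forall t, - c <= t <= c -> ball (w t : coefs R m) e (w' t : coefs R m)].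

Lemma path_ball_nbhs w c e : continuous (w : R -> coefs R m) -> 0 < e ->
  nbhs w (path_ball w c e).
Proof. exact: (@segment_ball_nbhs R (coefs R m) w c e). Qed.

Lemma nbhs_path_ball w (U : set (paths R m)) : continuous (w : R -> coefs R m) -> nbhs w U ->
  exists c e, 0 < e /\ path_ball w c e `<=` U.
Proof. exact: (@nbhs_segment_ball R (coefs R m) w U). Qed.

Lemma paths_hausdorff : hausdorff_space (paths R m).
Proof. exact: (@compact_open_hausdorff R (coefs R m)). Qed.

End PathSpace.

(** The image clusters in a compact segment, and a cluster point of an ultrafilter is a limit. *)
Lemma ultrafilter_limit (R : realType) (T : Type) (F : set_system T) (f : T -> R) (C : R) :
  UltraFilter F -> F [set x | `|f x| <= C] ->
  exists l : R, forall e, 0 < e -> F [set x | `|f x - l| < e].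
Proof.
move=> FU FC; have FP : ProperFilter F := ultra_proper.
have H : (f @ F) `[- C, C]%classic.
  have FC' : F [set x | `[- C, C]%classic (f x)].
    by apply: filterS FC => x /=; rewrite in_itv/= -ler_norml.
  exact: FC'.
have [l [_ lF]] := @segment_compact R (- C) C (f @ F) _ H.
exists l => e e0; have [//|FN] := in_ultra_setVsetC [set x | `|f x - l| < e] FU.
have FN' : (f @ F) [set z | ~ `|z - l| < e] by exact: FN.
by have [z [h1 h2]] := lF _ _ FN' (nbhsx_ballx l e e0); case: h1; rewrite distrC.
Qed.

(** The core of Ascoli's theorem, used for the hull and for Lipschitz states: the limit inherits the
    modulus of continuity, so convergence at [t] controls a whole ball around [t], and finitely many
    balls cover the segment. *)
Lemma equicontinuous_limit (R : realType) (T : Type) (F : set_system T)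
    (ev : T -> R -> R) (l : R -> R) (a b : R) :
  ProperFilter F ->
  (forall t e, a <= t <= b -> 0 < e -> F [set x | `|ev x t - l t| < e]) ->
  (forall e, 0 < e -> exists2 d : R, 0 < d & F [set x | forall s t,
     a <= s <= b -> a <= t <= b -> `|s - t| < d -> `|ev x s - ev x t| <= e]) ->
  forall e, 0 < e -> F [set x | forall t, a <= t <= b -> `|ev x t - l t| <= e].
Proof.
move=> FP Fl Fe e e0; have e3 : 0 < e / 3 by rewrite divr_gt0.
have [d d0 Fd] := Fe _ e3.
have lip s t : a <= s <= b -> a <= t <= b -> `|s - t| < d -> `|l s - l t| <= e / 3.
  move=> sab tab st; apply/ler_addgt0Pl => z z0; have z2 : 0 < z / 2 by rewrite divr_gt0.
  have [x [[h1 h2] h3]] := filter_ex (filterI (filterI (Fl s _ sab z2) (Fl t _ tab z2)) Fd).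
  have h4 := h3 s t sab tab st.
  have -> : l s - l t = (ev x t - l t) - (ev x s - l s) + (ev x s - ev x t) by ring.
  apply: le_trans (ler_normD _ _) _; have := ler_normB (ev x t - l t) (ev x s - l s).
  by move: h1 h2 => /=; lra.
have := @segment_compact R a b => /compact_near_coveringP/near_covering_withinP.
move=> /(_ _ F (fun x t => `|ev x t - l t| <= e) _) H.
suff : \near F, `[a, b]%classic `<=` (fun t => `|ev F t - l t| <= e).
  by apply: filterS => x xab t tab; apply: xab; rewrite /= in_itv.
apply: H => t; rewrite /= in_itv/= => tab.
exists (ball t d, [set x | `|ev x t - l t| < e / 3] `&` [set x | forall s t,
     a <= s <= b -> a <= t <= b -> `|s - t| < d -> `|ev x s - ev x t| <= e / 3]).
  by split => /=; [exact: nbhsx_ballx|apply: filterI => //; exact: Fl].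
move=> [s x] /= [ts [h1 h2]]; rewrite in_itv/= => sab.
have h3 := h2 t s tab sab ts; have h4 := lip t s tab sab ts.
have -> : ev x s - l s = (ev x t - l t) - (ev x t - ev x s) + (l t - l s) by ring.
apply: le_trans (ler_normD _ _) _; have := ler_normB (ev x t - l t) (ev x t - ev x s).
by move: h1 => /=; lra.
Qed.

(** * The hull: approximation by translates, inherited bounds, compactness *)

Section Hull.
Variables (R : realType) (m : nat).
Implicit Types (N : nicholson R m) (w : paths R m).

Lemma hull_system_coef_path N : hull_system (coef_path N) = N.
Proof.
case: N => d a b c; rewrite /hull_system; congr Nicholson; apply/funext => i; apply/funext => t;
  do ?[apply/funext => ?];
  by rewrite /hull_decay /hull_migration /hull_birth /hull_crowding /Defs.shift /coef_path /=
    mxE addr0.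
Qed.

Lemma hull_system_shift w s : hull_system (Defs.shift w s) = shift_system (hull_system w) s.
Proof.
rewrite /hull_system; congr Nicholson; apply/funext => i; apply/funext => t;
  do ?[apply/funext => ?];
  by rewrite /hull_decay /hull_migration /hull_birth /hull_crowding /Defs.shift /= !addr0.
Qed.

Lemma coefs_close_ball w w' e t : 0 < e -> ball (w t : coefs R m) e (w' t : coefs R m) ->
  coefs_close (hull_system w) (hull_system w') e t.
Proof.
move=> e0 /(coefs_ballP _ _ e0)[h1 h2 h3 h4].
split => [i|i j|i|i]; rewrite /hull_system /= /hull_decay /hull_migration /hull_birth /hull_crowding
  /Defs.shift addr0 ltW//.
Qed.

Lemma ball_coefs_close w w' e e' t : 0 <= e < e' ->
  coefs_close (hull_system w) (hull_system w') e t ->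
  ball (w t : coefs R m) e' (w' t : coefs R m).
Proof.
move=> /andP[e0 ee] [h1 h2 h3 h4]; have e'0 : 0 < e' by exact: le_lt_trans ee.
apply/(coefs_ballP _ _ e'0); rewrite /hull_system /= /hull_decay /hull_migration /hull_birth
  /hull_crowding /Defs.shift addr0 in h1 h2 h3 h4.
by split => [i|i j|i|i]; apply: le_lt_trans ee.
Qed.

Lemma coefs_close_trans N1 N2 N3 (e e' t : R) :
  coefs_close N1 N2 e t -> coefs_close N2 N3 e' t -> coefs_close N1 N3 (e + e') t.
Proof.
move=> /coefs_closeP h1 /coefs_closeP h2; apply/coefs_closeP => k.
exact: le_trans (ler_distD (coef N2 k t) _ _) (lerD (h1 k) (h2 k)).
Qed.

Lemma coefs_close_sym N1 N2 (e t : R) : coefs_close N1 N2 e t -> coefs_close N2 N1 e t.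
Proof. by move=> /coefs_closeP H; apply/coefs_closeP => k; rewrite distrC. Qed.

(* Joint almost periods let the translate [s] be chosen arbitrarily late. *)
Lemma hull_approx N w c e s1 : almost_periodic_system N -> hull (coef_path N) w -> 0 < e ->
  exists2 s : R, s1 <= s & forall u, - c <= u <= c ->
    coefs_close (hull_system w) (shift_system N s) e u.
Proof.
move=> apN [wc wcl] e0; have e2 : 0 < e / 2 by rewrite divr_gt0.
have [_ [[s0 _ <-] Hs0]] := wcl _ (path_ball_nbhs c wc e2).
have [L L0 HL] := joint_almost_period_system apN e2.
have [s' [/andP[h1 _] Hs']] := HL (s1 - s0).
exists (s0 + s'); first lra.
move=> u uc; rewrite (splitr e).
apply: (coefs_close_trans (N2 := shift_system N s0)).
  have := coefs_close_ball e2 (Hs0 u uc).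
  by rewrite hull_system_shift hull_system_coef_path.
have /coefs_closeP H := Hs' (s0 + u); apply/coefs_closeP => k; have := H k; rewrite distrC.
by case: k => [[i|p]|[i|i]] /=; have -> : s0 + s' + u = s' + (s0 + u) by ring.
Qed.

Lemma hullP N w : continuous (w : R -> coefs R m) ->
  (forall c e, 0 < e -> exists s : R, forall u, - c <= u <= c ->
    coefs_close (hull_system w) (shift_system N s) e u) -> hull (coef_path N) w.
Proof.
move=> wc H; split => // U /(nbhs_path_ball wc)[c [e [e0 HU]]].
have e2 : 0 < e / 2 by rewrite divr_gt0.
have [s Hs] := H c _ e2; exists (Defs.shift (coef_path N) s); split; first by exists s.
apply: HU => u uc; apply: (@ball_coefs_close _ _ (e / 2)).
  by rewrite ltW//= ltr_pdivrMr//; lra.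
by rewrite hull_system_shift hull_system_coef_path; exact: Hs.
Qed.

Lemma coef_path_continuous w : (forall k, continuous (coef (hull_system w) k)) ->
  continuous (w : R -> coefs R m).
Proof.
move=> H t; apply/cvg_ballP => e e0; have e2 : 0 < e / 2 by rewrite divr_gt0.
have : \forall u \near t, forall k, `|coef (hull_system w) k t - coef (hull_system w) k u| <= e / 2.
  apply: (@filter_forall R (coef_index m)
    (fun k u => `|coef (hull_system w) k t - coef (hull_system w) k u| <= e / 2) (nbhs t)) => k.
  by have /cvgrPdist_le/(_ _ e2) := H k t.
move=> Hn; apply: filterS Hn => u Hu.
have -> : w t = Defs.shift w t 0 by rewrite /Defs.shift addr0.
have -> : w u = Defs.shift w u 0 by rewrite /Defs.shift addr0.
apply: (@ball_coefs_close _ _ (e / 2)); first by rewrite ltW//= ltr_pdivrMr//; lra.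
rewrite !hull_system_shift; apply/coefs_closeP => k; have := Hu k.
by case: k => [[i|p]|[i|i]] /=; rewrite !addr0.
Qed.

Lemma hull_coef_continuous w : continuous (w : R -> coefs R m) ->
  forall k, continuous (coef (hull_system w) k).
Proof.
move=> wc k t; apply/cvgrPdist_le => e e0.
have := wc t => /cvg_ballP/(_ _ e0); apply: filterS => u.
have -> : w t = Defs.shift w t 0 by rewrite /Defs.shift addr0.
have -> : w u = Defs.shift w u 0 by rewrite /Defs.shift addr0.
move=> /(coefs_close_ball e0)/coefs_closeP/(_ k); rewrite !hull_system_shift.
by case: k => [[i|p]|[i|i]] /=; rewrite !addr0.
Qed.

Lemma shift_path_continuous w s : continuous (w : R -> coefs R m) ->
  continuous (Defs.shift w s : R -> coefs R m).
Proof.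
move=> wc; apply: coef_path_continuous => k t.
have := @hull_coef_continuous _ wc k; rewrite hull_system_shift => H.
have -> : coef (shift_system (hull_system w) s) k = (fun u => coef (hull_system w) k (s + u)).
  by case: k {H} => [[i|p]|[i|i]].
apply: (@continuous_comp _ _ _ (fun u => s + u) (coef (hull_system w) k)); last exact: H.
by apply: cvgD; [exact: cvg_cst|exact: cvg_id].
Qed.

Lemma hull_shift N w t : almost_periodic_system N -> hull (coef_path N) w ->
  hull (coef_path N) (Defs.shift w t).
Proof.
move=> apN wH; apply: hullP; first exact/shift_path_continuous/wH.1.
move=> c e e0; have [s _ Hs] := hull_approx (c + `|t|) 0 apN wH e0.
exists (s + t) => u /andP[u1 u2].
have tu : - (c + `|t|) <= t + u <= c + `|t|.
  by have := ler_norm t; have := ler_norm (- t); rewrite normrN => h1 h2; apply/andP; split; lra.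
have /coefs_closeP H := Hs _ tu; apply/coefs_closeP => k; have := H k.
by rewrite hull_system_shift; case: k => [[i|p]|[i|i]] /=; rewrite -(addrA s t u).
Qed.

(** All coefficients of [w] at time [t] are approximated by those of [N] at one common time. This is
    what lets the column inequality, a relation between several coefficients, pass to the limit. *)
Lemma hull_admissible N C c0 w : almost_periodic_system N -> admissible N C c0 ->
  hull (coef_path N) w -> admissible (hull_system w) C c0.
Proof.
move=> apN aN wH.
have close (t e : R) : 0 < e -> exists s : R, forall k,
    `|coef (hull_system w) k t - coef N k s| <= e.
  move=> e0; have [s _ Hs] := hull_approx `|t| 0 apN wH e0.
  exists (s + t) => k; have tt : - `|t| <= t <= `|t| by rewrite -ler_norml.
  by have /coefs_closeP/(_ k) := Hs t tt; case: k => [[i|p]|[i|i]].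
have bnd k (A B t : R) : (forall s, A <= coef N k s <= B) -> A <= coef (hull_system w) k t <= B.
  move=> H; apply/andP; split; apply/ler_addgt0Pl => e e0;
    have [s /(_ k)] := close t e e0; rewrite ler_norml => /andP[? ?]; have /andP[? ?] := H s; lra.
have cont := @hull_coef_continuous _ wH.1.
split; [exact: (adm_C aN)|exact: (adm_c0 aN)|..].
- by move=> i; exact: (cont (inl (inl i))).
- by move=> i j; exact: (cont (inl (inr (i, j)))).
- by move=> i; exact: (cont (inr (inl i))).
- by move=> i; exact: (cont (inr (inr i))).
- by move=> i t; apply: (bnd (inl (inl i))) => s; exact: (decay_bnd aN).
- by move=> i j t; apply: (bnd (inl (inr (i, j)))) => s; exact: (migration_bnd aN).
- by move=> i t; apply: (bnd (inr (inl i))) => s; exact: (birth_bnd aN).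
- by move=> i t; apply: (bnd (inr (inr i))) => s; exact: (crowding_bnd aN).
move=> i t; apply/ler_addgt0Pl => e e0.
have e'0 : 0 < e / (1 + m%:R) by rewrite divr_gt0// ltr_pwDl.
have [s Hs] := close t _ e'0.
have h1 := Hs (inl (inl i)); have h2 := column_ge0 aN i s.
have h3 : \sum_(j < m) migration (hull_system w) j i t <=
    \sum_(j < m) (migration N j i s + e / (1 + m%:R)).
  by apply: ler_sum => j _; have := Hs (inl (inr (j, i))); rewrite ler_norml => /andP[] /=; lra.
rewrite big_split /= sumr_const card_ord -[_ *+ m]mulr_natl in h3.
have eE : e = e / (1 + m%:R) + m%:R * (e / (1 + m%:R)).
  by field; rewrite gt_eqF// ltr_pwDl.
rewrite [X in X + _]eE.
by move: h1; rewrite ler_norml => /andP[] /=; lra.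
Qed.

(** A modulus of uniform continuity on the whole line is shared by all translates, hence by their
    limits. *)
Lemma hull_equicontinuous N e : almost_periodic_system N -> 0 < e ->
  exists2 d : R, 0 < d & forall w, hull (coef_path N) w -> forall k s t, `|s - t| < d ->
    `|coef (hull_system w) k s - coef (hull_system w) k t| <= e.
Proof.
move=> apN e0; have e3 : 0 < e / 3 by rewrite divr_gt0.
have [d d0 Hd] := system_equicontinuous apN e3.
exists d => // w wH k s t st.
have [q _ Hq] := hull_approx (`|s| + `|t|) 0 apN wH e3.
have ns := normr_ge0 s; have nt := normr_ge0 t.
have hs : - (`|s| + `|t|) <= s <= `|s| + `|t| by rewrite -ler_norml; lra.
have ht : - (`|s| + `|t|) <= t <= `|s| + `|t| by rewrite -ler_norml; lra.
have sE u : coef (shift_system N q) k u = coef N k (q + u) by case: (k) => [[i|p]|[i|i]].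
have /coefs_closeP/(_ k) := Hq s hs; have /coefs_closeP/(_ k) := Hq t ht; rewrite !sE => h1 h2.
have qst : `|q + s - (q + t)| < d by have -> : q + s - (q + t) = s - t by ring.
have /coefs_closeP/(_ k) := Hd _ _ qst.
have -> : coef (shift_system N (q + s - (q + t))) k (q + t) = coef N k (q + s).
  by case: (k) => [[i|p]|[i|i]] /=; rewrite subrK.
move=> h3.
have -> : coef (hull_system w) k s - coef (hull_system w) k t =
  (coef (hull_system w) k s - coef N k (q + s)) - (coef (hull_system w) k t - coef N k (q + t))
  + (coef N k (q + s) - coef N k (q + t)) by ring.
apply: le_trans (ler_normD _ _) _.
have := ler_normB (coef (hull_system w) k s - coef N k (q + s))
  (coef (hull_system w) k t - coef N k (q + t)).
lra.
Qed.

Definition system_of_coef (l : coef_index m -> R -> R) : nicholson R m :=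
  Nicholson (fun i => l (inl (inl i))) (fun i j => l (inl (inr (i, j))))
    (fun i => l (inr (inl i))) (fun i => l (inr (inr i))).

Lemma coef_system_of_coef l k : coef (system_of_coef l) k = l k.
Proof. by case: k => [[i|[i j]]|[i|i]]. Qed.

(** Along an ultrafilter each coordinate converges at each time by boundedness; the common modulus
    makes this uniform on segments, and the limit is again approximated by translates. *)
Lemma hull_compact N C c0 : almost_periodic_system N -> admissible N C c0 ->
  compact (hull (coef_path N)).
Proof.
move=> apN aN; rewrite compact_ultra => F FU FO.
have FP : ProperFilter F := ultra_proper.
have C0 := adm_C aN.
have /choice[l' Hl'] : forall kt : coef_index m * R, exists l : R, forall e, 0 < e ->
    F [set w | `|coef (hull_system w) kt.1 kt.2 - l| < e].
  move=> [k t] /=; apply: (@ultrafilter_limit R _ F _ C FU).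
  apply: filterS FO => w /(hull_admissible apN aN) aw.
  case: k => [[i|[i j]]|[i|i]] /=.
  - by have /andP[? ?] := decay_bnd aw i t; rewrite ger0_norm.
  - by have /andP[? ?] := migration_bnd aw i j t; rewrite ger0_norm.
  - by have /andP[? ?] := birth_bnd aw i t; rewrite ger0_norm.
  - have /andP[? ?] := crowding_bnd aw i t; rewrite ger0_norm//.
    exact: (crowding_ge0 aw).
pose l k t := l' (k, t).
have Hl k t e : 0 < e -> F [set w | `|coef (hull_system w) k t - l k t| < e] := Hl' (k, t) e.
pose w : paths R m := coef_path (system_of_coef l).
have wE : hull_system w = system_of_coef l by exact: hull_system_coef_path.
have unif c e : 0 < e -> F [set w' | forall t, - c <= t <= c ->
    coefs_close (hull_system w') (hull_system w) e t].
  move=> e0.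
  have : F [set w' | forall k t, - c <= t <= c -> `|coef (hull_system w') k t - l k t| <= e].
    apply: (@filter_forall _ (coef_index m)
      (fun k w' => forall t, - c <= t <= c -> `|coef (hull_system w') k t - l k t| <= e)) => k.
    apply: (@equicontinuous_limit R _ F (fun w' => coef (hull_system w') k) (l k) (- c) c) => //.
      by move=> t z _; exact: Hl.
    move=> z z0; have [d d0 Hd] := hull_equicontinuous apN z0; exists d => //.
    by apply: filterS FO => w' /Hd H s t _ _; exact: H.
  apply: filterS => w' H t tc; apply/coefs_closeP => k; rewrite wE coef_system_of_coef.
  exact: H.
have wc : continuous (w : R -> coefs R m).
  apply: coef_path_continuous => k t; apply/cvgrPdist_le => e e0.
  have e3 : 0 < e / 3 by rewrite divr_gt0.
  have [d d0 Hd] := hull_equicontinuous apN e3.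
  apply: filterS (nbhsx_ballx t d d0) => u tu; rewrite wE coef_system_of_coef.
  have [w' [[wH h1] h2]] := filter_ex (filterI (filterI FO (Hl k t _ e3)) (Hl k u _ e3)).
  have h3 := Hd _ wH k t u tu.
  have -> : l k t - l k u =
     (coef (hull_system w') k u - l k u) - (coef (hull_system w') k t - l k t)
     + (coef (hull_system w') k t - coef (hull_system w') k u) by ring.
  apply: le_trans (ler_normD _ _) _.
  have := ler_normB (coef (hull_system w') k u - l k u) (coef (hull_system w') k t - l k t).
  by move: h1 h2 => /=; lra.
exists w; split.
  apply: hullP => // c e e0; have e2 : 0 < e / 2 by rewrite divr_gt0.
  have [w' [wH Hw']] := filter_ex (filterI FO (unif c _ e2)).
  have [s _ Hs] := hull_approx c 0 apN wH e2; exists s => u uc.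
  rewrite (splitr e); apply: coefs_close_trans (Hs u uc).
  exact/coefs_close_sym/Hw'.
move=> U /(nbhs_path_ball wc)[c [e [e0 HU]]].
have e2 : 0 < e / 2 by rewrite divr_gt0.
apply: filterS (unif c _ e2) => w' Hw'; apply: HU => t tc.
apply: (@ball_coefs_close _ _ (e / 2)); first by rewrite ltW//= ltr_pdivrMr//; lra.
exact/coefs_close_sym/Hw'.
Qed.

End Hull.

(** * Topology of the state space and compact sets of states *)

Section StateSpace.
Variables (R : realType) (m : nat) (r : 'I_m -> R).
Hypothesis r_gt0 : forall i, 0 < r i.
Implicit Types phi psi : state R m.

(** The bound runs over the whole line, like the uniform topology of [state]; members of X all
    vanish outside their interval. *)
Definition state_ball phi (e : R) : set (state R m) :=
  [set psi | forall i s, `|phi i s - psi i s| < e].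

Lemma state_ball_nbhs phi e : 0 < e -> nbhs phi (state_ball phi e).
Proof.
move=> e0; apply/uniform_nbhs.
exists [set fg | forall t : R, setT t -> ball (fg.1 t : R) e (fg.2 t)]; split.
  rewrite uniform_entourage; exists [set xy | ball xy.1 e xy.2] => //.
  exact: entourage_ball (PosNum e0).
by move=> psi /= H i s; exact: (H i I s I).
Qed.

Lemma nbhs_state_ball phi U : nbhs phi U -> exists2 e : R, 0 < e & state_ball phi e `<=` U.
Proof.
move=> /uniform_nbhs[E [entE EU]].
move: entE; rewrite uniform_entourage => -[P entP PE].
move: entP; rewrite -entourage_ballE => -[e /= e0 He].
exists e => // psi H; apply: EU => i _; apply: PE => s _; apply: (He (_, _)) => /=.
exact: H.
Qed.

Lemma state_hausdorff : hausdorff_space (state R m).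
Proof.
move=> p q pq; apply/funext => i; apply/funext => s; apply/eqP; rewrite -subr_eq0 -normr_le0.
apply/ler_addgt0Pl => e e0; rewrite addr0; have e2 : 0 < e / 2 by rewrite divr_gt0.
have [f [fp fq]] := pq _ _ (state_ball_nbhs p e2) (state_ball_nbhs q e2).
have h1 := fp i s; have h2 := fq i s.
have -> : p i s - q i s = (p i s - f i s) - (q i s - f i s) by ring.
by have := ler_normB (p i s - f i s) (q i s - f i s); lra.
Qed.

Lemma stateX_outside phi : stateX r phi -> forall i s, ~ (- r i <= s <= 0) -> phi i s = 0.
Proof.
move=> pX i s ns; rewrite (pX i).2 patchE; case: ifPn => //.
by rewrite inE /= in_itv/= => /ns.
Qed.

Definition lipschitz_states (M K L : R) : set (state R m) :=
  [set phi | stateX r phi /\ forall i, (forall s, - r i <= s <= 0 -> M <= phi i s <= K) /\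
     forall s u, - r i <= s <= 0 -> - r i <= u <= 0 -> `|phi i s - phi i u| <= L * `|s - u|].

Lemma lipschitz_states_int M K L : 0 < M -> lipschitz_states M K L `<=` stateX_int r.
Proof.
move=> M0 phi [pX H]; split => // i s; rewrite in_itv/= => /(H i).1/andP[h _].
exact: lt_le_trans h.
Qed.

(** Ascoli again: pointwise limits along an ultrafilter, with equicontinuity provided by the
    Lipschitz constant. *)
Lemma lipschitz_states_compact M K L : 0 < L -> compact (lipschitz_states M K L).
Proof.
move=> L0; rewrite compact_ultra => F FU FB.
have FP : ProperFilter F := ultra_proper.
have /choice[l' Hl'] : forall p : 'I_m * R, exists l : R, - r p.1 <= p.2 <= 0 -> forall e, 0 < e ->
    F [set phi : state R m | `|phi p.1 p.2 - l| < e].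
  move=> [i s] /=; have [rs|/negP rs] := boolP (- r i <= s <= 0); last by exists 0.
  have [|l Hl] := @ultrafilter_limit R _ F (fun phi : state R m => phi i s) (`|M| + `|K|) FU.
    apply: filterS FB => phi [_ /(_ i)[/(_ s rs)/andP[h1 h2] _]] /=.
    rewrite ler_norml; have := ler_norm K; have := ler_norm (- M); rewrite normrN => h3 h4.
    by have := normr_ge0 K; have := normr_ge0 M; move=> ? ?; apply/andP; split; lra.
  by exists l => _.
pose l i s := l' (i, s).
have Hl i s e : - r i <= s <= 0 -> 0 < e -> F [set phi : state R m | `|phi i s - l i s| < e] :=
  fun rs => Hl' (i, s) rs e.
(* Outside the interval [l] is arbitrary; the restriction supplies the extension by 0 required by
   [stateX]. *)
pose phi : state R m := fun i => (l i) \_ `[- r i, 0].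
have phiE i s : - r i <= s <= 0 -> phi i s = l i s.
  by move=> rs; rewrite /phi patchE mem_set//= in_itv.
have lM i s : - r i <= s <= 0 -> M <= l i s <= K.
  move=> rs; apply/andP; split; apply/ler_addgt0Pl => e e0;
    have [psi [h [_ /(_ i)[/(_ s rs)/andP[h1 h2] _]]]] := filter_ex (filterI (Hl i s e rs e0) FB);
    by move: h; rewrite /= ltr_norml => /andP[]; lra.
have lL i s u : - r i <= s <= 0 -> - r i <= u <= 0 -> `|l i s - l i u| <= L * `|s - u|.
  move=> rs ru; apply/ler_addgt0Pl => e e0; have e2 : 0 < e / 2 by rewrite divr_gt0.
  have [psi [[h1 h2] [_ /(_ i)[_ /(_ s u rs ru) h3]]]] :=
    filter_ex (filterI (filterI (Hl i s _ rs e2) (Hl i u _ ru e2)) FB).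
  have -> : l i s - l i u = (psi i u - l i u) - (psi i s - l i s) + (psi i s - psi i u) by ring.
  apply: le_trans (ler_normD _ _) _; have := ler_normB (psi i u - l i u) (psi i s - l i s).
  by move: h1 h2 => /=; lra.
have pX : stateX r phi.
  move=> i; split; last by apply/funext => u; rewrite /phi /= !patchE; case: ifPn => // ->.
  apply/subspace_continuousP => s rs; apply/cvgrPdist_lt => e e0.
  have eL : 0 < e / L by rewrite divr_gt0.
  have H : nbhs s [set u | `[- r i, 0]%classic u -> `|phi i s - phi i u| < e].
    apply: filterS (nbhsx_ballx s _ eL) => u su ru.
    move: rs ru; rewrite /= !in_itv/= => rs ru; rewrite !phiE//.
    apply: le_lt_trans (lL i s u rs ru) _; by rewrite mulrC -ltr_pdivlMr.
  exact: H.
exists phi; split.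
  split => // i; split => [s rs|s u rs ru]; first by rewrite phiE//; exact: lM.
  by rewrite !phiE//; exact: lL.
move=> U /nbhs_state_ball[e e0 HU]; have e2 : 0 < e / 2 by rewrite divr_gt0.
have : F [set psi : state R m | forall i s, - r i <= s <= 0 -> `|psi i s - l i s| <= e / 2].
  apply: (@filter_forall _ 'I_m (fun i (psi : state R m) =>
    forall s, - r i <= s <= 0 -> `|psi i s - l i s| <= e / 2)) => i.
  apply: (@equicontinuous_limit R _ F (fun psi : state R m => psi i) (l i) (- r i) 0) => //.
    by move=> t z rt z0; exact: Hl.
  move=> z z0; exists (z / L); first by rewrite divr_gt0.
  apply: filterS FB => psi [_ /(_ i)[_ h]] s t rs rt st.
  by apply: le_trans (h s t rs rt) _; rewrite mulrC -ler_pdivlMr// ltW.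
move=> H; apply: filterS (filterI FB H) => psi [[psiX _] Hpsi]; apply: HU => i s.
have [rs|/negP rs] := boolP (- r i <= s <= 0).
  by rewrite phiE// distrC; apply: le_lt_trans (Hpsi i s rs) _; rewrite ltr_pdivrMr//; lra.
by rewrite (stateX_outside pX)// (stateX_outside psiX)// subrr normr0.
Qed.

(** Both bounds are encoded by one parameter, [e <= phi i u <= e^-1]. For small [e] this holds
    throughout a neighborhood of each state, so compactness yields a common [e]. *)
Lemma compact_uniform_bounds (X1 : set (state R m)) : compact X1 -> X1 `<=` stateX_int r ->
  exists mu K0 : R, 0 < mu /\ forall phi, X1 phi ->
    forall i u, - r i <= u <= 0 -> mu <= phi i u <= K0.
Proof.
move=> /compact_near_coveringP/near_covering_withinP cX XI.
have H := cX R (0 : R)^'+ (fun e phi => forall i u, - r i <= u <= 0 -> e <= phi i u <= e^-1) _.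
have [d /= d0 Hd] : \forall e \near (0 : R)^'+, X1 `<=`
    (fun phi => forall i u, - r i <= u <= 0 -> e <= phi i u <= e^-1).
  apply: H => phi Xphi; have [mu [K [mu0 HmuK]]] := stateX_int_bounds r_gt0 (XI _ Xphi).
  have mu2 : 0 < mu / 2 by rewrite divr_gt0.
  pose d := Num.min (mu / 2) (`|K| + mu)^-1.
  have Kmu : 0 < `|K| + mu by rewrite ltr_wpDl.
  have d0 : 0 < d by rewrite lt_min mu2 invr_gt0.
  exists (state_ball phi (mu / 2), [set e | 0 < e < d]).
    split; first exact: state_ball_nbhs.
    exists d => //= e /=; rewrite sub0r normrN => ed e0.
    by rewrite e0; move: ed; rewrite gtr0_norm.
  move=> [psi e] /= [Hpsi /andP[e0 ed]] _ i u ru.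
  have /andP[h1 h2] := HmuK i u ru; have := Hpsi i u; rewrite ltr_norml => /andP[h3 h4].
  have em : e < mu / 2 by apply: lt_le_trans ed _; rewrite ge_min lexx.
  have eK : e < (`|K| + mu)^-1 by apply: lt_le_trans ed _; rewrite ge_min lexx orbT.
  apply/andP; split; first lra.
  rewrite -[e^-1]div1r ler_pdivlMr//.
  have psi0 : 0 <= psi i u by lra.
  apply: (@le_trans _ _ ((`|K| + mu) * (`|K| + mu)^-1)); last by rewrite divff// gt_eqF.
  by apply: ler_pM => //; [exact: ltW|have := ler_norm K; lra|exact: ltW].
exists (d / 2), (d / 2)^-1; split; first by rewrite divr_gt0.
by apply: Hd => //=; rewrite ?divr_gt0// sub0r normrN gtr0_norm ?divr_gt0// ltr_pdivrMr//; lra.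
Qed.

Lemma sup_dist_le phi psi (e : R) : (0 < m)%N ->
  (forall i s, `|phi i s - psi i s| <= e) -> sup_dist r phi psi <= e.
Proof.
move=> m0 H; apply: ge_sup; last by move=> _ [p _ <-].
exists `|phi (Ordinal m0) 0 - psi (Ordinal m0) 0|; exists (Ordinal m0, 0) => //=.
by rewrite in_itv/= lexx oppr_le0 ltW.
Qed.

End StateSpace.

Lemma solution_lipschitz (R : realType) (m : nat) (r : 'I_m -> R) (N : nicholson R m)
    (C c0 : R) (phi : state R m) y (K a : R) :
  (forall i, 0 < r i) -> admissible N C c0 -> stateX_int r phi -> is_solution N r phi y ->
  0 < a -> (forall i t, a - r i <= t -> y i t <= K) ->
  forall i s u, a <= s -> a <= u -> `|y i s - y i u| <= (C + m%:R * C + C) * K * `|s - u|.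
Proof.
move=> r_gt0 aN pI ys a0 yK i.
have y0 := solution_gt0 r_gt0 aN pI ys; have C0 := ltW (adm_C aN).
set L := (_ * K).
have rhs_le t : a <= t -> `|nicholson_rhs N r y i t| <= L.
  move=> at_; have yt j : 0 <= y j t <= K.
    have := r_gt0 j => rj; apply/andP; split; first by apply/ltW/y0; lra.
    by apply: yK; lra.
  have ri := r_gt0 i.
  have yr0 : 0 <= y i (t - r i) by apply/ltW/y0; lra.
  have yrK : y i (t - r i) <= K by apply: yK; lra.
  have bnd x z : 0 <= x <= C -> 0 <= z <= K -> 0 <= x * z <= C * K.
    by move=> /andP[x0 xC] /andP[z0 zK]; rewrite mulr_ge0//=; apply: ler_pM.
  have /andP[h1 h2] := bnd _ _ (decay_bnd aN i t) (yt i).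
  have ric : 0 <= ricker (crowding N i t) (y i (t - r i)) <= K.
    by rewrite ricker_ge0//=; apply: le_trans yrK; apply: ricker_le => //; exact: (crowding_ge0 aN).
  have /andP[h3 h4] := bnd _ _ (birth_bnd aN i t) ric.
  have h5 : 0 <= \sum_(j < m) migration N i j t * y j t.
    by apply: sumr_ge0 => j _; have /andP[] := bnd _ _ (migration_bnd aN i j t) (yt j).
  have h6 : \sum_(j < m) migration N i j t * y j t <= m%:R * (C * K).
    apply: (@le_trans _ _ (\sum_(j < m) C * K)); last by rewrite sumr_const card_ord mulr_natl.
    by apply: ler_sum => j _; have /andP[] := bnd _ _ (migration_bnd aN i j t) (yt j).
  rewrite rhsE /L !mulrDl -mulrA ler_norml; apply/andP; split; lra.
suff H s u : a <= s -> s <= u -> `|y i s - y i u| <= L * `|s - u|.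
  move=> s u sa ua; case: (leP s u) => [|/ltW] h; first exact: H.
  by rewrite distrC (distrC s); exact: H.
move=> sa us; rewrite distrC (distrC s) (ger0_norm (_ : 0 <= u - s)) ?subr_ge0//.
have yd x : s <= x <= u -> is_derive x 1 (y i) (nicholson_rhs N r y i x).
  by move=> /andP[sx _]; apply: (solution_derive ys); lra.
have Ld (x : R) : is_derive x 1 (fun x : R => L * x) L.
  by apply: is_derive_eq (is_deriveZ L (is_derive_id x (1 : R))) _; rewrite /GRing.scale/= mulr1.
rewrite ler_norml; apply/andP; split.
  have D x : s <= x <= u -> is_derive x 1 (fun x => y i x + L * x) (nicholson_rhs N r y i x + L).
    by move=> sxu; have h1 := yd x sxu; exact: is_deriveD h1 (Ld x).
  have : y i s + L * s <= y i u + L * u.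
    apply: (derive_ge0_le us D) => x /andP[sx _].
    by have := rhs_le x (le_trans sa sx); rewrite ler_norml => /andP[]; lra.
  lra.
have D x : s <= x <= u -> is_derive x 1 (fun x => L * x - y i x) (L - nicholson_rhs N r y i x).
  by move=> sxu; have h1 := yd x sxu; exact: is_deriveB (Ld x) h1.
have : L * s - y i s <= L * u - y i u.
  apply: (derive_ge0_le us D) => x /andP[sx _].
  by have := rhs_le x (le_trans sa sx); rewrite ler_norml => /andP[]; lra.
lra.
Qed.

(** * The global attractor *)

Lemma hausdorff_pair (T1 T2 : topologicalType) :
  hausdorff_space T1 -> hausdorff_space T2 -> hausdorff_space (T1 * T2)%type.
Proof.
move=> h1 h2 [p1 p2] [q1 q2] pq; congr pair.
  apply: h1 => A B nA nB.
  have HA : nbhs (p1, p2) (A `*` setT) by exists (A, setT) => //; split => //; exact: filterT.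
  have HB : nbhs (q1, q2) (B `*` setT) by exists (B, setT) => //; split => //; exact: filterT.
  by have [[x y] [[/= xA _] [xB _]]] := pq _ _ HA HB; exists x.
apply: h2 => A B nA nB.
have HA : nbhs (p1, p2) (setT `*` A) by exists (setT, A) => //; split => //; exact: filterT.
have HB : nbhs (q1, q2) (setT `*` B) by exists (setT, B) => //; split => //; exact: filterT.
by have [[x y] [[/= _ xA] [_ xB]]] := pq _ _ HA HB; exists y.
Qed.

(** Otherwise the differences of [Q n] and [U] generate a proper filter, which clusters at some [z]
    in the compact [Q 0]. As the [Q n] are closed, [z] belongs to all of them, and then [U] contains
    the part of [Q 0] near [z]. *)
Lemma decreasing_compacts (T : topologicalType) (Q : nat -> set T) (U : set T) :
  hausdorff_space T -> (forall n, compact (Q n)) -> (forall n, Q n.+1 `<=` Q n) ->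
  (forall z, (forall n, Q n z) -> within (Q 0%N) (nbhs z) U) ->
  exists n, Q n `<=` U.
Proof.
move=> hT cQ dQ QU; apply: contrapT => /forallNP H.
have mono n k : (n <= k)%N -> Q k `<=` Q n.
  move=> /subnK <-; elim: (k - n)%N => [//|j IH].
  by rewrite addSn; apply: subset_trans IH; exact: dQ.
pose F := filter_from [set: nat] (fun n => Q n `\` U).
have FP : ProperFilter F.
  apply: filter_from_proper; last first.
    move=> n _; have /existsNP[z /not_implyP[Qz Uz]] := H n.
    by exists z.
  apply: filter_from_filter; first by exists 0%N.
  move=> n k _ _; exists (maxn n k) => // z [Qz Uz]; split; split => //.
    by apply: mono Qz; rewrite leq_maxl.
  by apply: mono Qz; rewrite leq_maxr.
have FQ n : F (Q n) by exists n => // z [].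
have [z [Qz Fz]] := cQ 0%N F FP (FQ 0%N).
have zQ n : Q n z.
  have /closure_id -> := compact_closed hT (cQ n).
  by move=> B nB; exact: Fz (FQ n) nB.
have F0 : F (Q 0%N `\` U) by exists 0%N.
by have [x [[Q0x nUx] Ux]] := Fz _ _ F0 (QU z zQ); apply: nUx; exact: Ux.
Qed.

(** * Attractor of a semiflow with a compact absorbing set *)

Section AbstractAttractor.
Variables (R : realType) (T : topologicalType) (f : R -> T -> T) (D K : set T) (t0 : R).
Hypotheses (hT : hausdorff_space T) (cK : compact K) (KD : K `<=` D) (t0_gt0 : 0 < t0).
Hypothesis f_add : forall s t z, 0 <= s -> 0 <= t -> D z -> f (s + t) z = f t (f s z).
Hypothesis f_cont : forall t, 0 <= t -> {within K, continuous (f t)}.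
Hypothesis f_absorb : forall t z, t0 <= t -> K z -> K (f t z).

(** Counting times from [t0] rather than 0 puts all these images inside [K] and makes them
    decrease. *)
Let Q (n : nat) : set T := f (n.+1%:R * t0) @` K.

Let nt0 n : 0 <= n%:R * t0. Proof. by rewrite mulr_ge0// ltW. Qed.

Definition attractor : set T := \bigcap_n Q n.

Let QK n : Q n `<=` K.
Proof.
move=> _ [z Kz <-]; apply: f_absorb => //.
by rewrite -natr1 mulrDl mul1r; have := nt0 n; lra.
Qed.

Let f_late n t z : 0 <= t -> K z -> n.+1%:R * t0 + t0 <= t -> Q n (f t z).
Proof.
move=> t_ge0 Kz tn; have := nt0 n.+1 => h; have t00 := t0_gt0.
exists (f (t - n.+1%:R * t0) z); first by apply: f_absorb => //; lra.
have h' : 0 <= t - n.+1%:R * t0 by lra.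
by rewrite -(f_add h' h (KD Kz)); congr (f _ z); ring.
Qed.

Let Qdecr n : Q n.+1 `<=` Q n.
Proof.
move=> _ [z Kz <-]; apply: f_late => //.
by rewrite -[n.+2%:R]natr1 mulrDl mul1r.
Qed.

Let Qcompact n : compact (Q n).
Proof. by apply: continuous_compact cK; apply: f_cont. Qed.

Let attractor_mem z : attractor z <-> forall n, Q n z.
Proof. by split => [H n|H n _]; exact: H. Qed.

Lemma attractor_sub : attractor `<=` K.
Proof. by move=> z /attractor_mem/(_ 0%N)/QK. Qed.

Lemma attractor_compact : compact attractor.
Proof.
apply: (@subclosed_compact _ _ (Q 0%N)) => //; last by move=> z /attractor_mem/(_ 0%N).
by apply: closed_bigI => n _; exact: compact_closed.
Qed.

Lemma attractor_attracts (U : set T) : (forall z, attractor z -> within K (nbhs z) U) ->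
  exists2 t1 : R, 0 <= t1 & forall t z, t1 <= t -> K z -> U (f t z).
Proof.
move=> AU; have [|n Hn] := @decreasing_compacts T Q U hT Qcompact Qdecr.
  move=> z /attractor_mem/AU; rewrite /within /= => H.
  by apply: filterS H => x Ux /QK/Ux.
have t00 := t0_gt0; exists (n.+1%:R * t0 + t0); first by have := nt0 n.+1; lra.
move=> t z tn Kz; apply/Hn/f_late => //.
by apply: le_trans tn; have := nt0 n.+1; lra.
Qed.

(** For the reverse inclusion, let [p] be outside the image. The points not sent to [p] by [f t]
    form a neighborhood of the attractor relative to [K], hence contain some [Q n]. But [p] is
    reached from [K] so late that the state a time [t] earlier is already in [Q n]. *)
Lemma attractor_invariant t : 0 <= t -> f t @` attractor = attractor.
Proof.
move=> t_ge0; rewrite eqEsubset; split.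
  move=> _ [z /attractor_mem Az <-]; apply/attractor_mem => n.
  have [k Kk <-] := Az n.+1; have h := nt0 n.+2.
  rewrite -(f_add h t_ge0 (KD Kk)); apply: f_late => //; first by rewrite addr_ge0.
  by rewrite -[n.+2%:R]natr1 mulrDl mul1r; lra.
move=> p Ap; apply: contrapT => np.
have AU z : attractor z -> within K (nbhs z) [set x | f t x <> p].
  move=> Az; have := f_cont t_ge0 => /subspace_continuousP/(_ z (attractor_sub Az)).
  move=> /(_ [set x | x <> p]) H; apply: H.
  have cl : closed [set p] by apply: accessible_closed_set1; exact: hausdorff_accessible.
  have op : open (~` [set p]) by exact: closed_openC.
  apply: open_nbhs_nbhs; split; first exact: op.
  by move=> ftz; apply: np; exists z.
have [|n Hn] := @decreasing_compacts T Q [set x | f t x <> p] hT Qcompact Qdecr.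
  move=> z /attractor_mem/AU; rewrite /within /= => H.
  by apply: filterS H => x Ux /QK/Ux.
(* The [k] additional steps cover the time [t] by which the orbit is rewound. *)
pose k := (Num.truncn (t / t0)).+1.
have tk : t <= k%:R * t0.
  have /andP[_ h] : (Num.truncn (t / t0))%:R <= t / t0 < k%:R.
    by apply: truncn_itv; rewrite divr_ge0// ltW.
  by rewrite ltr_pdivrMr// in h; exact: ltW.
have /attractor_mem/(_ (n + k + 1)%N)[z Kz zp] := Ap.
have E : (n + k + 1).+1%:R * t0 = (n.+1%:R * t0 + t0) + k%:R * t0.
  by rewrite -[(n + k + 1).+1%:R]natr1 !natrD -[n.+1%:R]natr1; ring.
have n0 := nt0 n.+1; have t00 := t0_gt0.
apply: (Hn (f ((n + k + 1).+1%:R * t0 - t) z)).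
  by apply: f_late => //; lra.
have h' : 0 <= (n + k + 1).+1%:R * t0 - t by lra.
by rewrite -(f_add h' t_ge0 (KD Kz)) subrK.
Qed.

End AbstractAttractor.

(** * The skew-product semiflow over the hull *)

Section SkewProduct.
Variables (R : realType) (m : nat) (r : 'I_m -> R) (N : nicholson R m) (C c0 : R).
Hypothesis r_gt0 : forall i, 0 < r i.
Hypothesis apN : almost_periodic_system N.
Hypothesis aN : admissible N C c0.
Local Notation Omega := (hull (coef_path N)).

Let hull_adm w : Omega w -> admissible (hull_system w) C c0.
Proof. exact: hull_admissible. Qed.

Let sol w phi := solution (hull_system w) r phi.

Let solP w phi : Omega w -> stateX_int r phi -> is_solution (hull_system w) r phi (sol w phi).
Proof. by move=> /hull_adm aw pI; exact: (solutionP r_gt0 aw pI). Qed.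

Lemma skew_product_domain t z : 0 <= t -> (Omega `*` stateX_int r) z ->
  (Omega `*` stateX_int r) (skew_product r t z).
Proof.
case: z => w phi t_ge0 [/= wO pI]; split => /=; first exact: hull_shift.
have ys := solP wO pI.
apply: segment_int => //; first by move=> i; have [] := ys i.
by move=> i u ru; exact: (solution_gt0 r_gt0 (hull_adm wO) pI ys).
Qed.

(** [solution] is chosen separately for each initial state, so the semigroup law rests on
    uniqueness: the shifted solution agrees with the one chosen for the shifted data. *)
Lemma skew_product_add s t z : 0 <= s -> 0 <= t -> (Omega `*` stateX_int r) z ->
  skew_product r (s + t) z = skew_product r t (skew_product r s z).
Proof.
case: z => w phi s_ge0 t_ge0 wpI; have [/= wO pI] := wpI; congr pair => /=.
  by apply/funext => u; rewrite /Defs.shift addrA.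
have [/= wO' pI'] := skew_product_domain s_ge0 wpI.
have ys := solution_shift (solP wO pI) s_ge0; rewrite -hull_system_shift in ys.
have E := solution_unique r_gt0 (hull_adm wO') pI' ys (solP wO' pI').
apply/funext => i; apply/funext => u; rewrite /segment !patchE.
case: ifPn => //; rewrite inE /= in_itv/= => /andP[ru u0].
have h : - r i <= t + u by lra.
by have /= E' := E i (t + u) h; rewrite /sol in E'; rewrite -E' addrA.
Qed.

(** [N'] is any admissible system, so the statement covers nearby points of the hull as well as the
    translates of [N] that approximate [w]. *)
Lemma continuous_dependence w phi t e : Omega w -> stateX_int r phi -> 0 <= t -> 0 < e ->
  exists2 d : R, 0 < d & forall N' phi' y', admissible N' C c0 -> stateX_int r phi' ->
    is_solution N' r phi' y' -> (forall i s, - r i <= s <= 0 -> `|phi i s - phi' i s| <= d) ->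
    (forall u, 0 < u <= t -> coefs_close (hull_system w) N' d u) ->
    forall i s, - r i <= s <= t -> `|sol w phi i s - y' i s| <= e.
Proof.
move=> wO pI t_ge0 e0; have ys := solP wO pI; have aw := hull_adm wO.
have [K HK] := solution_bounded r_gt0 aw pI ys t_ge0.
have HK' i s : - r i <= s <= t -> sol w phi i s <= `|K|.
  by move=> /HK/le_trans; apply; exact: ler_norm.
pose X := expR (growth_rate m C `|K| * t).
have g1 : 1 <= growth_rate m C `|K| by apply: growth_rate_ge1; [exact: ltW (adm_C aN)|].
have X1 : 1 <= X by rewrite -expR0 ler_expR mulr_ge0//; lra.
have X0 : 0 < X by exact: expR_gt0.
pose d := e / (2 * X); have d0 : 0 < d by rewrite divr_gt0// mulr_gt0.
have dE : 2 * d * X = e by rewrite /d; field; rewrite gt_eqF.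
exists d => // N' phi' y' aN' pI' ys' dphi dN i s /andP[rs st].
have [s0|s0] := leP 0 s.
  have s0t : 0 <= s <= t by rewrite s0.
  apply: le_trans (solution_dist r_gt0 aw aN' pI pI' ys ys' d0 dphi dN HK' i s0t) _.
  rewrite -dE; apply: ler_wpM2l; first by rewrite mulr_ge0// ltW.
  by rewrite ler_expR; apply: ler_wpM2l => //; lra.
have rs0 : - r i <= s <= 0 by rewrite rs ltW.
rewrite (solution_history ys)// (solution_history ys')//; apply: le_trans (dphi i s rs0) _.
rewrite -dE; have : d * 1 <= d * X by rewrite ler_wpM2l// ltW.
lra.
Qed.

Lemma skew_product_continuous t : 0 <= t ->
  {within Omega `*` stateX_int r, continuous (skew_product r t)}.
Proof.
move=> t_ge0; apply/subspace_continuousP => -[w phi] [/= wO pI] U [[U1 U2] /= [nU1 nU2] HU].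
have [c [e1 [e10 HU1]]] := nbhs_path_ball (shift_path_continuous (s := t) wO.1) nU1.
have [e2 e20 HU2] := nbhs_state_ball nU2.
have e2' : 0 < e2 / 2 by rewrite divr_gt0.
have [d d0 Hd] := continuous_dependence wO pI t_ge0 e2'.
have H : nbhs (w, phi) [set z | (Omega `*` stateX_int r) z -> U (skew_product r t z)].
  (* The first ball controls the shifted path on [-c, c], the second the coefficients that drive the
     solution up to time [t]. *)
  exists (path_ball w (`|c| + t) e1 `&` path_ball w t d, state_ball phi d).
    split => /=; last exact: state_ball_nbhs.
    by apply: filterI; apply: path_ball_nbhs => //; exact: wO.1.
  move=> [w' phi'] /= [[Hw1 Hw2] Hphi] [/= wO' pI'].
  apply: HU; split => /=.
    apply: HU1 => u /andP[u1 u2]; apply: Hw1; have := ler_norm c => h.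
    by apply/andP; split; lra.
  apply: HU2 => i u; rewrite /segment /=.
  have := Hd (hull_system w') phi' (sol w' phi') (hull_adm wO') pI' (solP wO' pI').
  move=> /(_ (fun i s _ => ltW (Hphi i s))) H.
  rewrite !patchE; case: ifPn; last by rewrite subrr normr0.
  rewrite inE /= in_itv/= => /andP[ru u0].
  apply: le_lt_trans (H _ i (t + u) _) _.
  - move=> v /andP[v0 vt]; apply: coefs_close_ball => //; apply: Hw2.
    by rewrite vt andbT; lra.
  - by apply/andP; split; lra.
  - by rewrite ltr_pdivrMr//; lra.
exact: H.
Qed.

Lemma skew_product_absorbing :
  (forall i t, 0 < birth N i t) ->
  (forall t i, 0 < decay N i t - \sum_(j < m) migration N j i t) ->
  uniformly_persistent N r ->
  exists M K L : R, [/\ 0 < M, 0 < L & forall mu K0 : R, 0 < mu -> exists2 T : R, 0 <= T &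
    forall t w phi, T <= t -> Omega w -> stateX_int r phi ->
      (forall i u, - r i <= u <= 0 -> mu <= phi i u <= K0) ->
      (Omega `*` lipschitz_states r M K L) (skew_product r t (w, phi))].
Proof.
move=> b0 a6 pers; have [M [K [s1 [M0 K0 HMK]]]] := uniform_bounds r_gt0 apN aN b0 a6 pers.
pose L := (C + m%:R * C + C) * K.
have C0 := adm_C aN.
have L0 : 0 < L.
  have : 0 <= m%:R * C by rewrite mulr_ge0// ltW.
  by move=> h; rewrite mulr_gt0//; lra.
exists M, K, L; split => // mu K1 mu0; have [T T0 HT] := HMK mu K1 mu0.
pose rmax := \sum_i r i.
have rm i : r i <= rmax.
  by rewrite /rmax (bigD1 i)//= lerDl sumr_ge0// => j _; exact: ltW.
have rm0 : 0 <= rmax by rewrite sumr_ge0// => j _; exact: ltW.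
(* One delay covers the segment, another the delayed values in the bound for the derivative; the 1
   keeps [t - rmax] positive. *)
exists (T + 2 * rmax + 1); first lra.
move=> t w phi tT wO pI phib.
(* The approximating translate may depend on [u] and [e], because [T] and the bounds are common to
   all late translates. *)
have bounds i u : T <= u -> M <= sol w phi i u <= K.
  move=> Tu; have u0 : 0 <= u by lra.
  have close e : 0 < e -> exists s : R, s1 <= s /\
      `|sol w phi i u - solution (shift_system N s) r phi i u| <= e.
    move=> e0; have [d d0 Hd] := continuous_dependence wO pI u0 e0.
    have [s ss Hs] := hull_approx u s1 apN wO d0.
    have aNs := shift_admissible s aN.
    exists s; split => //; apply: (Hd _ phi _ aNs pI (solutionP r_gt0 aNs pI)).
    - by move=> j v _; rewrite subrr normr0 ltW.
    - by move=> v /andP[v0 vu]; apply: Hs; rewrite vu andbT; lra.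
    - by have := r_gt0 i => ri; apply/andP; split; lra.
  apply/andP; split; apply/ler_addgt0Pl => e e0; have [s [ss]] := close e e0;
    have /andP[? ?] := HT s phi ss pI phib i u Tu; rewrite ler_norml => /andP[? ?]; lra.
have [/= wO' pI'] : (Omega `*` stateX_int r) (skew_product r t (w, phi)).
  by apply: skew_product_domain => //; lra.
split => //=; split; first exact: pI'.1.
have ys := solP wO pI.
move=> i; have segE s : - r i <= s <= 0 ->
    segment r (solution (hull_system w) r phi) t i s = sol w phi i (t + s).
  by move=> rs; rewrite /segment patchE mem_set//= in_itv.
have ri := rm i; split => [s rs|s u rs ru].
  by rewrite segE//; apply: bounds; have /andP[? ?] := rs; lra.
rewrite !segE//; have -> : s - u = (t + s) - (t + u) by ring.
apply: (solution_lipschitz (a := t - rmax) r_gt0 (hull_adm wO) pI ys).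
- lra.
- move=> j v jv; have rj := rm j; have h : T <= v by lra.
  by have /andP[] := bounds j v h.
- by have /andP[? ?] := rs; lra.
- by have /andP[? ?] := ru; lra.
Qed.

End SkewProduct.

Theorem theorem3p4 (R : realType) (m : nat) (N : nicholson R m) (r : 'I_m -> R)
    (m_gt0 : (0 < m)%N)
    (r_gt0 : forall i, 0 < r i)
    (a1 : [/\ forall i, almost_periodic (decay N i),
              forall i j, almost_periodic (migration N i j),
              forall i, almost_periodic (birth N i) &
              forall i, almost_periodic (crowding N i)])
    (a2 : exists2 d0 : R, 0 < d0 & forall t i, d0 <= decay N i t)
    (a3 : (forall i j t, 0 <= migration N i j t) /\
          (forall i t, migration N i i t = 0))
    (a4 : forall t i, 0 < birth N i t)
    (a5 : exists2 c0 : R, 0 < c0 & forall t i, c0 <= crowding N i t)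
    (a6 : forall t i, 0 < decay N i t - \sum_(j < m) migration N j i t)
    (persistent : uniformly_persistent N r) :
  let Omega := hull (coef_path N) in
  exists A : set (paths R m * state R m),
    [/\ compact A,
        A `<=` Omega `*` stateX_int r,
        (forall t, 0 <= t -> skew_product r t @` A = A) &
        forall X1 : set (state R m), compact X1 -> X1 `<=` stateX_int r ->
        forall dO : paths R m -> paths R m -> R, metrizes Omega dO ->
          hausdorff_semidist (max_dist dO (sup_dist r))
            (skew_product r t @` (Omega `*` X1)) A @[t --> +oo] --> 0%E].
Proof.
have [d0 d00 Hd0] := a2; have [a3' _] := a3; have [c0 c00 Hc0] := a5.
have b0 i t : 0 < birth N i t by exact: a4.
have [C aN] := almost_periodic_admissible a1 a2 a3' a4 c00 Hc0 a6.
have [M [K [L [M0 L0 absorb]]]] := skew_product_absorbing r_gt0 a1 aN b0 a6 persistent.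
move=> Omega.
pose B := lipschitz_states r M K L.
have BI : B `<=` stateX_int r by exact: lipschitz_states_int.
pose Q := Omega `*` B; pose D := Omega `*` stateX_int r.
have QD : Q `<=` D by move=> z [z1 /BI z2].
have cQ : compact Q.
  by apply: compact_setX; [exact: hull_compact a1 aN|exact: lipschitz_states_compact].
have hT : hausdorff_space (paths R m * state R m)%type.
  by apply: hausdorff_pair; [exact: paths_hausdorff|exact: state_hausdorff].
(* Members of [B] are themselves between [M] and [K], so [B] is absorbed by itself; [T + 1] is a
   positive absorption time. *)
have [T T0 HT] := absorb M K M0.
have T10 : 0 < T + 1 by lra.
have f_add s t z : 0 <= s -> 0 <= t -> D z ->
    skew_product r (s + t) z = skew_product r t (skew_product r s z).
  by move=> s0 t0 Dz; exact: (skew_product_add r_gt0 a1 aN).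
have f_contD (t : R) : 0 <= t -> {within D, continuous (skew_product r t)}.
  by move=> t0; exact: (skew_product_continuous r_gt0 a1 aN).
have f_cont (t : R) : 0 <= t -> {within Q, continuous (skew_product r t)}.
  by move=> t0; apply: continuous_subspaceW (f_contD t t0).
have f_absorb t z : T + 1 <= t -> Q z -> Q (skew_product r t z).
  case: z => w phi tT [/= wO phiB]; apply: HT => //; first by lra.
    exact: BI.
  by move=> i u ru; exact: (phiB.2 i).1.
exists (attractor (@skew_product R m r) Q (T + 1)).
have AQ := attractor_sub T10 f_absorb.
split.
- exact: (attractor_compact hT cQ T10 f_cont).
- by move=> z /AQ/QD.
- by move=> t t0; exact: (attractor_invariant hT cQ QD T10 f_add f_cont f_absorb).
move=> X1 cX XI dO dOm.
have [mu [K1 [mu0 HX]]] := compact_uniform_bounds r_gt0 cX XI.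
have [T1 T10' HT1] := absorb mu K1 mu0.
have close e : 0 < e -> exists t1 : R, forall t, t1 <= t ->
    (hausdorff_semidist (max_dist dO (sup_dist r)) (skew_product r t @` (Omega `*` X1))
      (attractor (@skew_product R m r) Q (T + 1)) <= e%:E)%E.
  move=> e0; have e2 : 0 < e / 2 by rewrite divr_gt0.
  have [dO_ge0 dO_sym _ dO_nbhs] := dOm.
  (* A neighborhood of the attractor relative to [Q]: [dO] induces the topology of the hull, and
     nothing outside the hull is involved. *)
  pose U := [set z | exists2 a, attractor (@skew_product R m r) Q (T + 1) a &
    max_dist dO (sup_dist r) z a <= e].
  have [|t1 t10 Ht1] := attractor_attracts hT cQ QD T10 f_add f_cont f_absorb (U := U).
    move=> [w phi] Az; have [/= wO phiB] := AQ _ Az.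
    have nw : within Omega (nbhs w) [set w' | Omega w' /\ dO w w' < e].
      by apply/(dO_nbhs _ _ wO); exists e.
    have H : nbhs (w, phi) [set z | Q z -> U z].
      exists ([set w' | Omega w' -> Omega w' /\ dO w w' < e], state_ball phi (e / 2)).
        by split => //=; exact: state_ball_nbhs.
      move=> [w' phi'] [/= Hw Hphi] [/= wO' _]; exists (w, phi) => //.
      rewrite /max_dist /= ge_max; apply/andP; split.
        by rewrite dO_sym//; apply/ltW; exact: (Hw wO').2.
      apply: sup_dist_le => // i s; rewrite distrC.
      by apply: le_trans (ltW (Hphi i s)) _; rewrite ler_pdivrMr//; lra.
    exact: H.
  (* After [T1] the image of [Omega] times [X1] is inside [Q]; after a further [t1] it is inside
     [U]. *)
  exists (T1 + t1) => t tT; rewrite /hausdorff_semidist ge_max lee_fin (ltW e0)/=.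
  apply: ge_ereal_sup => _ [z' [[w phi] [/= wO Xphi] <-] <-].
  have pI := XI _ Xphi.
  have h1 : Q (skew_product r T1 (w, phi)) by apply: HT1 => //; exact: HX.
  have -> : skew_product r t (w, phi) = skew_product r (t - T1) (skew_product r T1 (w, phi)).
    rewrite -f_add//; first by congr skew_product; ring.
    lra.
  have tT1 : t1 <= t - T1 by lra.
  have [a Aa za] := Ht1 _ _ tT1 h1.
  apply: le_trans (ereal_inf_lbound (ex_intro2 _ _ a Aa (erefl _))) _.
  by rewrite lee_fin.
have semidist_ge0 t : (0 <= hausdorff_semidist (max_dist dO (sup_dist r))
    (skew_product r t @` (Omega `*` X1)) (attractor (@skew_product R m r) Q (T + 1)))%E.
  by rewrite /hausdorff_semidist le_max lexx.
apply/fine_cvgP; split.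
  have [t1 Ht1] := close 1 ltr01.
  near=> t; rewrite ge0_fin_numE//; apply: le_lt_trans (Ht1 t _) (ltry 1).
  by near: t; apply: nbhs_pinfty_ge; exact: num_real.
apply/cvgrPdist_le => e e0; have [t1 Ht1] := close e e0.
near=> t; have h : t1 <= t by near: t; apply: nbhs_pinfty_ge; exact: num_real.
rewrite sub0r normrN ger0_norm ?fine_ge0//=.
rewrite -lee_fin fineK; first exact: Ht1.
by rewrite ge0_fin_numE//; apply: le_lt_trans (Ht1 t h) (ltry e).
Unshelve. all: by end_near. Qed.
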